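(* Let all distributions in $\mathcal M$ be equivalent (pairwise mutually absolutely continuous), let $Q\in\mathcal M$ and $m<\infty$. Let $\mathcal U$ be the set of a.s.-equivalence classes of measurable functions $u:\mathcal Z\to\mathbb R$ with $\|u\|_{L^\infty(Q)}\le m$, viewed as a subset of the ambient Hilbert space $L^2(Q)$. Define $\theta:\mathcal M\times\mathcal U\to L^2(Q_X)$ by $\theta(P',u')(x)=\mathrm{Var}_{P'}[u'(Z)\mid X=x]$. Fix $(P,u)\in\mathcal M\times\mathcal U$, suppose $\mathcal M$ is locally nonparametric at $P$, $\|dQ_X/dP_X\|_{L^\infty(P_X)}<\infty$ and $\|dP/dQ\|_{L^\infty(Q)}<\infty$. Then $\theta$ is totally pathwise differentiable at $(P,u)$ with $\dot\theta_{P,u}^*(w)=(\dot\nu_{P,u}^*(w),\dot\zeta_{P,u}^*(w))$, where $$\dot\nu_{P,u}^*(w)(z)=\frac{dQ_X}{dP_X}(x)\,w(x)\big[\{u(z)-E_P[u(Z)\mid X=x]\}^2-\theta(P,u)(x)\big],$$ $$\dot\zeta_{P,u}^*(w)(z)=2\,\frac{dP}{dQ}(z)\,\frac{dQ_X}{dP_X}(x)\,w(x)\,\{u(z)-E_P[u(Z)\mid X=x]\}.$$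
   Context: All Hilbert spaces are real. $\mathcal M$ is a set of probability distributions on a measurable space $\mathcal Z$. $X=\mathscr C(Z)$ for a measurable coarsening $\mathscr C:\mathcal Z\to\mathcal X$; $P_X=P\circ\mathscr C^{-1}$ is the law of $X$ when $Z\sim P$; $x=\mathscr C(z)$ whenever it appears with $z$. For $P\in\mathcal M$ and $s\in L^2(P)$, $\mathscr P(P,\mathcal M,s)$ is the collection of submodels $\{P_\epsilon:\epsilon\in[0,1]\}\subseteq\mathcal M$ with $P_{\epsilon=0}=P$ that are quadratic mean differentiable with score $s$ at $\epsilon=0$, i.e. $\int(\sqrt{dP_\epsilon}-\sqrt{dP}-\tfrac{\epsilon}{2}s\sqrt{dP})^2=o(\epsilon^2)$ as $\epsilon\to0$. The tangent set is $\check{\mathcal M}_P=\{s\in L^2(P):\mathscr P(P,\mathcal M,s)\neq\emptyset\}$ and the tangent space $\dot{\mathcal M}_P$ is the $L^2(P)$-closure of its linear span. $\mathcal M$ is locally nonparametric at $P$ if $\dot{\mathcal M}_P=\{s\in L^2(P):\int s\,dP=0\}$. For a subset $\mathcal U$ of a Hilbert space $\mathcal T$, $u\in\mathcal U$, $t\in\mathcal T$, $\mathscr P(u,\mathcal U,t)$ is the set of paths $\{u_\epsilon:\epsilon\in[0,1]\}\subseteq\mathcal U$ with $\|u_\epsilon-u-\epsilon t\|_{\mathcal T}=o(\epsilon)$; $\check{\mathcal U}_u=\{t\in\mathcal T:\mathscr P(u,\mathcal U,t)\ne\emptyset\}$ and $\dot{\mathcal U}_u$ is the $\mathcal T$-closure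 of its linear span. A map $\theta:\mathcal M\times\mathcal U\to\mathcal W$ ($\mathcal U\subseteq\mathcal T$; $\mathcal T,\mathcal W$ Hilbert) is totally pathwise differentiable at $(P,u)$ if there is a continuous linear $\dot\theta_{P,u}:\dot{\mathcal M}_P\oplus\dot{\mathcal U}_u\to\mathcal W$ such that for all $s\in\check{\mathcal M}_P$, $t\in\check{\mathcal U}_u$, $\{P_\epsilon\}\in\mathscr P(P,\mathcal M,s)$, $\{u_\epsilon\}\in\mathscr P(u,\mathcal U,t)$, $\|\theta(P_\epsilon,u_\epsilon)-\theta(P,u)-\epsilon\,\dot\theta_{P,u}(s,t)\|_{\mathcal W}=o(\epsilon)$. Its Hermitian adjoint is $\dot\theta_{P,u}^*:\mathcal W\to\dot{\mathcal M}_P\oplus\dot{\mathcal U}_u$. Here $\mathcal T=L^2(Q)$ and $\mathcal W=L^2(Q_X)$. *)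

(* Defs.v *)
From HB Require Import structures.
From mathcomp Require Import all_boot all_order all_algebra.
From mathcomp Require Import all_classical all_reals all_analysis.

Set Implicit Arguments.
Unset Strict Implicit.
Unset Printing Implicit Defensive.
Import Order.TTheory GRing.Theory Num.Theory.
Import numFieldNormedType.Exports.

Local Open Scope classical_set_scope.
Local Open Scope ring_scope.
Local Open Scope charge_scope.

(* An element of L^2(mu) is represented by any of its measurable
   representatives; every notion below is invariant under mu-a.e. equality. *)
Section L2.
Context d (T : measurableType d) (R : realType).
Variable mu : {measure set T -> \bar R}.

Definition L2 : set (T -> R) := [set f | f \in Lfun mu 2%:E].

Definition L2norm (f : T -> R) : \bar R := 'N[mu]_(2%:E)[EFin \o f].

Definition L2dot (f g : T -> R) : R := \int[mu]_z (f z * g z).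

Definition linear_span (S : set (T -> R)) : set (T -> R) :=
  [set f | exists n (c : 'I_n -> R) (g : 'I_n -> T -> R),
    (forall i, S (g i)) /\ f = (fun z => \sum_(i < n) c i * g i z)].

Definition L2closure (S : set (T -> R)) : set (T -> R) :=
  [set f | L2 f /\
    forall e : R, 0 < e -> exists2 g, S g & (L2norm (f \- g)%R < e%:E)%E].

Definition Linfty_ball (m : R) : set (T -> R) :=
  [set f | measurable_fun setT f /\ ('N[mu]_+oo[EFin \o f] <= m%:E)%E].

End L2.

(* r e = o(e ^ k) as e decreases to 0; r is extended-real valued so that an
   infinite remainder is not silently read as 0. *)
Definition littleo_at0 (R : realType) (r : R -> \bar R) (k : nat) : Prop :=
  (r e * (e ^- k)%:E)%E @[e --> 0^'+] --> 0%E.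

Definition RNderiv d (T : measurableType d) (R : realType)
    (nu mu : {finite_measure set T -> \bar R}) : T -> \bar R :=
  'd (charge_of_finite_measure nu) '/d mu.

Definition density d (T : measurableType d) (R : realType)
    (nu mu : {finite_measure set T -> \bar R}) (z : T) : R :=
  fine (RNderiv nu mu z).

Section conditional.
Context d d' (Z : measurableType d) (X : measurableType d') (R : realType).
Variables (P : probability Z R) (C : {mfun Z >-> X}).

(* g is a version of x |-> E_P[f(Z) | C(Z) = x] *)
Definition is_cond_exp (f : Z -> R) (g : X -> R) : Prop :=
  (distribution P C).-integrable setT (EFin \o g) /\
  forall B, measurable B ->
    (\int[P]_(z in C @^-1` B) (f z)%:E =
     \int[distribution P C]_(x in B) (g x)%:E)%E.

(* Versions exist for every P-integrable f (cond_expP) and are unique up to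
   equality almost everywhere for the law of C. *)
Definition cond_exp (f : Z -> R) : X -> R := xget (cst 0) (is_cond_exp f).

Definition cond_var (f : Z -> R) : X -> R :=
  cond_exp (fun z => (f z - cond_exp f (C z)) ^+ 2).

Lemma cond_expP (f : Z -> R) :
  P.-integrable setT (EFin \o f) -> is_cond_exp f (cond_exp f).
Proof.
move=> intf; rewrite /cond_exp; case: xgetP => // nex; exfalso.
pose nu : {charge set X -> \bar R} :=
  measure_function_pushforward__canonical__charge_Charge
    (induced_charge intf) (measurable_funPT C).
have dom : nu `<< distribution P C.
  apply/null_content_dominatesP => B mB PB0.
  have mCB : measurable (C @^-1` B) by exact: measurable_funPTI.
  apply: null_set_integral => //.
  exact: measurable_funS measurableT _ (measurable_int P intf).
pose h := 'd nu '/d (distribution P C).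
have hE : EFin \o (fine \o h) = h.
  by apply/funext => x /=; rewrite fineK// Radon_Nikodym_fin_num.
apply: (nex (fine \o h)); split.
  by rewrite hE; exact: Radon_Nikodym_integrable.
move=> B mB; have := Radon_Nikodym_integral dom mB.
by rewrite -/h -hE.
Qed.

End conditional.

Section measure_add_finite.
Context d (T : measurableType d) (R : realType).
Variables m1 m2 : {finite_measure set T -> \bar R}.

Let measure_add_fin : fin_num_fun (measure_add m1 m2).
Proof.
by move=> A mA; rewrite measure_addE/= fin_numD !fin_num_measure.
Qed.

HB.instance Definition _ := Measure.on (measure_add m1 m2).
HB.instance Definition _ :=
  Measure_isFinite.Build _ _ _ (measure_add m1 m2) measure_add_fin.

End measure_add_finite.

Section model.
Context d (Z : measurableType d) (R : realType).
Implicit Types (M : set (probability Z R)) (P : probability Z R).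

(* The integral of (sqrt dP' - sqrt dP - (e/2) s sqrt dP)^2, computed with
   respect to the dominating measure P + P'; its value does not depend on the
   dominating measure. *)
Definition qmd_remainder P (P' : probability Z R) (s : Z -> R) (e : R) :
    \bar R :=
  let la : {finite_measure set Z -> \bar R} := measure_add P P' in
  (\int[la]_z ((Num.sqrt (density P' la z) - Num.sqrt (density P la z)
      - e / 2 * s z * Num.sqrt (density P la z)) ^+ 2)%:E)%E.

Definition submodel M P (s : Z -> R) : set (R -> probability Z R) :=
  [set Pe | [/\ forall e, 0 <= e <= 1 -> M (Pe e), Pe 0 = P &
    littleo_at0 (fun e => qmd_remainder P (Pe e) s e) 2]].

Definition model_tangent_set M P : set (Z -> R) :=
  [set s | L2 P s /\ submodel M P s !=set0].

Definition model_tangent_space M P : set (Z -> R) :=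
  L2closure P (linear_span (model_tangent_set M P)).

Definition locally_nonparametric M P : Prop :=
  model_tangent_space M P = [set s | L2 P s /\ \int[P]_z s z = 0].

End model.

Section hilbert.
Context d (T : measurableType d) (R : realType).
Variables (mu : {measure set T -> \bar R}) (U : set (T -> R)) (u : T -> R).

Definition L2path (t : T -> R) : set (R -> T -> R) :=
  [set ue | (forall e, 0 <= e <= 1 -> U (ue e)) /\
    littleo_at0 (fun e => L2norm mu (fun z => ue e z - u z - e * t z)) 1].

Definition L2tangent_set : set (T -> R) :=
  [set t | L2 mu t /\ L2path t !=set0].

Definition L2tangent_space : set (T -> R) :=
  L2closure mu (linear_span L2tangent_set).

End hilbert.

Section total_derivative.
Context d1 d2 d3 (Z : measurableType d1) (T : measurableType d2)
  (Y : measurableType d3) (R : realType).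
Variables (M : set (probability Z R)) (mu : {measure set T -> \bar R})
  (U : set (T -> R)) (nu : {measure set Y -> \bar R})
  (theta : probability Z R -> (T -> R) -> Y -> R)
  (P : probability Z R) (u : T -> R).

Let dotM := model_tangent_space M P.
Let dotU := L2tangent_space mu U u.

(* D is a continuous linear map from the Hilbert sum of dotM and dotU to
   L^2(nu). *)
Definition continuous_linear (D : (Z -> R) -> (T -> R) -> Y -> R) : Prop :=
  [/\ forall s t, dotM s -> dotU t -> L2 nu (D s t),
      forall (a : R) s1 s2 t1 t2, dotM s1 -> dotM s2 -> dotU t1 -> dotU t2 ->
        D (fun z => a * s1 z + s2 z) (fun z => a * t1 z + t2 z) =
        (fun y => a * D s1 t1 y + D s2 t2 y) %[ae nu] &
      forall s t, dotM s -> dotU t -> forall e : R, 0 < e ->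
        exists2 del : R, 0 < del & forall s' t', dotM s' -> dotU t' ->
          (L2norm P (s' \- s)%R ^+ 2 + L2norm mu (t' \- t)%R ^+ 2 <
            (del ^+ 2)%:E)%E ->
          (L2norm nu (D s' t' \- D s t)%R < e%:E)%E].

(* The first clause says that theta takes its values in L^2(nu). *)
Definition is_total_derivative (D : (Z -> R) -> (T -> R) -> Y -> R) : Prop :=
  [/\ forall P' u', M P' -> U u' -> L2 nu (theta P' u'),
      continuous_linear D &
      forall s t Pe ue,
        model_tangent_set M P s -> L2tangent_set mu U u t ->
        submodel M P s Pe -> L2path mu U u t ue ->
        littleo_at0 (fun e => L2norm nu
          (fun y => theta (Pe e) (ue e) y - theta P u y - e * D s t y)) 1].

Definition totally_pathwise_differentiable : Prop :=
  exists D, is_total_derivative D.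

Definition is_adjoint (D : (Z -> R) -> (T -> R) -> Y -> R)
    (A : (Y -> R) -> (Z -> R) * (T -> R)) : Prop :=
  forall w, L2 nu w ->
    [/\ dotM (A w).1, dotU (A w).2 &
        forall s t, dotM s -> dotU t ->
          L2dot nu (D s t) w = L2dot P s (A w).1 + L2dot mu t (A w).2].

End total_derivative.

(* Main.v *)
Require Import Defs.
From HB Require Import structures.
From mathcomp Require Import all_boot all_order all_algebra.
From mathcomp Require Import all_classical all_reals all_analysis.
From mathcomp Require Import measurable_realfun ess_sup_inf.
From mathcomp Require Import ring lra.

(* Write [dP_e = g^2 dP] with [g = 1 + e s / 2 + r] and
   [u_e = u + e t + k], and let [E] be conditional expectation under [P] given
   [X]. By Bayes' rule, with [w = u_e - E u],
     [theta (P_e, u_e) = E (g^2 w^2) / E (g^2) - (E (g^2 w) / E (g^2))^2].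
   Put [A = E ((g - 1)^2)] and [B = E ((u_e - u)^2)].  Where [A] is small the
   denominators are bounded below and expanding gives the derivative
     [D (s, t) = E (s ((u - E u)^2 - theta) + 2 t (u - E u))],
   up to terms that are linear in [r] and [k] or quadratic in [(g - 1, u_e - u)];
   where [A] is not small both variances are merely bounded.  In both cases
     [(theta (P_e, u_e) - theta (P, u) - e D)^2
        <= c (E r^2 + E k^2 + e^2 E (s^2 + t^2) min (A + B, 1))],
   whose integral is [o (e^2)], because [A + B -> 0] in [L^1] and
   [E (s^2 + t^2)] is integrable.  Total derivatives are unique on the tangent
   spaces, so the adjoint may be computed for this [D]; it follows from the tower
   property and the change of measure from [P] to [Q].  Its second component lies
   in the tangent space of the ball because, for [m > 0], inward pointing bounded
   directions span all bounded functions, which are dense; for [m = 0] it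
   vanishes. *)

Set Implicit Arguments.
Unset Strict Implicit.
Unset Printing Implicit Defensive.
Import Order.TTheory GRing.Theory Num.Theory.
Import numFieldNormedType.Exports.

Local Open Scope classical_set_scope.
Local Open Scope ring_scope.

(** * Integration, square-integrable functions and densities *)

(** The obstacle is that the remainder is measured in [L^2], while its second-order terms are
    conditional expectations of squares of [g - 1], which are only known to lie in [L^1]. Squaring
    such a term produces [q^2] with [q = A + B], and nothing makes [q^2] integrable by itself. So
    the two factors are treated differently. One [q] is bounded by a multiple of
    [E r^2 + E k^2 + e^2 E (s^2 + t^2)], which has the right order in [e]. The other is bounded by a
    multiple of [min (q, 1)], and this is possible only where [q] is bounded. [B] always is, because
    the ball is bounded, but [A] is not: besides the lower bound on the denominators, this is what
    the restriction to small [A] provides. Uniform integrability of the fixed function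
    [E (s^2 + t^2)] then does the rest, without a rate for [q]. The two bounded densities serve to
    compare norms: [L^2 (QX)] with [L^2 (PX)], and [L^2 (P)] with [L^2 (Q)]. *)

Section transfer.
Context d1 d2 (T1 : measurableType d1) (T2 : measurableType d2) (R : realType).
Variables (mu1 : {measure set T1 -> \bar R}) (mu2 : {measure set T2 -> \bar R}).
Variables (C : {mfun T1 >-> T2}) (f : T1 -> R) (h : T2 -> R).
Hypotheses (mf : measurable_fun setT f) (mh : measurable_fun setT h).
Hypotheses (f0 : forall x, 0 <= f x) (h0 : forall y, 0 <= h y).
Hypothesis fh : forall B, measurable B ->
  (\int[mu1]_(x in C @^-1` B) (f x)%:E = \int[mu2]_(y in B) (h y)%:E)%E.

Import HBNNSimple.

Let mcomp (W : T2 -> R) : measurable_fun setT W ->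
  measurable_fun setT (W \o C).
Proof. by move=> mW; exact: measurableT_comp. Qed.

Let transfer_indic (B : set T2) : measurable B ->
  (\int[mu1]_x (\1_B (C x) * f x)%:E = \int[mu2]_y (\1_B y * h y)%:E)%E.
Proof.
move=> mB; transitivity (\int[mu1]_(x in C @^-1` B) (f x)%:E)%E.
  rewrite [RHS]integral_mkcond; apply: eq_integral => x _.
  rewrite patchE indicE; case: ifPn; rewrite ?inE => xB.
    by rewrite mem_set// mul1r.
  by rewrite memNset ?mul0r// => Bx; move: xB; rewrite notin_setE.
rewrite fh// integral_mkcond; apply: eq_integral => x _.
by rewrite patchE indicE; case: ifPn; rewrite ?mul1r ?mul0r.
Qed.

Let transfer_sfun (W : {nnsfun T2 >-> R}) :
  (\int[mu1]_x (W (C x) * f x)%:E = \int[mu2]_y (W y * h y)%:E)%E.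
Proof.
(* The inner map is left arbitrary so that the same decomposition serves both sides, with [C] on the
   left and the identity on the right. *)
have e1 (T : Type) (g : T -> T2) (k : T -> R) (x : T) : (W (g x) * k x)%:E =
    (\sum_(y \in range W) (y * (\1_(W @^-1` [set y]) (g x) * k x))%:E)%E.
  rewrite fsumEFin// fimfunE; congr EFin.
  rewrite !fsbig_finite//= mulr_suml; apply: eq_bigr => i _.
  by rewrite mulrA.
under eq_integral do rewrite e1.
under [RHS]eq_integral do rewrite (e1 _ id).
have ge (T : Type) (g : T -> T2) (k : T -> R) (y : R) (x : T) :
    0 <= k x -> (0 <= (y * (\1_(W @^-1` [set y]) (g x) * k x))%:E)%E.
  move=> k0; rewrite lee_fin indicE; case: (boolP (_ \in _)) => /=.
    by rewrite inE /= => <-; rewrite mul1r mulr_ge0.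
  by rewrite mul0r mulr0.
rewrite !ge0_integral_fsum//; last 4 first.
- move=> y; apply/measurable_EFinP; apply: measurable_funM => //.
  exact: measurable_funM.
- by move=> y x _; exact: (ge _ id).
- move=> y; apply/measurable_EFinP; apply: measurable_funM => //.
  apply: measurable_funM => //; apply: mcomp.
  by apply: measurable_indic.
- by move=> y x _; exact: ge.
apply: eq_fsbigr => r; rewrite inE => -[t _ <-].
under eq_integral do rewrite EFinM.
under [RHS]eq_integral do rewrite EFinM.
rewrite !ge0_integralZl ?lee_fin//; last 4 first.
- by apply/measurable_EFinP; exact: measurable_funM.
- by move=> x _; rewrite lee_fin mulr_ge0.
- apply/measurable_EFinP; apply: measurable_funM => //.
  by apply: mcomp; exact: measurable_indic.
- by move=> x _; rewrite lee_fin mulr_ge0.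
by rewrite transfer_indic.
Qed.

(* [C] pushes [f mu1] forward to [h mu2]; stated through integrals so that it
   covers both conditional expectations ([mu2] the law of [C]) and changes of
   measure ([C] the identity). *)
Lemma ge0_integral_transfer (W : T2 -> R) :
  measurable_fun setT W -> (forall y, 0 <= W y) ->
  (\int[mu1]_x (W (C x) * f x)%:E = \int[mu2]_y (W y * h y)%:E)%E.
Proof.
move=> mW W0.
have mEW : measurable_fun setT (EFin \o W) by exact/measurable_EFinP.
pose w := nnsfun_approx measurableT mEW.
have wW y : (EFin \o w ^~ y) @ \oo --> (W y)%:E.
  by apply: cvg_nnsfun_approx => // x _; rewrite lee_fin.
have nd y : {homo (fun n => w n y) : a b / (a <= b)%N >-> a <= b}.
  by move=> a b ab; exact/lefP/nd_nnsfun_approx.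
have -> : (\int[mu1]_x (W (C x) * f x)%:E)%E =
    limn (fun n => \int[mu1]_x (w n (C x) * f x)%:E)%E.
  rewrite -monotone_convergence//.
  - apply: eq_integral => x _; apply/esym/cvg_lim => //.
    under eq_fun do rewrite EFinM.
    by rewrite EFinM; apply: cvgeZr => //; exact: wW.
  - move=> n; apply/measurable_EFinP; apply: measurable_funM => //.
    exact: mcomp.
  - by move=> n x _; rewrite lee_fin mulr_ge0.
  - by move=> x _ a b ab; rewrite lee_fin ler_wpM2r//; exact: nd.
have -> : (\int[mu2]_x (W x * h x)%:E)%E =
    limn (fun n => \int[mu2]_x (w n x * h x)%:E)%E.
  rewrite -monotone_convergence//.
  - apply: eq_integral => x _; apply/esym/cvg_lim => //.
    under eq_fun do rewrite EFinM.
    by rewrite EFinM; apply: cvgeZr => //; exact: wW.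
  - by move=> n; apply/measurable_EFinP; apply: measurable_funM.
  - by move=> n x _; rewrite lee_fin mulr_ge0.
  - by move=> x _ a b ab; rewrite lee_fin ler_wpM2r//; exact: nd.
by congr (limn _); apply/funext => n; exact: transfer_sfun.
Qed.

End transfer.

Section integral_density.
Context d (T : measurableType d) (R : realType).
Variables (nu mu : {measure set T -> \bar R}) (h : T -> R).
Hypotheses (mh : measurable_fun setT h) (h0 : forall x, 0 <= h x).
Hypothesis nuE : forall A, measurable A ->
  nu A = (\int[mu]_(x in A) (h x)%:E)%E.

Let idm : {mfun T >-> T} := mfun_Sub (mem_set (@measurable_id _ T setT)).

Lemma ge0_integral_density (f : T -> R) : measurable_fun setT f ->
  (forall x, 0 <= f x) ->
  (\int[nu]_x (f x)%:E = \int[mu]_x (f x * h x)%:E)%E.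
Proof.
move=> mf f0; rewrite -(@ge0_integral_transfer _ _ _ _ _ nu mu idm (cst 1) h)//.
  by apply: eq_integral => x _ /=; rewrite mulr1.
move=> B mB; rewrite -nuE// -[LHS]/(\int[nu]_(x in B) (cst 1%:E) x)%E.
by rewrite integral_cst// mul1e.
Qed.

End integral_density.

Local Notation intg mu f := (integrable mu setT (EFin \o f)).

Section L2_facts.
Context d (T : measurableType d) (R : realType).
Variable mu : {measure set T -> \bar R}.
Implicit Types f g h : T -> R.

(** Norm estimates below are all turned into estimates of integrals of squares, which add and
    compare without roots in the extended reals. *)
Lemma L2norm_sqr f : (L2norm mu f ^+ 2 = \int[mu]_x (f x ^+ 2)%:E)%E.
Proof.
rewrite expe2 /L2norm; set N := Lnorm _ _ _.
have N0 : (0 <= N)%E by exact: Lnorm_ge0.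
have -> : (N * N = N `^ 2)%E.
  rewrite [RHS](_ : _ = N `^ (1 + 1))%E; last by congr (_ `^ _)%E.
  by rewrite poweRD ?poweRe1// add_neq0_poweRD_def.
rewrite poweR_Lnorm//; apply: eq_integral => x _ /=.
by rewrite powR_mulrn// real_normK// num_real.
Qed.

Lemma L2norm_ge0 f : (0 <= L2norm mu f)%E.
Proof. exact: Lnorm_ge0. Qed.

Lemma L2norm_lt f (e : R) : 0 < e ->
  (L2norm mu f < e%:E)%E = (\int[mu]_x (f x ^+ 2)%:E < (e ^+ 2)%:E)%E.
Proof.
by move=> e0; rewrite -L2norm_sqr -lte_sqr ?L2norm_ge0 ?lee_fin ?ltW//.
Qed.

Lemma L2P f : L2 mu f <->
  measurable_fun setT f /\ intg mu (fun x => f x ^+ 2).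
Proof.
split=> [f2|[mf f2]].
  split; last exact: Lfun2_integrable_sqr.
  by move: f2; rewrite /L2 /= inE => /andP[]; rewrite inE.
rewrite /L2 /= inE; apply/andP; split; rewrite inE //= /finLfun /= ?inE /finite_norm -/(L2norm mu f).
have := integrable_lty measurableT f2; rewrite -L2norm_sqr.
by have := L2norm_ge0 f; case: (L2norm mu f) => [r||] //=; rewrite ?ltry.
Qed.

Lemma L2_measurable f : L2 mu f -> measurable_fun setT f.
Proof. by case/L2P. Qed.

Lemma intg_measurable f : intg mu f -> measurable_fun setT f.
Proof. by move=> /measurable_int/measurable_EFinP. Qed.

Lemma intg_le f g : measurable_fun setT f -> intg mu g ->
  (forall x, `|f x| <= g x) -> intg mu f.
Proof.
move=> mf ig fg; apply: (le_integrable _ _ _ ig) => //.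
  exact/measurable_EFinP.
by move=> x _ /=; rewrite lee_fin (le_trans (fg x))// ler_norm.
Qed.

Lemma intgZ (a : R) f : intg mu f -> intg mu (fun x => a * f x).
Proof. by move=> If; exact: (integrableZl measurableT a If). Qed.

Lemma intgD f g : intg mu f -> intg mu g -> intg mu (fun x => f x + g x).
Proof. by move=> If Ig; exact: (integrableD measurableT If Ig). Qed.

Lemma intgB f g : intg mu f -> intg mu g -> intg mu (fun x => f x - g x).
Proof. by move=> If Ig; exact: (integrableB measurableT If Ig). Qed.

Lemma intg_bM (K : R) f g : measurable_fun setT f -> (forall x, `|f x| <= K) ->
  intg mu g -> intg mu (fun x => f x * g x).
Proof.
move=> mf fK ig; apply: (@intg_le _ (fun x => K * `|g x|)).
- by apply: measurable_funM => //; exact: intg_measurable.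
- by apply: intgZ; exact: integrable_norm.
- by move=> x; rewrite normrM ler_wpM2r.
Qed.

Lemma intg_lty f : intg mu f -> (\int[mu]_x (f x)%:E < +oo)%E.
Proof. exact: (integrable_lty measurableT). Qed.

Lemma intg_ge0 f : measurable_fun setT f -> (forall x, 0 <= f x) ->
  (\int[mu]_x (f x)%:E < +oo)%E -> intg mu f.
Proof.
move=> mf f0 foo; apply/integrableP; split; first exact/measurable_EFinP.
by under eq_integral => x _ do rewrite /= ger0_norm//.
Qed.

Lemma L2_sqr f : L2 mu f -> intg mu (fun x => f x ^+ 2).
Proof. by case/L2P. Qed.

Lemma L2_mul f g : L2 mu f -> L2 mu g -> intg mu (fun x => f x * g x).
Proof. by move=> f2 g2; apply/Lfun1_integrable/Lfun2_mul_Lfun1. Qed.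

Lemma L2_le f g : measurable_fun setT f -> intg mu g ->
  (forall x, f x ^+ 2 <= g x) -> L2 mu f.
Proof.
move=> mf ig fg; apply/L2P; split => //.
apply: intg_le ig _; first exact: measurable_funX.
by move=> x; rewrite ger0_norm ?sqr_ge0.
Qed.

Lemma L2Z (a : R) f : L2 mu f -> L2 mu (fun x => a * f x).
Proof.
move=> f2; apply: (@L2_le _ (fun x => a ^+ 2 * f x ^+ 2)).
- by apply: measurable_funM => //; exact: L2_measurable.
- exact/intgZ/L2_sqr.
- by move=> x; rewrite exprMn.
Qed.

Lemma L2D f g : L2 mu f -> L2 mu g -> L2 mu (fun x => f x + g x).
Proof.
move=> f2 g2; apply: (@L2_le _ (fun x => 2 * (f x ^+ 2 + g x ^+ 2))).
- by apply: measurable_funD; exact: L2_measurable.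
- by apply: intgZ; apply: intgD; exact: L2_sqr.
- by move=> x; have := sqr_ge0 (f x - g x); nra.
Qed.

Lemma L2_bM (K : R) f g : measurable_fun setT f -> (forall x, `|f x| <= K) ->
  L2 mu g -> L2 mu (fun x => f x * g x).
Proof.
move=> mf fK g2; apply: (@L2_le _ (fun x => K ^+ 2 * g x ^+ 2)).
- by apply: measurable_funM => //; exact: L2_measurable.
- exact/intgZ/L2_sqr.
- move=> x; rewrite exprMn ler_wpM2r ?sqr_ge0//.
  by rewrite -real_normK ?num_real// lerXn2r ?nnegrE// (le_trans _ (fK x)).
Qed.

Lemma L2B f g : L2 mu f -> L2 mu g -> L2 mu (fun x => f x - g x).
Proof.
move=> f2 g2; have := L2D f2 (L2Z (-1) g2); congr (L2 mu).
by apply/funext => x; rewrite mulN1r.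
Qed.

Lemma L2_0 : L2 mu (fun _ => 0).
Proof.
apply: (@L2_le _ (fun=> 0)) => //; last by move=> x; rewrite expr0n.
exact: integrable0.
Qed.

Lemma intg_ae_eq f g : measurable_fun setT g ->
  {ae mu, forall x, f x = g x} -> intg mu f -> intg mu g.
Proof.
move=> mg fg If; have mf := intg_measurable If.
apply/integrableP; split; first exact/measurable_EFinP.
case/integrableP: If => _; apply: le_lt_trans.
rewrite le_eqVlt; apply/orP; left; apply/eqP; apply: ae_eq_integral => //.
- by apply: measurableT_comp => //; exact/measurable_EFinP.
- by apply: measurableT_comp => //; exact/measurable_EFinP.
- by apply: filterS fg => x /= ->.
Qed.

Lemma L2_ae_eq f g : measurable_fun setT g ->
  {ae mu, forall x, f x = g x} -> L2 mu f -> L2 mu g.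
Proof.
move=> mg fg /L2P[mf If]; apply/L2P; split => //.
apply: intg_ae_eq If; first exact: measurable_funX.
by apply: filterS fg => x ->.
Qed.

End L2_facts.

Section L2_probability.
Context d (T : measurableType d) (R : realType) (P : probability T R).

Lemma intg_bounded (K : R) (f : T -> R) : measurable_fun setT f ->
  (forall x, `|f x| <= K) -> intg P f.
Proof.
move=> mf fK; apply: (@intg_le _ _ _ _ _ (cst K)) => //.
exact: finite_measure_integrable_cst.
Qed.

Lemma L2_bounded (K : R) (f : T -> R) : measurable_fun setT f ->
  (forall x, `|f x| <= K) -> L2 P f.
Proof.
move=> mf fK; apply: (@L2_le _ _ _ _ _ (cst (K ^+ 2))) => //.
  exact: finite_measure_integrable_cst.
move=> x; rewrite -real_normK ?num_real// lerXn2r ?nnegrE//.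
exact: le_trans (fK x).
Qed.

Lemma L2_intg (f : T -> R) : L2 P f -> intg P f.
Proof.
move=> f2; apply: (@intg_le _ _ _ _ _ (fun x => 1 + f x ^+ 2)).
- exact: L2_measurable f2.
- apply: intgD; last exact: L2_sqr.
  by apply: (@intg_bounded 1) => // x; rewrite normr1.
- by move=> x; rewrite ler_norml; apply/andP; split; nra.
Qed.

End L2_probability.

(** On the set where [h] is negative, the integral of its absolute value is minus that of [h], hence
    at most 0; so that set is null. *)
Lemma ae_ge0_of_integral d (T : measurableType d) (R : realType)
    (mu : {measure set T -> \bar R}) (h : T -> R) :
  intg mu h -> (forall B, measurable B -> (0 <= \int[mu]_(x in B) (h x)%:E)%E) ->
  {ae mu, forall x, 0 <= h x}.
Proof.
move=> Ih h0; have mh := intg_measurable Ih.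
pose B := [set x | h x < 0].
have mB : measurable B.
  rewrite [B](_ : _ = setT `&` h @^-1` `]-oo, 0[%classic); first exact: mh.
  by rewrite setTI; apply/seteqP; split => x /=; rewrite in_itv.
have mhB : measurable_fun B (EFin \o h).
  by apply/measurable_EFinP; exact: measurable_funTS.
have : (\int[mu]_(x in B) `|(EFin \o h) x| = 0)%E.
  apply/eqP; rewrite eq_le integral_ge0 ?andbT//.
  have -> : (\int[mu]_(x in B) `|(EFin \o h) x| =
      \int[mu]_(x in B) - (EFin \o h) x)%E.
    by apply: eq_integral => x; rewrite inE /B /= => hx; rewrite ltr0_norm.
  rewrite integralN/=; last first.
    by apply: integrable_add_def => //; exact: integrableS Ih.
  by rewrite oppe_le0 h0.
move/(ae_eq_integral_abs _ mB mhB); apply: filterS => x hB.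
by rewrite leNgt; apply/negP => hx; have [] := hB hx => hx0; rewrite hx0 ltxx in hx.
Qed.

Lemma ae_EFin d (T : measurableType d) (R : realType)
    (mu : {measure set T -> \bar R}) (D : set T) (h k : T -> R) :
  {ae mu, forall x, h x = k x} -> ae_eq mu D (EFin \o h) (EFin \o k).
Proof. by apply: filterS => x /= ->. Qed.

Lemma ae_and d (T : measurableType d) (R : realType)
    (mu : {measure set T -> \bar R}) (p q : T -> Prop) :
  {ae mu, forall x, p x} -> {ae mu, forall x, q x} ->
  {ae mu, forall x, p x /\ q x}.
Proof. by apply: filterS2. Qed.

Lemma ler_sqr_norm (R : realDomainType) (x c : R) : `|x| <= c -> x ^+ 2 <= c ^+ 2.
Proof.
move=> xc; rewrite -[x ^+ 2]real_normK ?num_real//.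
by rewrite lerXn2r ?nnegrE// (le_trans _ xc).
Qed.

(** * Conditional expectations *)

Lemma integral_lin d (T : measurableType d) (R : realType)
    (mu : {measure set T -> \bar R}) (A : set T) (a : R) (h k : T -> R) :
  measurable A -> mu.-integrable A (EFin \o h) -> mu.-integrable A (EFin \o k) ->
  (\int[mu]_(x in A) (a * h x + k x)%:E =
    a%:E * \int[mu]_(x in A) (h x)%:E + \int[mu]_(x in A) (k x)%:E)%E.
Proof.
move=> mA Ih Ik; under eq_integral do rewrite EFinD EFinM.
rewrite integralD//; last exact: (integrableZl mA a Ih).
by rewrite integralZl.
Qed.

Section conditional_expectation.
Context d d' (Z : measurableType d) (X : measurableType d') (R : realType).
Variables (P : probability Z R) (C : {mfun Z >-> X}).
Notation PX := (distribution P C).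
Notation ice := (is_cond_exp P C).
Implicit Types (f : Z -> R) (g W : X -> R).

Lemma measurable_preimage (B : set X) : measurable B -> measurable (C @^-1` B).
Proof. by move=> mB; exact: measurable_funPTI. Qed.

Lemma measurable_compC W : measurable_fun setT W ->
  measurable_fun setT (fun z => W (C z)).
Proof. by move=> mW; exact: measurableT_comp. Qed.

Lemma ice_intg f g : ice f g -> intg PX g.
Proof. by case. Qed.

Lemma ice_measurable f g : ice f g -> measurable_fun setT g.
Proof. by move=> /ice_intg/intg_measurable. Qed.

(** Together with [ice_ae_eqr] and [ice_unique] this allows one version to be exchanged for another.
    Computations use the relation [is_cond_exp] instead of the version chosen by [cond_exp], so that
    versions may be taken bounded or nonnegative at every point. *)
Lemma ice_ae_eql f f' g : measurable_fun setT f -> measurable_fun setT f' ->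
  {ae P, forall z, f z = f' z} -> ice f g -> ice f' g.
Proof.
move=> mf mf' ff' [Ig fg]; split => // B mB; rewrite -fg//.
apply: ae_eq_integral; first exact: measurable_preimage.
- by apply/measurable_EFinP; exact: measurable_funTS.
- by apply/measurable_EFinP; exact: measurable_funTS.
- by apply: ae_EFin; apply: filterS ff' => z ->.
Qed.

Lemma ice_ae_eqr f g g' : measurable_fun setT g' ->
  {ae PX, forall x, g x = g' x} -> ice f g -> ice f g'.
Proof.
move=> mg' gg' [Ig fg]; split; first exact: intg_ae_eq Ig.
move=> B mB; rewrite fg//; apply: ae_eq_integral => //.
- by apply/measurable_EFinP/measurable_funTS; exact: intg_measurable Ig.
- by apply/measurable_EFinP; exact: measurable_funTS.
- exact: ae_EFin.
Qed.

Lemma ice_unique f g g' : ice f g -> ice f g' ->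
  {ae PX, forall x, g x = g' x}.
Proof.
move=> [Ig fg] [Ig' fg'].
have : ae_eq PX setT (EFin \o g) (EFin \o g').
  apply: integral_ae_eq => //; first exact: measurable_int Ig'.
  by move=> B _ mB; rewrite -fg// -fg'.
by apply: filterS => x /(_ I)[].
Qed.

Lemma intg_sub f (A : set Z) : measurable A -> intg P f ->
  P.-integrable A (EFin \o f).
Proof. by move=> mA; apply: integrableS. Qed.

Lemma ice_lin (a : R) f1 f2 g1 g2 : intg P f1 -> intg P f2 ->
  ice f1 g1 -> ice f2 g2 ->
  ice (fun z => a * f1 z + f2 z) (fun x => a * g1 x + g2 x).
Proof.
move=> If1 If2 [Ig1 e1] [Ig2 e2]; split.
  by apply: intgD => //; exact: intgZ.
move=> B mB; have mCB := measurable_preimage mB.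
rewrite !integral_lin ?e1 ?e2//; [exact: integrableS Ig1|exact: integrableS Ig2|
  exact: intg_sub|exact: intg_sub].
Qed.

Lemma ice_ge0 f g : (forall z, 0 <= f z) -> ice f g ->
  {ae PX, forall x, 0 <= g x}.
Proof.
move=> f0 [Ig fg]; apply: ae_ge0_of_integral => // B mB.
by rewrite -fg// integral_ge0// => z _; rewrite lee_fin.
Qed.

Lemma ice_le f1 f2 g1 g2 : intg P f1 -> intg P f2 -> (forall z, f1 z <= f2 z) ->
  ice f1 g1 -> ice f2 g2 -> {ae PX, forall x, g1 x <= g2 x}.
Proof.
move=> If1 If2 f12 i1 i2.
have h z : 0 <= -1 * f1 z + f2 z by have := f12 z; lra.
by apply: filterS (ice_ge0 h (ice_lin (-1) If1 If2 i1 i2)) => x; lra.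
Qed.

Lemma ice_cst (c : R) : ice (fun=> c) (fun=> c).
Proof.
split; first by apply: (@intg_bounded _ _ _ _ `|c|).
by move=> B mB; rewrite !integral_cst//; exact: measurable_preimage.
Qed.

(** By monotonicity, truncating a version at [a] and [b] changes it on a null set only. Bounds valid
    at every point spare the later estimates their exceptional sets. *)
Lemma ice_clip (a b : R) f : a <= b -> measurable_fun setT f ->
  (forall z, a <= f z <= b) ->
  exists g, [/\ ice f g, measurable_fun setT g & forall x, a <= g x <= b].
Proof.
move=> ab mf fab.
have If : intg P f.
  apply: (@intg_bounded _ _ _ _ (`|a| + `|b|)) => // z.
  have /andP[h1 h2] := fab z; have := ler_norm b; have := ler_norm (- a).
  by rewrite normrN ler_norml; have := normr_ge0 a; have := normr_ge0 b; lra.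
have [k ik] : exists k, ice f k by exists (cond_exp P C f); exact: cond_expP.
have mk := ice_measurable ik.
pose g x := Num.max a (Num.min b (k x)).
have mg : measurable_fun setT g.
  by apply: measurable_maxr => //; exact: measurable_minr.
exists g; split => //; last first.
  by move=> x; rewrite /g le_max lexx ge_max ab ge_min lexx.
apply: ice_ae_eqr (ik) => //.
have Ic c : intg P (fun=> c) by apply: (@intg_bounded _ _ _ _ `|c|).
have h1 : {ae PX, forall x, a <= k x}.
  by apply: (ice_le (Ic a) If _ (ice_cst a) ik) => z; case/andP: (fab z).
have h2 : {ae PX, forall x, k x <= b}.
  by apply: (ice_le If (Ic b) _ ik (ice_cst b)) => z; case/andP: (fab z).
apply: filterS2 h1 h2 => x h1 h2.
by rewrite /g (min_idPr h2) (max_idPr h1).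
Qed.

Section pullout.

(** The integrated pull-out property, bundled with the integrability on the side of [X] that makes
    differences legitimate. [Q0] treats nonnegative [W] and [f] by transfer of integrals; [QB] then
    removes the sign condition, on [W] in [Q1] and on [f] in [ice_integral]. *)
Let Q W f g := intg PX (fun x => W x * g x) /\
  (\int[P]_z (W (C z) * f z)%:E = \int[PX]_x (W x * g x)%:E)%E.

Let Q0 W f g : measurable_fun setT W -> (forall x, 0 <= W x) ->
  intg P f -> (forall z, 0 <= f z) -> (forall x, 0 <= g x) ->
  intg P (fun z => W (C z) * f z) -> ice f g -> Q W f g.
Proof.
move=> mW W0 If f0 g0 IWf ig; have mg := ice_measurable ig.
have E : (\int[P]_z (W (C z) * f z)%:E = \int[PX]_x (W x * g x)%:E)%E.
  apply: ge0_integral_transfer => //; first exact: intg_measurable If.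
  by case: ig.
split => //; apply: intg_ge0.
- exact: measurable_funM.
- by move=> x; exact: mulr_ge0.
- by rewrite -E; exact: intg_lty.
Qed.

Let QB W1 W2 f1 f2 g1 g2 W f g : intg P (fun z => W1 (C z) * f1 z) ->
  intg P (fun z => W2 (C z) * f2 z) ->
  (forall z, W (C z) * f z = W1 (C z) * f1 z - W2 (C z) * f2 z) ->
  (forall x, W x * g x = W1 x * g1 x - W2 x * g2 x) ->
  Q W1 f1 g1 -> Q W2 f2 g2 -> Q W f g.
Proof.
move=> I1 I2 Ef Eg [J1 E1] [J2 E2]; split.
  by under eq_fun do rewrite Eg; exact: intgB.
under eq_integral do rewrite Ef.
under [RHS]eq_integral do rewrite Eg.
by rewrite [LHS](integralB_EFin measurableT I1 I2) E1 E2 [RHS](integralB_EFin measurableT J1 J2).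
Qed.

Let pos (r : R) := Num.max r 0.
Let pos0 r : 0 <= pos r. Proof. by rewrite /pos le_max lexx orbT. Qed.
Let posB r : r = pos r - pos (- r).
Proof.
rewrite /pos; have [r0|r0] := lerP r 0; first by rewrite max_l ?oppr_ge0// sub0r opprK.
by rewrite max_r ?subr0// oppr_le0 ltW.
Qed.
Let pos_le r : `|pos r| <= `|r|.
Proof.
rewrite ger0_norm// /pos; have [r0|r0] := lerP r 0 => //.
exact: ler_norm.
Qed.
Let mpos dd (T : measurableType dd) (h : T -> R) : measurable_fun setT h ->
  measurable_fun setT (fun x => pos (h x)).
Proof. by move=> mh; exact: measurable_maxr. Qed.

Let Q1 W f g : measurable_fun setT W ->
  intg P f -> (forall z, 0 <= f z) -> (forall x, 0 <= g x) ->
  intg P (fun z => W (C z) * f z) -> ice f g -> Q W f g.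
Proof.
move=> mW If f0 g0 IWf ig; have mf := intg_measurable If.
have mNW : measurable_fun setT (fun x => - W x) by exact: measurableT_comp.
have I1 : intg P (fun z => pos (W (C z)) * f z).
  apply: intg_le (integrable_norm IWf) _.
    by apply: measurable_funM => //; apply: mpos; exact: measurable_compC.
  by move=> z /=; rewrite !normrM ler_wpM2r.
have I2 : intg P (fun z => pos (- W (C z)) * f z).
  apply: intg_le (integrable_norm IWf) _.
    apply: measurable_funM => //; apply: mpos.
    by apply: measurableT_comp => //; exact: measurable_compC.
  by move=> z /=; rewrite !normrM ler_wpM2r// -(normrN (W _)).
apply: (@QB (pos \o W) (fun x => pos (- W x)) f f g g) => //.
- by move=> z /=; rewrite {1}(posB (W (C z))) mulrBl.
- by move=> x /=; rewrite {1}(posB (W x)) mulrBl.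
- by apply: Q0 => //; [exact: mpos|move=> x; exact: pos0].
- by apply: Q0 => //; [exact: mpos].
Qed.

Lemma ice_ge0_version f : measurable_fun setT f -> intg P f -> (forall z, 0 <= f z) ->
  exists2 g, ice f g & forall x, 0 <= g x.
Proof.
move=> mf If f0.
have ik : ice f (cond_exp P C f) by exact: cond_expP.
exists (fun x => pos (cond_exp P C f x)) => //.
apply: ice_ae_eqr (ik); first by apply: mpos; exact: ice_measurable ik.
by apply: filterS (ice_ge0 f0 ik) => x h; rewrite /pos max_l.
Qed.

Lemma ice_integral W f g : measurable_fun setT W -> intg P f ->
  intg P (fun z => W (C z) * f z) -> ice f g ->
  intg PX (fun x => W x * g x) /\
  (\int[P]_z (W (C z) * f z)%:E = \int[PX]_x (W x * g x)%:E)%E.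
Proof.
move=> mW If IWf ig; have mf := intg_measurable If.
have mNf : measurable_fun setT (fun z => - f z) by exact: measurableT_comp.
have I1 : intg P (fun z => pos (f z)).
  by apply: intg_le (integrable_norm If) _; [exact: mpos|move=> z /=].
have I2 : intg P (fun z => pos (- f z)).
  apply: intg_le (integrable_norm If) _; first exact: mpos.
  by move=> z /=; rewrite -(normrN (f _)).
have J1 : intg P (fun z => W (C z) * pos (f z)).
  apply: intg_le (integrable_norm IWf) _.
    by apply: measurable_funM; [exact: measurable_compC|exact: mpos].
  by move=> z /=; rewrite !normrM ler_wpM2l.
have J2 : intg P (fun z => W (C z) * pos (- f z)).
  apply: intg_le (integrable_norm IWf) _.
    by apply: measurable_funM; [exact: measurable_compC|exact: mpos].
  by move=> z /=; rewrite !normrM ler_wpM2l// -(normrN (f _)).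
have [g1 ig1 g10] := ice_ge0_version (mpos mf) I1 (fun=> pos0 _).
have [g2 ig2 g20] := ice_ge0_version (mpos mNf) I2 (fun=> pos0 _).
have [K E] : Q W f (fun x => g1 x - g2 x).
  apply: (@QB W W _ _ g1 g2 _ _ _ J1 J2).
  - by move=> z; rewrite -mulrBr -posB.
  - by move=> x; rewrite mulrBr.
  - by apply: Q1.
  - by apply: Q1.
have gg : {ae PX, forall x, g1 x - g2 x = g x}.
  apply: ice_unique ig; have := ice_lin (-1) I2 I1 ig2 ig1.
  congr ice; apply/funext => x; last by rewrite mulN1r addrC.
  by rewrite mulN1r addrC -posB.
have mg := ice_measurable ig.
split; first apply: intg_ae_eq K.
- exact: measurable_funM.
- by apply: filterS gg => x ->.
rewrite E; apply: ae_eq_integral => //.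
- by apply/measurable_EFinP; exact: intg_measurable K.
- by apply/measurable_EFinP; exact: measurable_funM.
- by apply: (@ae_EFin _ _ _ _ _ (fun x => W x * (g1 x - g2 x)) (fun x => W x * g x)); apply: filterS gg => x ->.
Qed.

(** The integrated identity applied to the factor [\1_B * W] gives the defining identity on [B]. *)
Lemma ice_pullout W f g : measurable_fun setT W -> intg P f ->
  intg P (fun z => W (C z) * f z) -> ice f g ->
  ice (fun z => W (C z) * f z) (fun x => W x * g x).
Proof.
move=> mW If IWf ig; split; first by case: (ice_integral mW If IWf ig).
move=> B mB; pose V x := \1_B x * W x.
have mV : measurable_fun setT V by apply: measurable_funM.
have IVf : intg P (fun z => V (C z) * f z).
  apply: intg_le (integrable_norm IWf) _.
    by apply: measurable_funM; [exact: measurable_compC|exact: intg_measurable If].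
  move=> z /=; rewrite !normrM ler_wpM2r// ler_piMl// indicE.
  by case: (_ \in _); rewrite /= ?normr1 ?normr0.
have [_ E] := ice_integral mV If IVf ig.
transitivity (\int[P]_z (V (C z) * f z)%:E)%E; last rewrite E.
  rewrite integral_mkcond; apply: eq_integral => z _; rewrite patchE /V indicE.
  case: ifPn; rewrite ?inE => h; first by rewrite mem_set// mul1r.
  by rewrite memNset ?mul0r//; move: h; rewrite notin_setE.
rewrite [RHS]integral_mkcond; apply: eq_integral => x _; rewrite patchE /V indicE.
by case: ifPn => h; rewrite ?mul1r ?mul0r.
Qed.

End pullout.

(* Truncating [g] at height [n] avoids any integrability of [g * f] beyond what
   the pull-out property gives for bounded factors. *)
Lemma ice_jensen f g g2 : L2 P f -> ice f g -> ice (fun z => f z ^+ 2) g2 ->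
  {ae PX, forall x, g x ^+ 2 <= g2 x}.
Proof.
move=> f2 ig ig2; have mg := ice_measurable ig.
have If : intg P f by exact: L2_intg.
have If2 : intg P (fun z => f z ^+ 2) by exact: L2_sqr.
pose W n x : R := \1_[set x | `|g x| <= n%:R] x * g x.
have mW n : measurable_fun setT (W n).
  apply: measurable_funM => //; apply: measurable_indic.
  rewrite [X in measurable X](_ : _ = setT `&` (fun x => `|g x|) @^-1` `]-oo, n%:R]%classic).
    exact: measurableT_comp.
  by rewrite setTI; apply/seteqP; split => x /=; rewrite in_itv.
have Wn n x : `|W n x| <= n%:R.
  rewrite /W indicE; case: (boolP (_ \in _)); last by rewrite mul0r normr0.
  by rewrite inE /= mul1r.
(* The conditional expectation of the square of [W n - f] is nonnegative; where [|g x| <= n] this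
   reads [0 <= g2 x - g x ^+ 2]. As [n] ranges over a countable set, one null set serves for all of
   them. *)
have h n : {ae PX, forall x, 0 <= g2 x - 2 * (W n x * g x) + W n x ^+ 2}.
  have IWf : intg P (fun z => W n (C z) * f z).
    by apply: (@intg_bM _ _ _ _ n%:R) => //; exact: measurable_compC.
  have IW2 : intg P (fun z => W n (C z) ^+ 2 * 1).
    apply: (@intg_bounded _ _ _ _ (n%:R ^+ 2)).
      by apply: measurable_funM => //; apply: measurable_funX; exact: measurable_compC.
    by move=> z; rewrite mulr1 normrX lerXn2r ?nnegrE.
  have i1 := ice_pullout (mW n) If IWf ig.
  have I1 : intg P (fun=> 1 : R) by apply: (@intg_bounded _ _ _ _ `|1|).
  have i2 := ice_pullout (measurable_funX 2 (mW n)) I1 IW2 (ice_cst 1).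
  have i3 := ice_lin (-2) IWf If2 i1 ig2.
  have I3 := intgD (intgZ (-2) IWf) If2.
  have i4 := ice_lin 1 I3 IW2 i3 i2.
  have nn z : 0 <= 1 * (-2 * (W n (C z) * f z) + f z ^+ 2) + W n (C z) ^+ 2 * 1.
    by have := sqr_ge0 (W n (C z) - f z); nra.
  by apply: filterS (ice_ge0 nn i4) => x; lra.
have : {ae PX, forall x n, 0 <= g2 x - 2 * (W n x * g x) + W n x ^+ 2}.
  exact/ae_foralln.
apply: filterS => x hx.
have [n gn] : exists n, `|g x| <= n%:R.
  by exists (Num.bound `|g x|); exact/ltW/archi_boundP.
have := hx n; rewrite /W indicE mem_set//= mul1r; nra.
Qed.

End conditional_expectation.

(** * The pointwise inequality for variances *)

(** If [A] exceeds [16^-1] then [2 * Rr + 2^-1 * S] does too, and [S] is at most [16 * (S * mn)]. So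
    1 is bounded by a multiple of [W], and the mere boundedness of [th] and [th'] is good enough. *)
Lemma variance_expansion_far (R : realType) (M Rr S T mn th th' D W A : R) : 8 <= M -> 0 <= S -> 0 <= T -> 0 <= Rr ->
  0 <= th <= M ^+ 2 -> 0 <= th' <= M ^+ 2 -> 16^-1 < A -> A <= 2 * Rr + 2^-1 * S ->
  16^-1 <= mn -> Rr + (S + T) * mn <= W ->
  D ^+ 2 <= 8 * M ^+ 4 * (S + T) ->
  (th' - th - D) ^+ 2 <= 600 * (M ^+ 4 * W).
Proof.
move=> M8 S0 T0 R0 /andP[th0 th1] /andP[th'0 th'1] A16 HA mn16 HW HD.
have h1 : (th' - th) ^+ 2 <= M ^+ 4.
  rewrite (exprM M 2 2) -real_normK ?num_real// lerXn2r ?nnegrE ?sqr_ge0//.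
  by rewrite ler_norml; clear - th0 th1 th'0 th'1; lra.
have STm : S + T <= 16 * ((S + T) * mn).
  rewrite mulrCA -[leLHS]mulr1 ler_wpM2l ?addr_ge0//; clear - mn16; lra.
have M4 : 0 <= M ^+ 4 by rewrite exprn_ge0//; clear - M8; lra.
have h4 : 1 <= 160 * W by clear - HA A16 HW STm R0 S0 T0; lra.
have h5 : S + T <= 16 * W by clear - HW STm R0; lra.
have h3 : (th' - th - D) ^+ 2 <= 2 * (th' - th) ^+ 2 + 2 * D ^+ 2.
  by have := sqr_ge0 (th' - th + D); clear; move: (th' - th) => x; lra.
have h6 : M ^+ 4 * 1 <= M ^+ 4 * (160 * W) by rewrite ler_wpM2l.
have h7 : M ^+ 4 * (S + T) <= M ^+ 4 * (16 * W) by rewrite ler_wpM2l.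
have W0 : 0 <= M ^+ 4 * W by rewrite mulr_ge0//; clear - h4; lra.
clear - h1 h3 h6 h7 HD W0; move: ((th' - th - D) ^+ 2) ((th' - th) ^+ 2) h1 h3 => x y *.
lra.
Qed.

(** Moving the conditional mean is a second-order effect. Since [G0 >= 2^-1], the term [G0 * c ^+ 2]
    is at most [2 * G1 ^+ 2], and [G1] is of first order: its part [H] is even quadratic, and
    [N ^+ 2] is controlled by [q]. *)
Lemma variance_expansion_mean_shift (R : realType) (M A G0 G1 c H N q : R) : 0 <= M -> 0 <= A -> A <= q -> A <= 16^-1 ->
  2^-1 <= G0 -> G1 = G0 * c -> G1 = H + N -> `|H| <= M * A ->
  N ^+ 2 <= 8 * M ^+ 2 * q -> 0 <= G0 * c ^+ 2 <= 34 * (M ^+ 2 * q).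
Proof.
move=> M0 A0 Aq A16 Gh HG1 HGN HH HN.
have H2 : H ^+ 2 <= M ^+ 2 * A ^+ 2.
  by rewrite -exprMn -[H ^+ 2]real_normK ?num_real// lerXn2r ?nnegrE ?mulr_ge0.
have A2 : A ^+ 2 <= 16^-1 * q.
  rewrite expr2 (le_trans (_ : _ <= 16^-1 * A))// ?ler_wpM2r// ler_wpM2l//.
have q0 : 0 <= q by exact: le_trans A0 Aq.
have Mq : 0 <= M ^+ 2 * q by rewrite mulr_ge0// sqr_ge0.
have h1 : M ^+ 2 * A ^+ 2 <= M ^+ 2 * (16^-1 * q) by rewrite ler_wpM2l ?sqr_ge0.
have G1b : G1 ^+ 2 <= 17 * (M ^+ 2 * q).
  have : G1 ^+ 2 <= 2 * H ^+ 2 + 2 * N ^+ 2.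
    by rewrite HGN; have := sqr_ge0 (H - N); clear; lra.
  clear - h1 H2 HN Mq; move: (G1 ^+ 2) (H ^+ 2) H2 => x y *; lra.
have V0 : 0 <= G0 * c ^+ 2 by rewrite mulr_ge0 ?sqr_ge0//; clear - Gh; lra.
rewrite V0 /=.
have : 2^-1 * (G0 * c ^+ 2) <= G1 ^+ 2.
  have -> : G1 ^+ 2 = G0 * (G0 * c ^+ 2) by rewrite HG1; ring.
  by rewrite ler_wpM2r.
clear - G1b; lra.
Qed.

(** The quadratic error contributes [q ^+ 2], which is bounded by [q] times
    [2 * (Rr + K) + 2 * (S + T)]. Next to [Rr + K], already of the right order, the remaining [q] is
    replaced by a constant; next to [S + T] it is replaced by a multiple of [mn], the gain that
    makes this term negligible after integration. *)
Lemma variance_expansion_bracket (R : realType) (M Rr K S T mn q Y b W : R) : 8 <= M -> 0 <= q ->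
  0 <= S -> 0 <= T -> 0 <= Rr -> 0 <= K -> 0 <= mn ->
  q <= 2 * (Rr + K) + 2 * (S + T) -> q <= 2 * M ^+ 2 -> q <= 2 * M ^+ 2 * mn ->
  W = Rr + K + (S + T) * mn -> `|b - Y| <= M ^+ 4 * q ->
  Y ^+ 2 <= 8 * M ^+ 4 * (Rr + K) -> b ^+ 2 <= 9 * (M ^+ 10 * W).
Proof.
move=> M8 q0 S0 T0 R0 K0 mn0 qb qM qmn WE bE HY.
have RK0 : 0 <= Rr + K by rewrite addr_ge0.
have ST0 : 0 <= S + T by rewrite addr_ge0.
have STm : 0 <= (S + T) * mn by rewrite mulr_ge0.
have W0 : 0 <= W by rewrite WE addr_ge0.
have h1 : (b - Y) ^+ 2 <= M ^+ 8 * q ^+ 2.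
  rewrite -real_normK ?num_real//.
  have -> : M ^+ 8 * q ^+ 2 = (M ^+ 4 * q) ^+ 2 by ring.
  by rewrite lerXn2r ?nnegrE// (le_trans _ bE).
have b2 : b ^+ 2 <= 2 * Y ^+ 2 + 2 * (M ^+ 8 * q ^+ 2).
  by have := sqr_ge0 (b - 2 * Y); clear - h1; lra.
have q2 : q ^+ 2 <= 4 * M ^+ 2 * W.
  have h2 : q * (Rr + K) <= 2 * M ^+ 2 * (Rr + K) by rewrite ler_wpM2r.
  have h3 : q * (S + T) <= 2 * M ^+ 2 * mn * (S + T) by rewrite ler_wpM2r.
  have h4 : q ^+ 2 <= q * (2 * (Rr + K) + 2 * (S + T)) by rewrite expr2 ler_wpM2l.
  by rewrite WE; clear - h2 h3 h4; lra.
have M0 : 0 <= M by clear - M8; lra.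
have h2 : M ^+ 8 * q ^+ 2 <= 4 * (M ^+ 10 * W).
  have -> : 4 * (M ^+ 10 * W) = M ^+ 8 * (4 * M ^+ 2 * W) by ring.
  by rewrite ler_wpM2l// exprn_ge0.
have h3 : M ^+ 4 * (Rr + K) <= M ^+ 4 * W.
  by rewrite ler_wpM2l ?exprn_ge0// WE lerDl.
have h4 : M ^+ 4 * W * 64 <= M ^+ 10 * W.
  have -> : M ^+ 10 * W = M ^+ 4 * W * M ^+ 6 by ring.
  rewrite ler_wpM2l ?mulr_ge0 ?exprn_ge0//.
  rewrite (le_trans (_ : _ <= M ^+ 2)) ?ler_weXn2l//; clear - M8; nra.
have h5 : 0 <= M ^+ 4 * W by rewrite mulr_ge0 ?exprn_ge0.
clear - h2 h3 h4 h5 b2 HY; move: (b ^+ 2) (Y ^+ 2) (M ^+ 8 * q ^+ 2) b2 HY h2 => x y z *.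
lra.
Qed.

(** This removes the factor [G0]: [th' - th - D] is [b] plus [(1 - G0) * (th' - th)]. The lower
    bound on [G0] controls [th' - th] by [b + D], and the product of [(1 - G0) ^+ 2] with [D ^+ 2]
    is of order [A * (S + T)], hence absorbed by [(S + T) * mn]. *)
Lemma variance_expansion_near (R : realType) (M A S T mn th th' D W G0 b : R) : 0 <= M -> 0 <= A ->
  A <= mn -> 0 <= S + T -> (S + T) * mn <= W ->
  (1 - G0) ^+ 2 <= 9 * A -> (1 - G0) ^+ 2 <= 1 -> 2^-1 <= G0 ->
  b = G0 * (th' - th) - D -> D ^+ 2 <= 8 * M ^+ 4 * (S + T) ->
  (th' - th - D) ^+ 2 <= 18 * b ^+ 2 + 1200 * (M ^+ 4 * W).
Proof.
move=> M0 A0 Amn ST0 HW G9 G1 Gh bE HD.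
have M4 : 0 <= M ^+ 4 by rewrite exprn_ge0.
have D2 : D ^+ 2 * A <= 8 * (M ^+ 4 * W).
  have h1 : (S + T) * A <= W by rewrite (le_trans _ HW)// ler_wpM2l.
  have h2 : M ^+ 4 * ((S + T) * A) <= M ^+ 4 * W by rewrite ler_wpM2l.
  have h3 : D ^+ 2 * A <= 8 * M ^+ 4 * (S + T) * A by rewrite ler_wpM2r.
  by clear - h2 h3; move: (D ^+ 2) h3 => x *; lra.
have W0 : 0 <= M ^+ 4 * W.
  by rewrite mulr_ge0// (le_trans _ HW)// mulr_ge0// (le_trans A0).
pose x := (1 - G0) * (th' - th).
have h1 : (th' - th) ^+ 2 <= 4 * (b + D) ^+ 2.
  have -> : b + D = G0 * (th' - th) by rewrite bE subrK.
  rewrite exprMn mulrA -[leLHS]mul1r ler_wpM2r ?sqr_ge0//.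
  by clear - Gh; nra.
have h2 : (b + D) ^+ 2 <= 2 * b ^+ 2 + 2 * D ^+ 2.
  by have := sqr_ge0 (b - D); clear; lra.
have h3 : x ^+ 2 <= (1 - G0) ^+ 2 * (8 * b ^+ 2 + 8 * D ^+ 2).
  rewrite /x exprMn ler_wpM2l ?sqr_ge0//; clear - h1 h2.
  by move: (_ ^+ 2) ((b + D) ^+ 2) h1 h2 => y z *; lra.
have h4 : (1 - G0) ^+ 2 * b ^+ 2 <= 1 * b ^+ 2 by rewrite ler_wpM2r ?sqr_ge0.
have h5 : (1 - G0) ^+ 2 * D ^+ 2 <= 9 * A * D ^+ 2 by rewrite ler_wpM2r ?sqr_ge0.
have -> : th' - th - D = b + x by rewrite bE /x; ring.
have h6 : (b + x) ^+ 2 <= 2 * b ^+ 2 + 2 * x ^+ 2.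
  by have := sqr_ge0 (b - x); clear; move: x => x; lra.
clear - D2 W0 h3 h4 h5 h6.
move: ((b + x) ^+ 2) (x ^+ 2) ((1 - G0) ^+ 2) h3 h4 h5 h6 => y z w *; lra.
Qed.

(* At a point [x]: capital letters are conditional expectations under [P]
   ([L] of [g - 1], [G0] of [g^2], [G1] of [g^2 w], [E2] of [g^2 (w^2 - th)]),
   [c] is the shift of the conditional mean, and the time [e] is absorbed in [S],
   [T] and [D]. *)
Lemma variance_expansion_algebra (R : realType)
    (M A B Rr K S T G0 L th th' c E2 G1 H N Y D q mn : R) :
  8 <= M -> 0 <= A -> 0 <= B -> 0 <= Rr -> 0 <= K -> 0 <= S -> 0 <= T ->
  0 <= th <= M ^+ 2 -> 0 <= th' <= M ^+ 2 ->
  A <= 2 * Rr + 2^-1 * S -> B <= 2 * K + 2 * T -> B <= M ^+ 2 ->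
  G0 = 1 + 2 * L + A -> L ^+ 2 <= A ->
  G0 * (th' - th) = E2 - G0 * c ^+ 2 -> G1 = G0 * c ->
  `|E2 - D - Y| <= 7 * M ^+ 2 * (A + B) ->
  Y ^+ 2 <= 8 * M ^+ 4 * (Rr + K) ->
  G1 = H + N -> `|H| <= M * A -> N ^+ 2 <= 8 * M ^+ 2 * (A + B) ->
  D ^+ 2 <= 8 * M ^+ 4 * (S + T) ->
  q = A + B -> mn = Num.min q 1 ->
  (th' - th - D) ^+ 2 <= 200 * M ^+ 10 * (Rr + K + (S + T) * mn).
Proof.
move=> M8 A0 B0 R0 K0 S0 T0 hth hth' HA HB BM HG HL HE HG1 HY1 HY HGN HH HN HD qE mnE.
have q0 : 0 <= q by rewrite qE addr_ge0.
have mn0 : 0 <= mn by rewrite mnE le_min q0 ler01.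
have M0 : 0 <= M by clear - M8; lra.
have M2 : 64 <= M ^+ 2 by clear - M8; nra.
have Aq : A <= q by rewrite qE lerDl.
set W := Rr + K + (S + T) * mn.
have ST0 : 0 <= (S + T) * mn by rewrite mulr_ge0// addr_ge0.
have STW : (S + T) * mn <= W by rewrite lerDr addr_ge0.
have W0 : 0 <= W by exact: le_trans STW.
have M4W : M ^+ 4 * W * 64 <= M ^+ 10 * W.
  have -> : M ^+ 10 * W = M ^+ 4 * W * M ^+ 6 by ring.
  rewrite ler_wpM2l ?mulr_ge0 ?exprn_ge0// (le_trans M2)// ler_weXn2l//.
  by clear - M8; lra.
have M4W0 : 0 <= M ^+ 4 * W by rewrite mulr_ge0 ?exprn_ge0.
rewrite -(mulrA 200).
(* The threshold is chosen so that [L ^+ 2 <= A] gives [|L| <= 4^-1], whence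
   [G0 = 1 + 2 * L + A >= 2^-1]. *)
have [A16|A16] := lerP A 16^-1; last first.
  have mn16 : 16^-1 <= mn.
    rewrite mnE le_min; apply/andP; split; first exact: le_trans (ltW A16) Aq.
    by rewrite invf_le1 ?ler1n ?ltr0n.
  have RW : Rr + (S + T) * mn <= W by rewrite /W lerD2r lerDl.
  have := variance_expansion_far M8 S0 T0 R0 hth hth' A16 HA mn16 RW HD.
  clear - M4W M4W0 W0; move: (M ^+ 4 * W) (M ^+ 10 * W) M4W M4W0 (_ ^+ 2) => x y h1 h2 z; lra.
have /andP[L4a L4b] : - 4^-1 <= L <= 4^-1.
  by apply/andP; split; clear - HL A16; nra.
have Gh : 2^-1 <= G0 by rewrite HG; clear - L4a A0; lra.
have G1s : (1 - G0) ^+ 2 <= 9 * A.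
  have A2 : A ^+ 2 <= 16^-1 * A by rewrite expr2 ler_wpM2r.
  by rewrite HG; have := sqr_ge0 (2 * L - A); clear - HL A2 A0; lra.
have G1s1 : (1 - G0) ^+ 2 <= 1 by clear - G1s A16; lra.
have qM : q <= 2 * M ^+ 2 by rewrite qE; clear - M2 A16 BM; lra.
have qmn : q <= 2 * M ^+ 2 * mn.
  rewrite mnE; have [q1|q1] := lerP q 1; last by rewrite mulr1.
  by rewrite -[leLHS]mul1r ler_wpM2r//; clear - M2; lra.
have Amn : A <= mn by rewrite mnE le_min Aq (le_trans A16)// invf_le1 ?ler1n ?ltr0n.
rewrite -qE in HN HY1.
have /andP[V0 Vb] := variance_expansion_mean_shift M0 A0 Aq A16 Gh HG1 HGN HH HN.
pose b := G0 * (th' - th) - D.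
have bE : `|b - Y| <= M ^+ 4 * q.
  have -> : b - Y = (E2 - D - Y) - G0 * c ^+ 2 by rewrite /b HE; ring.
  rewrite (le_trans (ler_normB _ _))// (ger0_norm V0).
  (* The constants 7 and 34 add up to less than 64, which is at most [M ^+ 2]: the assumption
     [8 <= M] lets powers of [M] swallow numerical constants. *)
  have h1 : M ^+ 2 * q * 64 <= M ^+ 4 * q.
    have -> : M ^+ 4 * q = M ^+ 2 * q * M ^+ 2 by ring.
    by rewrite ler_wpM2l// mulr_ge0// sqr_ge0.
  have h2 : 0 <= M ^+ 2 * q by rewrite mulr_ge0// sqr_ge0.
  clear - h1 h2 Vb HY1; move: (`|_|) (G0 * c ^+ 2) HY1 Vb => x y *; lra.
have qb : q <= 2 * (Rr + K) + 2 * (S + T) by rewrite qE; clear - HA HB S0 T0; lra.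
have bb : b ^+ 2 <= 9 * (M ^+ 10 * W).
  exact: (variance_expansion_bracket M8 q0 S0 T0 R0 K0 mn0 qb qM qmn erefl bE HY).
have nn : (th' - th - D) ^+ 2 <= 18 * b ^+ 2 + 1200 * (M ^+ 4 * W).
  exact: (variance_expansion_near M0 A0 Amn (addr_ge0 S0 T0) STW G1s G1s1 Gh erefl HD).
rewrite (le_trans nn)//; clear - bb M4W M4W0.
by move: (b ^+ 2) (M ^+ 4 * W) (M ^+ 10 * W) M4W M4W0 bb => x y z *; lra.
Qed.

(** * Change of measure by a squared density, and Bayes' rule *)

Section density.
Context d (T : measurableType d) (R : realType).
Variables (P P' : probability T R) (g : T -> R).
Hypothesis mg : measurable_fun setT g.
Hypothesis P'E : forall A, measurable A ->
  P' A = (\int[P]_(z in A) (g z ^+ 2)%:E)%E.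

Lemma ge0_integral_sqr_density (f : T -> R) : measurable_fun setT f ->
  (forall z, 0 <= f z) ->
  (\int[P']_z (f z)%:E = \int[P]_z (g z ^+ 2 * f z)%:E)%E.
Proof.
move=> mf f0; rewrite (ge0_integral_density _ _ P'E)//.
- by apply: eq_integral => x _; rewrite mulrC.
- exact: measurable_funX.
- by move=> y; exact: sqr_ge0.
Qed.

Lemma intg_sqr_density : intg P (fun z => g z ^+ 2).
Proof.
apply: intg_ge0 => //; first exact: measurable_funX.
  by move=> z; exact: sqr_ge0.
by rewrite -P'E// probability_setT ltry.
Qed.

(** Adding [K] makes [f] nonnegative, and the integral of the constant is then subtracted on both
    sides. *)
Lemma integral_sqr_density (K : R) (f : T -> R) : measurable_fun setT f ->
  (forall z, `|f z| <= K) ->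
  (\int[P']_z (f z)%:E = \int[P]_z (g z ^+ 2 * f z)%:E)%E.
Proof.
move=> mf fK; have Ig := intg_sqr_density.
have I1 : intg P' (fun z => f z + K).
  apply: (@intg_bounded _ _ _ _ (K + `|K|)); first exact: measurable_funD.
  by move=> z; rewrite (le_trans (ler_normD _ _))// lerD2r.
have I2 : intg P' (fun=> K) by apply: (@intg_bounded _ _ _ _ `|K|).
have J2 : intg P (fun z => g z ^+ 2 * K).
  by under eq_fun do rewrite mulrC; exact: intgZ.
have Jf : intg P (fun z => g z ^+ 2 * f z).
  by under eq_fun do rewrite mulrC; exact: intg_bM fK Ig.
have J1 : intg P (fun z => g z ^+ 2 * (f z + K)).
  by under eq_fun do rewrite mulrDr; exact: intgD.
transitivity (\int[P']_z ((f z + K)%:E - K%:E))%E.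
  by apply: eq_integral => z _; rewrite -EFinB addrK.
rewrite (integralB_EFin measurableT I1 I2) !ge0_integral_sqr_density//.
- rewrite -[LHS](integralB_EFin measurableT J1 J2).
  by apply: eq_integral => z _; rewrite -EFinB mulrDr addrK.
- by move=> z; rewrite (le_trans _ (fK z)).
- exact: measurable_funD.
- by move=> z; have := fK z; rewrite ler_norml; lra.
Qed.

End density.

Section bayes.
Context d d' (Z : measurableType d) (X : measurableType d') (R : realType).
Variables (P P' : probability Z R) (C : {mfun Z >-> X}) (g : Z -> R).
Hypothesis mg : measurable_fun setT g.
Hypothesis P'E : forall A, measurable A ->
  P' A = (\int[P]_(z in A) (g z ^+ 2)%:E)%E.

(** Bayes' rule in multiplied form, which asks nothing of the points where [G0] vanishes. Over the
    preimage of [B], the [P]-integral of [g ^+ 2 * f] is the [P']-integral of [f], hence of [h]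
    composed with [C]; going back to [P] and pulling [h] out produces [G0 * h]. *)
Lemma ice_bayes (K : R) (f : Z -> R) (h G0 : X -> R) :
  measurable_fun setT f -> (forall z, `|f z| <= K) -> (forall x, `|h x| <= K) ->
  is_cond_exp P' C f h -> is_cond_exp P C (fun z => g z ^+ 2) G0 ->
  is_cond_exp P C (fun z => g z ^+ 2 * f z) (fun x => G0 x * h x).
Proof.
move=> mf fK hK ih iG; have mh := ice_measurable ih.
have Ig := intg_sqr_density mg P'E.
have mhC : measurable_fun setT (fun z => h (C z)) by exact: measurable_compC.
have IhC : intg P (fun z => h (C z) * g z ^+ 2).
  exact: (@intg_bM _ _ _ _ K).
have [IG _] := ice_integral mh Ig IhC iG.
split; first by under eq_fun do rewrite mulrC.
move=> B mB; have mCB := measurable_preimage C mB.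
have m1 : measurable_fun setT (\1_(C @^-1` B) : Z -> R).
  exact: measurable_indic.
have b1 (T : Type) (A : set T) x : `|\1_A x : R| <= 1.
  by rewrite indicE; case: (_ \in _); rewrite /= ?normr1 ?normr0.
have Ef (k : Z -> R) : measurable_fun setT k -> (forall z, `|k z| <= K) ->
    (\int[P']_(z in C @^-1` B) (k z)%:E =
     \int[P]_z (g z ^+ 2 * (\1_(C @^-1` B) z * k z))%:E)%E.
  move=> mk kK; rewrite -(@integral_sqr_density _ _ _ P P' g mg P'E K); last 2 first.
  - exact: measurable_funM.
  - by move=> z; rewrite normrM -[leRHS]mul1r ler_pM.
  rewrite integral_mkcond; apply: eq_integral => z _; rewrite patchE indicE.
  by case: ifPn => _; rewrite ?mul1r ?mul0r.
transitivity (\int[P']_(z in C @^-1` B) (f z)%:E)%E.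
  rewrite Ef// integral_mkcond; apply: eq_integral => z _; rewrite patchE indicE.
  by case: ifPn => _; rewrite ?mul1r ?mul0r ?mulr0.
transitivity (\int[P']_(z in C @^-1` B) (h (C z))%:E)%E.
  case: ih => Ih ->//; rewrite integral_pushforward//.
    exact/measurable_EFinP.
  apply: (intg_sub mCB); apply: (@intg_bounded _ _ _ _ K) => //.
rewrite Ef//.
have mV : measurable_fun setT (fun x => \1_B x * h x) by apply: measurable_funM.
have IV : intg P (fun z => (\1_B (C z) * h (C z)) * g z ^+ 2).
  apply: (@intg_bM _ _ _ _ K) => //; first exact: (measurable_compC C mV).
  by move=> z; rewrite normrM -[leRHS]mul1r ler_pM.
have [_ E] := ice_integral mV Ig IV iG.
transitivity (\int[P]_z ((\1_B (C z) * h (C z)) * g z ^+ 2)%:E)%E.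
  by apply: eq_integral => z _; rewrite mulrC.
rewrite E [RHS]integral_mkcond; apply: eq_integral => x _; rewrite patchE indicE.
by case: ifPn => _; rewrite ?mul1r ?mul0r// mulrC.
Qed.

End bayes.

(** * The expansion of the conditional variance at almost every point *)

Section pointwise.
Context d d' (Z : measurableType d) (X : measurableType d') (R : realType).
Variables (P : probability Z R) (C : {mfun Z >-> X}).
Notation PX := (distribution P C).
Notation ice := (is_cond_exp P C).

Lemma ice_lin2 (a b : R) (f1 f2 : Z -> R) (g1 g2 : X -> R) : intg P f1 -> intg P f2 ->
  ice f1 g1 -> ice f2 g2 ->
  ice (fun z => a * f1 z + b * f2 z) (fun x => a * g1 x + b * g2 x).
Proof.
move=> If1 If2 i1 i2; apply: ice_lin => //; first exact: intgZ.
have I0 : intg P (fun=> 0 : R) by apply: (@intg_bounded _ _ _ _ 0) => // z; rewrite normr0.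
have := ice_lin b If2 I0 i2 (ice_cst P C 0).
by congr ice; apply/funext => z; rewrite addr0.
Qed.

(** Here [s] and [t] stand for the directions already multiplied by the time, [r] and [k] for the
    remainders of the two paths, and [h], [th'] for the mean and variance under the perturbed
    law. *)
Variables (M : R) (g s r t k u v : Z -> R) (mu h th th' D : X -> R).
Variables (G0 A B Rr K S T : X -> R).
Hypotheses (M8 : 8 <= M) (g2 : L2 P g) (s2 : L2 P s) (r2 : L2 P r).
Hypotheses (t2 : L2 P t) (k2 : L2 P k).
Hypotheses (mfu : measurable_fun setT u) (mv : measurable_fun setT v).
Hypotheses (mmu : measurable_fun setT mu) (mh : measurable_fun setT h).
Hypotheses (mth : measurable_fun setT th).
Hypothesis gE : forall z, g z = 1 + 2^-1 * s z + r z.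
Hypothesis vE : forall z, v z = u z + t z + k z.
Hypothesis muM : forall z, `|u z - mu (C z)| <= M.
Hypothesis mvM : forall z, `|v z - mu (C z)| <= M.
Hypothesis vuM : forall z, `|v z - u z| <= M.
Hypothesis hM : forall x, `|h x - mu x| <= M.
Hypothesis uM : forall z, `|u z| <= M.
Hypothesis vM : forall z, `|v z| <= M.
Hypothesis mubM : forall x, `|mu x| <= M.
Hypothesis thM : forall x, 0 <= th x <= M ^+ 2.
Hypothesis th'M : forall x, 0 <= th' x <= M ^+ 2.
Hypotheses (i_mu : ice u mu) (i_th : ice (fun z => (u z - mu (C z)) ^+ 2) th).
Hypothesis i_D : ice (fun z => s z * ((u z - mu (C z)) ^+ 2 - th (C z)) +
  2 * (t z * (u z - mu (C z)))) D.
Hypotheses (i_G0 : ice (fun z => g z ^+ 2) G0).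
Hypothesis i_h : ice (fun z => g z ^+ 2 * v z) (fun x => G0 x * h x).
Hypothesis i_th' : ice (fun z => g z ^+ 2 * (v z - h (C z)) ^+ 2)
  (fun x => G0 x * th' x).
Hypotheses (i_A : ice (fun z => (g z - 1) ^+ 2) A).
Hypotheses (i_B : ice (fun z => (v z - u z) ^+ 2) B).
Hypotheses (i_R : ice (fun z => r z ^+ 2) Rr) (i_K : ice (fun z => k z ^+ 2) K).
Hypotheses (i_S : ice (fun z => s z ^+ 2) S) (i_T : ice (fun z => t z ^+ 2) T).

Let f0 z := u z - mu (C z).
Let w z := v z - mu (C z).
Let a z := g z - 1.
Let dl z := v z - u z.
Let phi z := f0 z ^+ 2 - th (C z).

Let mf0 : measurable_fun setT f0.
Proof. by apply: measurable_funB => //; exact: measurable_compC. Qed.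
Let mw : measurable_fun setT w.
Proof. by apply: measurable_funB => //; exact: measurable_compC. Qed.
Let mphi : measurable_fun setT phi.
Proof.
by apply: measurable_funB; [exact: measurable_funX|exact: measurable_compC].
Qed.
Let phiM z : `|phi z| <= M ^+ 2.
Proof.
have := muM z; have /andP[] := thM (C z); rewrite /phi /f0.
set y := _ - _; set q := th _ => q0 q1 yM.
have : y ^+ 2 <= M ^+ 2.
  exact: (ler_sqr_norm yM).
by rewrite ler_norml; have := sqr_ge0 y; lra.
Qed.
Let a2 : L2 P a.
Proof.
apply: L2B => //; apply: (@L2_bounded _ _ _ _ 1) => // z.
by rewrite normr1.
Qed.
Let dl2 : L2 P dl.
Proof. by apply: (@L2_bounded _ _ _ _ M) => //; exact: measurable_funB. Qed.
Let mg : measurable_fun setT g. Proof. exact: L2_measurable g2. Qed.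
Let Ig : intg P (fun z => g z ^+ 2). Proof. exact: L2_sqr. Qed.
Let Ia : intg P (fun z => a z ^+ 2). Proof. exact: L2_sqr. Qed.
Let Idl : intg P (fun z => dl z ^+ 2). Proof. exact: L2_sqr. Qed.
Let Ir : intg P (fun z => r z ^+ 2). Proof. exact: L2_sqr. Qed.
Let Ik : intg P (fun z => k z ^+ 2). Proof. exact: L2_sqr. Qed.
Let Is : intg P (fun z => s z ^+ 2). Proof. exact: L2_sqr. Qed.
Let It : intg P (fun z => t z ^+ 2). Proof. exact: L2_sqr. Qed.
Let Igb (c : R) (f : Z -> R) : measurable_fun setT f -> (forall z, `|f z| <= c) ->
  intg P (fun z => g z ^+ 2 * f z).
Proof. by move=> mf fM; under eq_fun do rewrite mulrC; exact: intg_bM fM Ig. Qed.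
Let L2Mb (c : R) (f f1 : Z -> R) : measurable_fun setT f -> (forall z, `|f z| <= c) ->
  L2 P f1 -> L2 P (fun z => f1 z * f z).
Proof. by move=> mf fM f12; under eq_fun do rewrite mulrC; exact: L2_bM fM f12. Qed.

Let D2 : L2 P (fun z => s z * phi z + 2 * (t z * f0 z)).
Proof. by apply: L2D; [exact: L2Mb phiM s2|apply: L2Z; exact: L2Mb muM t2]. Qed.
Let Yf z := 2 * (k z * f0 z) + 2 * (r z * phi z).
Let Y2 : L2 P Yf.
Proof.
by apply: L2D; apply: L2Z; [exact: L2Mb muM k2|exact: L2Mb phiM r2].
Qed.
Let Nf z := 2 * (a z * w z) + dl z.
Let N2 : L2 P Nf.
Proof. by apply: L2D => //; apply: L2Z; exact: L2Mb mvM a2. Qed.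

Let facts1 : {ae PX, forall x, [/\ 0 <= A x, 0 <= B x, 0 <= Rr x & 0 <= K x] /\
  [/\ 0 <= S x, 0 <= T x, A x <= 2 * Rr x + 2^-1 * S x,
      B x <= 2 * K x + 2 * T x & B x <= M ^+ 2]}.
Proof.
have sq (f : Z -> R) z : 0 <= f z ^+ 2 by exact: sqr_ge0.
have h1 := ice_ge0 (sq a) i_A. have h2 := ice_ge0 (sq dl) i_B.
have h3 := ice_ge0 (sq r) i_R. have h4 := ice_ge0 (sq k) i_K.
have h5 := ice_ge0 (sq s) i_S. have h6 := ice_ge0 (sq t) i_T.
have h7 : {ae PX, forall x, A x <= 2 * Rr x + 2^-1 * S x}.
  have J := ice_lin2 2 2^-1 Ir Is i_R i_S.
  apply: (ice_le Ia _ _ i_A J); first by apply: intgD; exact: intgZ.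
  move=> z; rewrite /a gE; have := sqr_ge0 (r z - 2^-1 * s z); lra.
have h8 : {ae PX, forall x, B x <= 2 * K x + 2 * T x}.
  have J := ice_lin2 2 2 Ik It i_K i_T.
  apply: (ice_le Idl _ _ i_B J); first by apply: intgD; exact: intgZ.
  move=> z; rewrite /dl vE; have := sqr_ge0 (k z - t z); lra.
have h9 : {ae PX, forall x, B x <= M ^+ 2}.
  apply: (ice_le Idl _ _ i_B (ice_cst P C (M ^+ 2))).
    by apply: (@intg_bounded _ _ _ _ (`|M ^+ 2|)).
  by move=> z; apply: ler_sqr_norm; exact: vuM.
have H := ae_and h1 (ae_and h2 (ae_and h3 (ae_and h4 (ae_and h5
  (ae_and h6 (ae_and h7 (ae_and h8 h9))))))).
apply: filterS H => x [? [? [? [? [? [? [? [? ?]]]]]]]].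
by split; split.
Qed.


(** Jensen's inequality followed by monotonicity; it controls the squares of the first-order terms
    [Y], [N] and [D]. *)
Let jensen_le (c : R) (f q1 q2 : Z -> R) (F Q1 Q2 : X -> R) : L2 P f ->
  intg P q1 -> intg P q2 -> ice f F -> ice q1 Q1 -> ice q2 Q2 ->
  (forall z, f z ^+ 2 <= c * (q1 z + q2 z)) ->
  {ae PX, forall x, F x ^+ 2 <= c * (Q1 x + Q2 x)}.
Proof.
move=> f2 I1 I2 iF i1 i2 fq.
have If2 := L2_sqr f2.
have j := cond_expP C If2.
have J := ice_lin2 c c I1 I2 i1 i2.
have h1 : {ae PX, forall x, cond_exp P C (fun z => f z ^+ 2) x <= c * Q1 x + c * Q2 x}.
  apply: (ice_le If2 _ _ j J); first by apply: intgD; exact: intgZ.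
  by move=> z; rewrite -mulrDr.
have h2 := ice_jensen f2 iF j.
by apply: filterS (ae_and h1 h2) => x []; rewrite mulrDr; lra.
Qed.

Let ice_eqf (f f' : Z -> R) (F : X -> R) : (forall z, f z = f' z) -> ice f F -> ice f' F.
Proof. by move=> ff'; rewrite (_ : f' = f)//; apply/funext. Qed.

(** [L] is the conditional expectation of [a = g - 1]; the identity expands [g ^+ 2] around 1 and
    the inequality is Jensen's. *)
Let facts2 : exists L : X -> R,
  {ae PX, forall x, G0 x = 1 + 2 * L x + A x /\ L x ^+ 2 <= A x}.
Proof.
have Ia1 : intg P a by exact: L2_intg.
exists (cond_exp P C a); have iL := cond_expP C Ia1.
have I1 : intg P (fun=> 1 : R) by apply: (@intg_bounded _ _ _ _ `|1|).
have J := ice_lin2 2 1 Ia1 Ia iL i_A.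
have IJ : intg P (fun z => 2 * a z + 1 * a z ^+ 2).
  by apply: intgD; exact: intgZ.
have J' := ice_lin2 1 1 I1 IJ (ice_cst P C 1) J.
have h1 := ice_unique i_G0 (ice_eqf _ J').
have h2 := ice_jensen a2 iL i_A.
have {}h1 := h1 ltac:(by move=> z; rewrite /a; ring).
apply: filterS (ae_and h1 h2) => x [-> ?]; split => //; ring.
Qed.

Let w2M z : `|w z ^+ 2| <= M ^+ 2.
Proof. by rewrite ger0_norm ?sqr_ge0// ler_sqr_norm// mvM. Qed.

(** The perturbed variance is recentred at the unperturbed mean [mu]. With [c = h - mu], the square
    of [v - h] is [w ^+ 2 - 2 * c * w + c ^+ 2], and [G1 = G0 * c] merges the last two terms into
    [- G0 * c ^+ 2]. *)
Let facts3 : exists E22 G1 : X -> R,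
  [/\ ice (fun z => g z ^+ 2 * w z ^+ 2) E22, ice (fun z => g z ^+ 2 * w z) G1 &
  {ae PX, forall x, G1 x = G0 x * (h x - mu x) /\
    G0 x * (th' x - th x) = (E22 x - th x * G0 x) - G0 x * (h x - mu x) ^+ 2}].
Proof.
have mw2 : measurable_fun setT (fun z => w z ^+ 2) by exact: measurable_funX.
have I22 := Igb mw2 w2M.
have I1 := Igb mw mvM.
have i22 := cond_expP C I22. have i1 := cond_expP C I1.
set E22 := cond_exp _ _ _ in i22. set G1 := cond_exp _ _ _ in i1.
exists E22, G1; split; [exact: i22|exact: i1|].
have mmuC : measurable_fun setT (fun z => mu (C z)) by exact: measurable_compC.
have Imu : intg P (fun z => mu (C z) * g z ^+ 2) by apply: (@intg_bM _ _ _ _ M) => // z; exact: mubM.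
have imu := ice_pullout mmu Ig Imu i_G0.
have Igv := Igb mv vM.
have h1 : {ae PX, forall x, G1 x = 1 * (G0 x * h x) + (-1) * (mu x * G0 x)}.
  apply: ice_unique i1 (ice_eqf _ (ice_lin2 1 (-1) Igv Imu i_h imu)).
  by move=> z; rewrite /w; ring.
pose c x := h x - mu x.
have mc : measurable_fun setT c by exact: measurable_funB.
have mcC : measurable_fun setT (fun z => c (C z)) by exact: measurable_compC.
have mc2 : measurable_fun setT (fun x => c x ^+ 2) by exact: measurable_funX.
have c2M x : `|c x ^+ 2| <= M ^+ 2.
  by rewrite ger0_norm ?sqr_ge0// ler_sqr_norm// hM.
have Ic1 : intg P (fun z => c (C z) * (g z ^+ 2 * w z)).
  by apply: (@intg_bM _ _ _ _ M) => // z; exact: hM.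
have Ic2 : intg P (fun z => c (C z) ^+ 2 * g z ^+ 2).
  by apply: (@intg_bM _ _ _ _ (M ^+ 2)) => //; exact: measurable_funX.
have ic1 := ice_pullout mc I1 Ic1 i1.
have ic2 := ice_pullout mc2 Ig Ic2 i_G0.
have J1 := ice_lin2 (-2) 1 Ic1 Ic2 ic1 ic2.
have IJ1 : intg P (fun z => -2 * (c (C z) * (g z ^+ 2 * w z)) +
    1 * (c (C z) ^+ 2 * g z ^+ 2)) by apply: intgD; exact: intgZ.
have J2 := ice_lin2 1 1 I22 IJ1 i22 J1.
have h2 : {ae PX, forall x, G0 x * th' x = 1 * E22 x +
    1 * (-2 * (c x * G1 x) + 1 * (c x ^+ 2 * G0 x))}.
  apply: ice_unique i_th' (ice_eqf _ J2).
  by move=> z; rewrite /w /c; ring.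
apply: filterS (ae_and h1 h2) => x [{}h1 {}h2].
have e1 : G1 x = G0 x * (h x - mu x) by rewrite h1; ring.
split => //; rewrite mulrBr h2 e1 /c; ring.
Qed.

(** With [g = 1 + a] and [w = f0 + dl], the part of [g ^+ 2 * (w ^+ 2 - th)] of order at most one is
    [phi + 2 * a * phi + 2 * f0 * dl]. Inserting [2 * a = s + 2 * r] and [dl = t + k] turns it into
    [phi], the integrand of [D], and the integrand [Yf] of [Y], which collects the terms linear in
    [r] and [k]. *)
Let facts4 (E22 : X -> R) : ice (fun z => g z ^+ 2 * w z ^+ 2) E22 ->
  exists Y : X -> R, {ae PX, forall x,
    `|E22 x - th x * G0 x - D x - Y x| <= 7 * M ^+ 2 * (A x + B x) /\
    Y x ^+ 2 <= 8 * M ^+ 4 * (Rr x + K x)}.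
Proof.
move=> i22; have M8' := M8.
have mw2 : measurable_fun setT (fun z => w z ^+ 2) by exact: measurable_funX.
have I22 := Igb mw2 w2M.
have IY : intg P Yf by exact: L2_intg.
have iY := cond_expP C IY; set Y := cond_exp _ _ _ in iY.
have ID : intg P (fun z => s z * phi z + 2 * (t z * f0 z)) by exact: L2_intg.
have mthC : measurable_fun setT (fun z => th (C z)) by exact: measurable_compC.
have thM' x : `|th x| <= M ^+ 2.
  by case/andP: (thM x) => ? ?; rewrite ger0_norm.
have Itg : intg P (fun z => th (C z) * g z ^+ 2).
  by apply: (@intg_bM _ _ _ _ (M ^+ 2)).
have Ith : intg P (fun z => th (C z) * 1).
  apply: (@intg_bounded _ _ _ _ (M ^+ 2)); first exact: measurable_funM.
  by move=> z; rewrite mulr1.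
have I1 : intg P (fun=> 1 : R) by apply: (@intg_bounded _ _ _ _ `|1|).
have itg := ice_pullout mth Ig Itg i_G0.
have ith := ice_pullout mth I1 Ith (ice_cst P C 1).
have If02 : intg P (fun z => f0 z ^+ 2).
  apply: (@intg_bounded _ _ _ _ (M ^+ 2)); first exact: measurable_funX.
  by move=> z; rewrite ger0_norm ?sqr_ge0// ler_sqr_norm// muM.
have J1 := ice_lin2 1 (-1) I22 Itg i22 itg.
have K1 := intgD (intgZ 1 I22) (intgZ (-1) Itg).
have J2 := ice_lin2 1 1 ID IY i_D iY.
have K2 := intgD (intgZ 1 ID) (intgZ 1 IY).
(* This is [phi], whose conditional expectation is [th - th = 0]: subtracting it cancels the term of
   order zero inside the integrand at no cost outside. *)
have J3 := ice_lin2 1 (-1) If02 Ith i_th ith.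
have K3 := intgD (intgZ 1 If02) (intgZ (-1) Ith).
have J4 := ice_lin2 (-1) (-1) K2 K3 J2 J3.
have K4 := intgD (intgZ (-1) K2) (intgZ (-1) K3).
have J := ice_lin2 1 1 K1 K4 J1 J4.
have KJ := intgD (intgZ 1 K1) (intgZ 1 K4).
have JAB c := ice_lin2 c c Ia Idl i_A i_B.
have KAB c := intgD (intgZ c Ia) (intgZ c Idl).
(* What remains after the terms of order zero and one are removed. The coefficients 1 and -1 are
   kept so that the integrand matches the term produced by [ice_lin2]. *)
pose Psi z := 1 * (1 * (g z ^+ 2 * w z ^+ 2) + -1 * (th (C z) * g z ^+ 2)) +
  1 * (-1 * (1 * (s z * phi z + 2 * (t z * f0 z)) + 1 * Yf z) +
       -1 * (1 * f0 z ^+ 2 + -1 * (th (C z) * 1))).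
have PsiE z : Psi z = dl z ^+ 2 + 2 * a z * dl z * (2 * f0 z + dl z) +
    a z ^+ 2 * (w z ^+ 2 - th (C z)).
  rewrite /Psi /Yf /phi /dl /a /w /f0 gE vE; by field.
have Psib z : `|Psi z| <= 7 * M ^+ 2 * (a z ^+ 2 + dl z ^+ 2).
  rewrite PsiE.
  have h1 : `|2 * f0 z + dl z| <= 3 * M.
    rewrite (le_trans (ler_normD _ _))// normrM (ger0_norm (_ : 0 <= 2))//.
    by have := muM z; have := vuM z; rewrite -/(dl z) -/(f0 z); lra.
  have h2 : `|w z ^+ 2 - th (C z)| <= M ^+ 2.
    have := w2M z; have := sqr_ge0 (w z); have /andP[] := thM (C z).
    by rewrite !ler_norml; lra.
  have h3 : `|2 * a z * dl z| <= a z ^+ 2 + dl z ^+ 2.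
    have := sqr_ge0 (a z - dl z); have := sqr_ge0 (a z + dl z).
    by rewrite ler_norml; lra.
  have q0 : 0 <= a z ^+ 2 + dl z ^+ 2 by rewrite addr_ge0 ?sqr_ge0.
  have M2 : 8 * M <= M ^+ 2 by nra.
  have M1 : 8 <= M ^+ 2 by lra.
  rewrite (le_trans (ler_normD _ _))//.
  have : `|dl z ^+ 2 + 2 * a z * dl z * (2 * f0 z + dl z)| <=
      dl z ^+ 2 + (a z ^+ 2 + dl z ^+ 2) * (3 * M).
    rewrite (le_trans (ler_normD _ _))// ger0_norm ?sqr_ge0// lerD2l normrM.
    by rewrite ler_pM.
  have : `|a z ^+ 2 * (w z ^+ 2 - th (C z))| <= a z ^+ 2 * M ^+ 2.
    by rewrite normrM ger0_norm ?sqr_ge0// ler_wpM2l ?sqr_ge0.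
  have : (a z ^+ 2 + dl z ^+ 2) * (3 * M) <= (a z ^+ 2 + dl z ^+ 2) * M ^+ 2.
    by rewrite ler_wpM2l//; lra.
  have := sqr_ge0 (a z); have := sqr_ge0 (dl z).
  have : a z ^+ 2 * 8 <= a z ^+ 2 * M ^+ 2 by rewrite ler_wpM2l ?sqr_ge0.
  have : dl z ^+ 2 * 8 <= dl z ^+ 2 * M ^+ 2 by rewrite ler_wpM2l ?sqr_ge0.
  lra.
have h1 : {ae PX, forall x, Y x ^+ 2 <= 8 * M ^+ 4 * (Rr x + K x)}.
  apply: (jensen_le Y2 Ir Ik iY i_R i_K) => z.
  have f02 : f0 z ^+ 2 <= M ^+ 2 by rewrite ler_sqr_norm// muM.
  have p2 : phi z ^+ 2 <= (M ^+ 2) ^+ 2 by rewrite ler_sqr_norm.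
  have M4 : M ^+ 2 <= M ^+ 4 by rewrite ler_weXn2l//; lra.
  have e : Yf z ^+ 2 <= 8 * (k z ^+ 2 * f0 z ^+ 2) + 8 * (r z ^+ 2 * phi z ^+ 2).
    by rewrite /Yf; have := sqr_ge0 (k z * f0 z - r z * phi z); lra.
  have e1 : k z ^+ 2 * f0 z ^+ 2 <= k z ^+ 2 * M ^+ 4.
    by rewrite ler_wpM2l ?sqr_ge0// (le_trans f02).
  have e2 : r z ^+ 2 * phi z ^+ 2 <= r z ^+ 2 * M ^+ 4.
    by rewrite ler_wpM2l ?sqr_ge0// (le_trans p2)// -exprM.
  lra.
have h2 : {ae PX, forall x, E22 x - th x * G0 x - D x - Y x <= 7 * M ^+ 2 * (A x + B x)}.
  have : {ae PX, forall x, _} := ice_le KJ (KAB (7 * M ^+ 2)) _ J (JAB (7 * M ^+ 2)).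
  move=> /(_ _) H.
  have {}H := H ltac:(by move=> z; have := Psib z; rewrite -/(Psi z) ler_norml -mulrDr => /andP[]).
  by apply: filterS H => x; lra.
have h3 : {ae PX, forall x, - (7 * M ^+ 2 * (A x + B x)) <= E22 x - th x * G0 x - D x - Y x}.
  have H := ice_le (KAB (- (7 * M ^+ 2))) KJ _ (JAB (- (7 * M ^+ 2))) J.
  have {}H := H ltac:(by move=> z; have := Psib z; rewrite -/(Psi z) ler_norml -mulrDr mulNr => /andP[]).
  by apply: filterS H => x; lra.
exists Y; apply: filterS (ae_and h1 (ae_and h2 h3)) => x [? [? ?]].
by split => //; rewrite ler_norml; apply/andP.
Qed.

(** [g ^+ 2 * w] equals [f0 + (2 * a * w + dl) + a ^+ 2 * w], and [f0] has conditional mean zero.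
    The last term is kept apart as [H]: it need not be square-integrable, so it is bounded directly
    by [M * A], whereas [N] is handled by Jensen's inequality. *)
Let facts5 (G1 : X -> R) : ice (fun z => g z ^+ 2 * w z) G1 ->
  exists H N : X -> R, {ae PX, forall x, [/\ G1 x = H x + N x,
    `|H x| <= M * A x & N x ^+ 2 <= 8 * M ^+ 2 * (A x + B x)]}.
Proof.
move=> i1; have M8' := M8.
have Iaw : intg P (fun z => a z ^+ 2 * w z).
  by under eq_fun do rewrite mulrC; exact: intg_bM mvM Ia.
have IN : intg P Nf by exact: L2_intg.
have iH := cond_expP C Iaw; set H := cond_exp _ _ _ in iH.
have iN := cond_expP C IN; set N := cond_exp _ _ _ in iN.
exists H, N.
have If0 : intg P f0 by apply: (@intg_bounded _ _ _ _ M).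
have Iu : intg P u by apply: (@intg_bounded _ _ _ _ M).
have I1 : intg P (fun=> 1 : R) by apply: (@intg_bounded _ _ _ _ `|1|).
have Imu : intg P (fun z => mu (C z) * 1).
  apply: (@intg_bounded _ _ _ _ M); last by move=> z; rewrite mulr1.
  by apply: measurable_funM => //; exact: measurable_compC.
have imu := ice_pullout mmu I1 Imu (ice_cst P C 1).
have J1 := ice_lin2 1 (-1) Iu Imu i_mu imu.
have K1 := intgD (intgZ 1 Iu) (intgZ (-1) Imu).
have J2 := ice_lin2 1 1 Iaw IN iH iN.
have K2 := intgD (intgZ 1 Iaw) (intgZ 1 IN).
have J := ice_lin2 1 1 K1 K2 J1 J2.
have h1 := ice_unique i1 (ice_eqf _ J).
have {}h1 := h1 ltac:(by move=> z; rewrite /Nf /dl /a /w; ring).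
have h2 : {ae PX, forall x, H x <= M * A x}.
  have JA := ice_lin2 M 0 Ia Ia i_A i_A.
  have KA := intgD (intgZ M Ia) (intgZ 0 Ia).
  have q := ice_le Iaw KA _ iH JA.
  have {}q := q ltac:(by move=> z; rewrite mul0r addr0 mulrC ler_wpM2r ?sqr_ge0//;
    have := mvM z; rewrite ler_norml => /andP[]).
  by apply: filterS q => x; rewrite mul0r addr0.
have h3 : {ae PX, forall x, - (M * A x) <= H x}.
  have JA := ice_lin2 (- M) 0 Ia Ia i_A i_A.
  have KA := intgD (intgZ (- M) Ia) (intgZ 0 Ia).
  have q := ice_le KA Iaw _ JA iH.
  have {}q := q ltac:(by move=> z; rewrite mul0r addr0 [leRHS]mulrC ler_wpM2r ?sqr_ge0//;
    have := mvM z; rewrite ler_norml => /andP[]).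
  by apply: filterS q => x; rewrite mul0r addr0 mulNr.
have h4 : {ae PX, forall x, N x ^+ 2 <= 8 * M ^+ 2 * (A x + B x)}.
  apply: (jensen_le N2 Ia Idl iN i_A i_B) => z.
  have e : Nf z ^+ 2 <= 8 * (a z ^+ 2 * w z ^+ 2) + 2 * dl z ^+ 2.
    by rewrite /Nf; have := sqr_ge0 (2 * (a z * w z) - dl z); lra.
  have e1 : a z ^+ 2 * w z ^+ 2 <= a z ^+ 2 * M ^+ 2.
    by rewrite ler_wpM2l ?sqr_ge0// ler_sqr_norm// mvM.
  have e2 : dl z ^+ 2 <= M ^+ 2 * dl z ^+ 2.
    by rewrite ler_peMl ?sqr_ge0// exprn_ege1//; lra.
  by have := sqr_ge0 (dl z); lra.
apply: filterS (ae_and h1 (ae_and h2 (ae_and h3 h4))) => x [-> [? [? ?]]].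
by split => //; [ring|rewrite ler_norml; apply/andP].
Qed.

Let facts6 : {ae PX, forall x, D x ^+ 2 <= 8 * M ^+ 4 * (S x + T x)}.
Proof.
have M8' := M8; apply: (jensen_le D2 Is It i_D i_S i_T) => z.
have f02 : f0 z ^+ 2 <= M ^+ 2 by rewrite ler_sqr_norm// muM.
have p2 : phi z ^+ 2 <= (M ^+ 2) ^+ 2 by rewrite ler_sqr_norm.
have M4 : M ^+ 2 <= M ^+ 4 by rewrite ler_weXn2l//; lra.
have e : (s z * phi z + 2 * (t z * f0 z)) ^+ 2 <=
    2 * (s z ^+ 2 * phi z ^+ 2) + 8 * (t z ^+ 2 * f0 z ^+ 2).
  by have := sqr_ge0 (s z * phi z - 2 * (t z * f0 z)); lra.
have e1 : t z ^+ 2 * f0 z ^+ 2 <= t z ^+ 2 * M ^+ 4.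
  by rewrite ler_wpM2l ?sqr_ge0// (le_trans f02).
have e2 : s z ^+ 2 * phi z ^+ 2 <= s z ^+ 2 * M ^+ 4.
  by rewrite ler_wpM2l ?sqr_ge0// (le_trans p2)// -exprM.
have : 0 <= s z ^+ 2 * M ^+ 4 by rewrite mulr_ge0 ?sqr_ge0// exprn_ge0//; lra.
lra.
Qed.

Lemma cond_var_expansion : {ae PX, forall x, (th' x - th x - D x) ^+ 2 <=
  200 * M ^+ 10 * (Rr x + K x + (S x + T x) * Num.min (A x + B x) 1)}.
Proof.
have [L h2] := facts2.
have [E22 [G1 [i22 i1 h3]]] := facts3.
have [Y h4] := facts4 i22.
have [H [N h5]] := facts5 i1.
apply: filterS (ae_and facts1 (ae_and h2 (ae_and h3 (ae_and h4 (ae_and h5 facts6))))).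
move=> x [[[A0 B0 R0 K0] [S0 T0 HA HB BM]] [[HG HL] [[HG1 HE] [[HY1 HY] [[HGN HH HN] HD]]]]].
exact: (variance_expansion_algebra M8 A0 B0 R0 K0 S0 T0 (thM x) (th'M x) HA HB BM
  HG HL HE HG1 HY1 HY HGN HH HN HD erefl erefl).
Qed.

End pointwise.

(** * Real-valued Radon-Nikodym derivatives and square roots of densities *)

Section radon_nikodym_density.
Context d (T : measurableType d) (R : realType).
Implicit Types (nu mu : {finite_measure set T -> \bar R}).

Lemma measurable_density nu mu : nu `<< mu -> measurable_fun setT (density nu mu).
Proof.
move=> numu; apply: (intg_measurable (mu := mu)).
rewrite (_ : EFin \o _ = RNderiv nu mu); first exact: Radon_Nikodym_integrable.
by apply/funext => x; rewrite /= /density fineK// Radon_Nikodym_fin_num.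
Qed.

Lemma EFin_density nu mu : nu `<< mu -> EFin \o density nu mu = RNderiv nu mu.
Proof.
by move=> numu; apply/funext => x; rewrite /= fineK// Radon_Nikodym_fin_num.
Qed.

Lemma density_integral nu mu : nu `<< mu -> forall A, measurable A ->
  nu A = (\int[mu]_(x in A) (density nu mu x)%:E)%E.
Proof.
move=> numu A mA; have := Radon_Nikodym_integral (nu := charge_of_finite_measure nu) numu mA.
by rewrite -/(RNderiv nu mu) -(EFin_density numu).
Qed.

Lemma density_ge0 nu mu : nu `<< mu -> {ae mu, forall x, 0 <= density nu mu x}.
Proof.
move=> numu; apply: ae_ge0_of_integral => [|B mB].
  by rewrite EFin_density//; exact: Radon_Nikodym_integrable.
by rewrite -(density_integral numu).
Qed.

(** The derivative is nonnegative only almost everywhere; its positive part is nonnegative at every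
    point, as the transfer of integrals requires. *)
Definition pdensity nu mu x := Num.max (density nu mu x) 0.

Lemma pdensity_ge0 nu mu x : 0 <= pdensity nu mu x.
Proof. by rewrite /pdensity le_max lexx orbT. Qed.

Lemma pdensityE nu mu : nu `<< mu ->
  {ae mu, forall x, density nu mu x = pdensity nu mu x}.
Proof.
by move=> /density_ge0; apply: filterS => x x0; rewrite /pdensity max_l.
Qed.

Lemma measurable_pdensity nu mu : nu `<< mu -> measurable_fun setT (pdensity nu mu).
Proof. by move=> ?; apply: measurable_maxr => //; exact: measurable_density. Qed.

Lemma pdensity_integral nu mu : nu `<< mu -> forall A, measurable A ->
  nu A = (\int[mu]_(x in A) (pdensity nu mu x)%:E)%E.
Proof.
move=> numu A mA; rewrite (density_integral numu)//; apply: ae_eq_integral => //.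
- by apply/measurable_EFinP; apply: measurable_funTS; exact: measurable_density.
- by apply/measurable_EFinP; apply: measurable_funTS; exact: measurable_pdensity.
- by apply: ae_EFin; exact: pdensityE.
Qed.

Lemma ge0_integral_pdensity nu mu (f : T -> R) : nu `<< mu ->
  measurable_fun setT f -> (forall z, 0 <= f z) ->
  (\int[nu]_z (f z)%:E = \int[mu]_z (f z * pdensity nu mu z)%:E)%E.
Proof.
move=> numu; apply: ge0_integral_density; last exact: pdensity_integral.
- exact: measurable_pdensity.
- exact: pdensity_ge0.
Qed.

(** The form in which bounded densities enter the norm estimates, with [nu] and [mu] being [QX] and
    [PX], or [P] and [Q]. *)
Lemma ge0_le_integral_bounded_density nu mu (K : R) (f : T -> R) : nu `<< mu ->
  {ae mu, forall x, density nu mu x <= K} -> 0 <= K ->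
  measurable_fun setT f -> (forall z, 0 <= f z) ->
  (\int[nu]_z (f z)%:E <= K%:E * \int[mu]_z (f z)%:E)%E.
Proof.
move=> numu pK K0 mf f0; have mp := measurable_pdensity numu.
rewrite (ge0_integral_pdensity numu)// -ge0_integralZl//; last 2 first.
- exact/measurable_EFinP.
- by move=> z _; rewrite lee_fin.
apply: ae_ge0_le_integral => //.
- by move=> z _; rewrite lee_fin mulr_ge0// pdensity_ge0.
- by apply/measurable_EFinP; exact: measurable_funM.
- by move=> z _; rewrite lee_fin mulr_ge0.
- by apply/measurable_EFinP; exact: measurable_funM.
- apply: filterS pK => x xK _; rewrite lee_fin mulrC ler_wpM2r//.
  by rewrite /pdensity ge_max xK.
Qed.

Lemma bounded_densityP (nu mu : probability T R) : nu `<< mu ->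
  ('N[mu]_+oo[RNderiv nu mu] < +oo)%E ->
  exists2 K : R, 0 <= K & {ae mu, forall x, `|density nu mu x| <= K}.
Proof.
move=> numu; rewrite unlock /= probability_setT lte01 => soo.
set E := ess_sup _ _ in soo.
have hE : {ae mu, forall x, `|RNderiv nu mu x| <= E}%E by exact: ess_sup_ge.
exists (Num.max 0 (fine E)); first by rewrite le_max lexx.
apply: filterS hE => x; rewrite -(EFin_density numu) /=.
move: soo; case: (E) => [r| |]//= _; rewrite ?leeNy_eq//.
by rewrite lee_fin le_max => ->; rewrite orbT.
Qed.

Lemma L2_bounded_density nu mu (K : R) (f : T -> R) : nu `<< mu ->
  {ae mu, forall x, density nu mu x <= K} -> 0 <= K -> L2 mu f -> L2 nu f.
Proof.
move=> numu pK K0 /L2P[mf If]; apply/L2P; split => //.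
apply: intg_ge0; [exact: measurable_funX|by move=> x; exact: sqr_ge0|].
apply: le_lt_trans (ge0_le_integral_bounded_density numu pK K0 _ _) _.
- exact: measurable_funX.
- by move=> x; exact: sqr_ge0.
- by apply: lte_mul_pinfty => //; exact: intg_lty.
Qed.

End radon_nikodym_density.

Section qmd.
Context d (T : measurableType d) (R : realType).

(* [g] is the square root of the density of [P'] with respect to [P]; the
   dominating measure [P + P'] of [qmd_remainder] disappears by the chain rule. *)
Lemma qmd_density (P P' : probability T R) (s : T -> R) (e : R) :
  P `<< P' -> P' `<< P -> measurable_fun setT s ->
  exists g : T -> R, [/\ measurable_fun setT g,
    forall A, measurable A -> P' A = (\int[P]_(z in A) (g z ^+ 2)%:E)%E &
    (\int[P]_z ((g z - (1 + 2^-1 * (e * s z))) ^+ 2)%:E <= qmd_remainder P P' s e)%E].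
Proof.
move=> PP' P'P ms.
pose la : {finite_measure set T -> \bar R} := measure_add P P'.
have laE A : la A = (P A + P' A)%E by rewrite /la /= measure_addE.
have Pla : P `<< la.
  apply/null_content_dominatesP => A mA la0.
  have := laE A; rewrite (la0 : la A = 0%E) => /esym/eqP.
  by rewrite padde_eq0// => /andP[/eqP].
have P'la : P' `<< la by exact: null_dominates_trans P'P Pla.
pose p0 := pdensity P la. pose p1 := pdensity P' la.
have mp0 : measurable_fun setT p0 by exact: measurable_pdensity.
have mp1 : measurable_fun setT p1 by exact: measurable_pdensity.
have p00 x : 0 <= p0 x by exact: pdensity_ge0.
have p10 x : 0 <= p1 x by exact: pdensity_ge0.
have msqrt : measurable_fun setT (@Num.sqrt R).
  by apply: continuous_measurable_fun; exact: sqrt_continuous.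
pose q := pdensity P' P.
have mq : measurable_fun setT q by exact: measurable_pdensity.
have q0 x : 0 <= q x by exact: pdensity_ge0.
(* Both sides integrate to [P' A] over every measurable [A], which determines an integrable function
   up to a null set. *)
have p1E : {ae la, forall z, q z * p0 z = p1 z}.
  have Ip1 : intg la p1.
    apply: intg_ge0 => //; rewrite -(pdensity_integral P'la measurableT).
    by rewrite ltey_eq fin_num_measure.
  have Iqp : intg la (fun z => q z * p0 z).
    apply: intg_ge0; [exact: measurable_funM|by move=> x; exact: mulr_ge0|].
    rewrite -(ge0_integral_pdensity Pla mq q0).
    by rewrite -(pdensity_integral P'P measurableT) ltey_eq fin_num_measure.
  have : ae_eq la setT (EFin \o (fun z => q z * p0 z)) (EFin \o p1).
    apply: integral_ae_eq => //; first exact: measurable_int Ip1.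
    move=> A _ mA.
    rewrite -(pdensity_integral P'la mA) (pdensity_integral P'P mA).
    have mA1 : measurable_fun setT (\1_A : T -> R) by exact: measurable_indic.
    have A0 x : 0 <= \1_A x :> R by rewrite indicE; case: (_ \in _).
    transitivity (\int[P]_z (\1_A z * q z)%:E)%E; last first.
      rewrite [RHS]integral_mkcond; apply: eq_integral => z _.
      by rewrite patchE indicE; case: ifPn => _; rewrite ?mul1r ?mul0r.
    rewrite (ge0_integral_pdensity Pla); [|exact: measurable_funM|]; last first.
      by move=> x; exact: mulr_ge0.
    rewrite integral_mkcond; apply: eq_integral => z _.
    by rewrite patchE indicE; case: ifPn => _; rewrite ?mul1r ?mul0r.
  by apply: filterS => x /(_ I)[].
pose g z := Num.sqrt (q z).
have mg : measurable_fun setT g by exact: measurableT_comp.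
exists g; split => //.
  move=> A mA; rewrite (pdensity_integral P'P mA); apply: eq_integral => z _.
  by rewrite sqr_sqrtr.
have mh : measurable_fun setT (fun z => (g z - (1 + 2^-1 * (e * s z))) ^+ 2).
  apply: measurable_funX; apply: measurable_funB => //.
  by apply: measurable_funD => //; do 2 apply: measurable_funM => //.
rewrite (ge0_integral_pdensity Pla mh); last by move=> z; exact: sqr_ge0.
rewrite le_eqVlt; apply/orP; left; apply/eqP; rewrite /qmd_remainder -/la.
have md0 : measurable_fun setT (density P la) by exact: measurable_density.
have md1 : measurable_fun setT (density P' la) by exact: measurable_density.
apply: ae_eq_integral => //.
- by apply/measurable_EFinP; exact: measurable_funM.
- apply/measurable_EFinP; apply: measurable_funX; apply: measurable_funB.
    by apply: measurable_funB; exact: measurableT_comp.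
  by apply: measurable_funM; [exact: measurable_funM|exact: measurableT_comp].
apply: filterS (ae_and p1E (ae_and (pdensityE Pla) (pdensityE P'la))).
move=> z [pE [-> ->]] _ /=; congr EFin; rewrite -/(p1 z) -/(p0 z) -pE sqrtrM// -/(g z).
by rewrite -[in LHS](sqr_sqrtr (p00 z)); field.
Qed.

End qmd.

(** * Little-o along paths and uniform integrability *)

Section asymptotics.
Context (R : realType).

(** Convergence to 0 makes a nonnegative remainder finite near 0, so a single inequality in the
    extended reals carries both finiteness and smallness. *)
Lemma littleo_at0_ge0P (r : R -> \bar R) (k : nat) : (forall e, (0 <= r e)%E) ->
  littleo_at0 r k <->
  forall eps : R, 0 < eps -> \forall e \near (0:R)^'+, (r e <= (eps * e ^+ k)%:E)%E.
Proof.
move=> r0; rewrite /littleo_at0; split=> [h eps eps0|h].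
  have /fine_cvgP[fin /cvgrPdist_le/(_ _ eps0) fle] := h.
  near=> e; have e0 : 0 < e by near: e; exact: nbhs_right_gt.
  have ek0 : 0 < e ^+ k by rewrite exprn_gt0.
  have f1 : (r e * (e ^- k)%:E)%E \is a fin_num by near: e.
  have f2 : `|0 - fine (r e * (e ^- k)%:E)%E| <= eps by near: e.
  have re : r e \is a fin_num.
    have := f1; have := r0 e; case: (r e) => //= _; rewrite gt0_mulye//.
    by rewrite lte_fin invr_gt0.
  move: f2; rewrite sub0r normrN -(fineK re) -EFinM /=.
  rewrite ger0_norm; last by rewrite mulr_ge0 ?fine_ge0// invr_ge0 ltW.
  by rewrite lee_fin ler_pdivrMr.
have key eps : 0 < eps -> \forall e \near (0:R)^'+,
    (0 <= r e * (e ^- k)%:E)%E /\ (r e * (e ^- k)%:E <= eps%:E)%E.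
  move=> eps0; near=> e; have e0 : 0 < e by near: e; exact: nbhs_right_gt.
  have ek0 : 0 < e ^+ k by rewrite exprn_gt0.
  have re : (r e <= (eps * e ^+ k)%:E)%E by near: e; exact: h.
  split; first by rewrite mule_ge0// lee_fin invr_ge0 ltW.
  apply: le_trans (_ : ((eps * e ^+ k)%:E * (e ^- k)%:E <= _)%E).
    by rewrite lee_wpmul2r// lee_fin invr_ge0 ltW.
  by rewrite -EFinM lee_fin mulfK// gt_eqF.
apply/fine_cvgP; split.
  apply: filterS (key 1 ltr01) => e [h0 h1].
  by rewrite ge0_fin_numE// (le_lt_trans h1)// ltry.
apply/cvgrPdist_le => eps eps0; apply: filterS (key eps eps0) => e [h0 h1].
rewrite sub0r normrN /=.
have fn : (r e * (e ^- k)%:E)%E \is a fin_num.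
  by rewrite ge0_fin_numE// (le_lt_trans h1)// ltry.
by rewrite ger0_norm ?fine_ge0// -lee_fin fineK.
Unshelve. all: by end_near. Qed.

Context d (T : measurableType d) (mu : {measure set T -> \bar R}).

Lemma L2norm_le (f : T -> R) (c : R) : 0 <= c ->
  (L2norm mu f <= c%:E)%E = (\int[mu]_x (f x ^+ 2)%:E <= (c ^+ 2)%:E)%E.
Proof. by move=> c0; rewrite -L2norm_sqr -lee_sqr ?L2norm_ge0 ?lee_fin. Qed.

Lemma littleo_L2normP (f : R -> T -> R) :
  littleo_at0 (fun e => L2norm mu (f e)) 1 <->
  littleo_at0 (fun e => \int[mu]_x (f e x ^+ 2)%:E)%E 2.
Proof.
rewrite littleo_at0_ge0P; last by move=> e; exact: L2norm_ge0.
rewrite littleo_at0_ge0P; last by move=> e; apply: integral_ge0 => x _; rewrite lee_fin sqr_ge0.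
split=> h eps eps0.
  have := h (Num.sqrt eps); rewrite sqrtr_gt0 => /(_ eps0) {}h.
  near=> e; have e0 : 0 < e by near: e; exact: nbhs_right_gt.
  have : (L2norm mu (f e) <= (Num.sqrt eps * e ^+ 1)%:E)%E by near: e.
  rewrite L2norm_le; last by rewrite mulr_ge0 ?sqrtr_ge0// exprn_ge0// ltW.
  by rewrite expr1 exprMn sqr_sqrtr; last exact: ltW.
have {}h := h (eps ^+ 2) (exprn_gt0 2 eps0).
near=> e; have e0 : 0 < e by near: e; exact: nbhs_right_gt.
rewrite L2norm_le; last by rewrite mulr_ge0 ?exprn_ge0// ltW.
by rewrite exprMn expr1; near: e.
Unshelve. all: by end_near. Qed.

(** Dominated convergence: at each point the tail vanishes once [n] reaches [F x]. It serves both
    for uniform integrability and for the density of bounded functions. *)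
Lemma tail_integral (F : T -> R) : (forall x, 0 <= F x) -> intg mu F ->
  forall eps : R, 0 < eps -> exists n : nat,
  (\int[mu]_x (\1_[set x | n%:R < F x] x * F x)%:E <= eps%:E)%E.
Proof.
move=> F0 IF eps eps0; have mF := intg_measurable IF.
pose G n x := (\1_[set x | n%:R < F x] x * F x)%:E.
have mG n : measurable_fun setT (G n).
  apply/measurable_EFinP; apply: measurable_funM => //.
  apply: measurable_indic.
  rewrite [X in measurable X](_ : _ = setT `&` F @^-1` `]n%:R, +oo[%classic); first exact: mF.
  by rewrite setTI; apply/seteqP; split => x /=; rewrite in_itv /= andbT.
have G0 x : G ^~ x @ \oo --> 0%E.
  apply: cvg_near_cst; apply: filterS (nbhs_infty_gtr (F x)) => n Fn.
  rewrite /G indicE memNset ?mul0r//.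
  by rewrite /= => h; move: Fn; rewrite ltNge (ltW h).
have [||||_ _] := @dominated_convergence _ T R mu setT measurableT G (cst 0%E)
  (EFin \o F) mG; rewrite ?integral0//.
- by apply: nearW => x _; exact: G0.
- apply: nearW => x n _; rewrite /G /= lee_fin normrM (ger0_norm (F0 _)).
  by rewrite indicE; case: (_ \in _); rewrite ?normr1 ?mul1r// normr0 mul0r.
move=> /fine_cvgP[fin /cvgrPdist_le/(_ _ eps0) fle].
have [n [h1 h2]] : exists n, (\int[mu]_x G n x)%E \is a fin_num /\
    `|0 - fine (\int[mu]_x G n x)%E| <= eps.
  apply: (@filter_ex _ \oo); exact: filterI fin fle.
exists n; rewrite -[leLHS](fineK h1) lee_fin.
by move: h2; rewrite sub0r normrN; apply: le_trans; exact: ler_norm.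
Unshelve. all: by end_near. Qed.

(** Where [F] exceeds [n] the minimum is bounded by 1 and the tail of [F] is small; elsewhere the
    product is at most [n * q]. The threshold [del] depends on [F] and [eps] but not on [q]. *)
Lemma uniformly_integrable_min (F : T -> R) : (forall x, 0 <= F x) -> intg mu F ->
  forall eps : R, 0 < eps -> exists2 del : R, 0 < del &
  forall q : T -> R, measurable_fun setT q -> (forall x, 0 <= q x) ->
    (\int[mu]_x (q x)%:E <= del%:E)%E ->
    (\int[mu]_x (F x * Num.min (q x) 1)%:E <= eps%:E)%E.
Proof.
move=> F0 IF eps eps0; have mF := intg_measurable IF.
have e2 : 0 < eps / 2 by rewrite divr_gt0.
have [n hn] := tail_integral F0 IF e2.
(* [n] may be 0, hence the successor. *)
exists (eps / 2 / n.+1%:R); first by rewrite divr_gt0.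
move=> q mq q0 he.
have m1 : measurable_fun setT (fun x => \1_[set x | n%:R < F x] x * F x).
  apply: measurable_funM => //; apply: measurable_indic.
  rewrite [X in measurable X](_ : _ = setT `&` F @^-1` `]n%:R, +oo[%classic); first exact: mF.
  by rewrite setTI; apply/seteqP; split => x /=; rewrite in_itv /= andbT.
have i0 x : 0 <= \1_[set x | n%:R < F x] x * F x :> R.
  by rewrite mulr_ge0// indicE; case: (_ \in _).
apply: (@le_trans _ _ (\int[mu]_x (\1_[set x | n%:R < F x] x * F x)%:E +
    \int[mu]_x (n.+1%:R * q x)%:E)%E).
  rewrite -ge0_integralD//; last 4 first.
  - by move=> x _; rewrite lee_fin.
  - exact/measurable_EFinP.
  - by move=> x _; rewrite lee_fin mulr_ge0.
  - by apply/measurable_EFinP; apply: measurable_funM.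
  apply: ge0_le_integral => //.
  - by move=> x _; rewrite lee_fin mulr_ge0// le_min q0 ler01.
  - apply/measurable_EFinP; apply: measurable_funM => //.
    exact: measurable_minr.
  - apply/measurable_EFinP; apply: measurable_funD => //.
    exact: measurable_funM.
  - move=> x _; rewrite -EFinD lee_fin indicE.
    case: (boolP (_ \in _)); rewrite ?inE ?notin_setE /= => h.
      rewrite mul1r -[leLHS]addr0 lerD ?mulr_ge0//.
      by rewrite ler_piMr// ge_min lexx orbT.
    rewrite mul0r add0r ler_pM ?le_min ?q0 ?ler01 ?ge_min ?lexx//.
    by rewrite (@le_trans _ _ n%:R)// ?ler_nat// leNgt; apply/negP.
rewrite [eps in leRHS]splitr EFinD leeD//.
under eq_integral do rewrite EFinM.
rewrite ge0_integralZl//; last 2 first.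
- exact/measurable_EFinP.
- by move=> x _; rewrite lee_fin.
have -> : eps / 2 = n.+1%:R * (eps / 2 / n.+1%:R) by rewrite [RHS]mulrC divfK.
by rewrite [leRHS]EFinM lee_wpmul2l.
Qed.

End asymptotics.

(** * Bounded versions and the integrated remainder *)

Lemma ge0_integral_lin d (T : measurableType d) (R : realType)
    (mu : {measure set T -> \bar R}) (a b : R) (f g : T -> R) :
  measurable_fun setT f -> measurable_fun setT g ->
  (forall x, 0 <= f x) -> (forall x, 0 <= g x) -> 0 <= a -> 0 <= b ->
  (\int[mu]_x (a * f x + b * g x)%:E =
   a%:E * \int[mu]_x (f x)%:E + b%:E * \int[mu]_x (g x)%:E)%E.
Proof.
move=> mf mg f0 g0 a0 b0.
under eq_integral do rewrite EFinD !EFinM.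
rewrite ge0_integralD//; last 4 first.
- by move=> x _; rewrite lee_fin mulr_ge0.
- by apply/measurable_EFinP; exact: measurable_funM.
- by move=> x _; rewrite lee_fin mulr_ge0.
- by apply/measurable_EFinP; exact: measurable_funM.
rewrite !ge0_integralZl ?lee_fin//.
- exact/measurable_EFinP.
- by move=> x _; rewrite lee_fin.
- exact/measurable_EFinP.
- by move=> x _; rewrite lee_fin.
Qed.

Section versions.
Context d d' (Z : measurableType d) (X : measurableType d') (R : realType).
Implicit Types (P : probability Z R) (C : {mfun Z >-> X}).

Lemma distribution_dominates P P' C : P `<< P' ->
  distribution P C `<< distribution P' C.
Proof.
move=> /null_content_dominatesP PP'; apply/null_content_dominatesP => B mB PB0.
by apply: PP' => //; exact: measurable_preimage.
Qed.

Lemma ae_dominates dd (T : measurableType dd) (P P' : {measure set T -> \bar R})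
  (p : T -> Prop) : P `<< P' -> {ae P', forall z, p z} -> {ae P, forall z, p z}.
Proof.
by move=> /null_content_dominatesP PP' [A [mA A0 pA]]; exists A; split => //; exact: PP'.
Qed.

Lemma ae_comp P C (p : X -> Prop) : {ae distribution P C, forall x, p x} ->
  {ae P, forall z, p (C z)}.
Proof.
move=> [A [mA A0 pA]]; exists (C @^-1` A); split => //.
  exact: measurable_preimage.
by move=> z pz; apply: pA.
Qed.

Lemma ge0_integral_law P C (F : X -> R) : measurable_fun setT F ->
  (forall x, 0 <= F x) ->
  (\int[distribution P C]_x (F x)%:E = \int[P]_z (F (C z))%:E)%E.
Proof.
by move=> mF F0; rewrite ge0_integral_distribution//; exact/measurable_EFinP.
Qed.

Lemma ice_total P C f g : is_cond_exp P C f g ->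
  (\int[distribution P C]_x (g x)%:E = \int[P]_z (f z)%:E)%E.
Proof. by case=> _ /(_ setT measurableT) <-; rewrite preimage_setT. Qed.

(** [cond_var] nests two arbitrary choices of versions, and members of the ball are bounded only
    almost everywhere. Clipping [u], then its conditional mean, then the conditional variance,
    yields representatives bounded at every point. *)
Lemma cond_var_version P C (m : R) (u : Z -> R) : 0 <= m ->
  measurable_fun setT u -> {ae P, forall z, `|u z| <= m} ->
  exists (u' : Z -> R) (mu th : X -> R), [/\ [/\ measurable_fun setT u', forall z, `|u' z| <= m &
      {ae P, forall z, u z = u' z}],
    [/\ measurable_fun setT mu, forall x, `|mu x| <= m,
      is_cond_exp P C u' mu & {ae distribution P C, forall x, cond_exp P C u x = mu x}] &
    [/\ measurable_fun setT th, forall x, 0 <= th x <= (2 * m) ^+ 2,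
      is_cond_exp P C (fun z => (u' z - mu (C z)) ^+ 2) th,
      measurable_fun setT (cond_var P C u) &
      {ae distribution P C, forall x, cond_var P C u x = th x}]].
Proof.
move=> m0 mfu um.
pose u' z := Num.max (- m) (Num.min m (u z)).
have mfu' : measurable_fun setT u'.
  by apply: measurable_maxr => //; exact: measurable_minr.
have mm : - m <= m by lra.
have u'm z : - m <= u' z <= m.
  by rewrite /u' le_max lexx ge_max mm ge_min lexx.
have u'b z : `|u' z| <= m by rewrite ler_norml.
have uu' : {ae P, forall z, u z = u' z}.
  apply: filterS um => z; rewrite ler_norml => /andP[h1 h2].
  by rewrite /u' (min_idPr h2) (max_idPr h1).
have [mu [imu mmu muM]] := ice_clip P C mm mfu' u'm.
have mub x : `|mu x| <= m by rewrite ler_norml.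
have Iu' : intg P u' by exact: (intg_bounded P mfu' u'b).
have u'u : {ae P, forall z, u' z = u z} by apply: filterS uu' => z ->.
have Iu : intg P u by exact: intg_ae_eq mfu u'u Iu'.
have icu := cond_expP C Iu.
have cumu : {ae distribution P C, forall x, cond_exp P C u x = mu x}.
  by apply: ice_unique icu _; exact: ice_ae_eql imu.
have mmuC : measurable_fun setT (fun z => mu (C z)) by exact: measurable_compC.
have mf : measurable_fun setT (fun z => (u' z - mu (C z)) ^+ 2).
  by apply: measurable_funX; exact: measurable_funB.
have fb z : 0 <= (u' z - mu (C z)) ^+ 2 <= (2 * m) ^+ 2.
  rewrite sqr_ge0; apply: ler_sqr_norm; rewrite (le_trans (ler_normB _ _))//.
  by have := u'b z; have := mub (C z); lra.
have [th [ith mth thb]] := ice_clip P C (sqr_ge0 (2 * m)) mf fb.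
have mcu : measurable_fun setT (cond_exp P C u) by exact: ice_measurable icu.
have mf1 : measurable_fun setT (fun z => (u z - cond_exp P C u (C z)) ^+ 2).
  apply: measurable_funX; apply: measurable_funB => //.
  exact: measurable_compC.
have ff1 : {ae P, forall z, (u' z - mu (C z)) ^+ 2 = (u z - cond_exp P C u (C z)) ^+ 2}.
  by apply: filterS (ae_and uu' (ae_comp cumu)) => z [-> ->].
have If1 : intg P (fun z => (u z - cond_exp P C u (C z)) ^+ 2).
  apply: intg_ae_eq mf1 ff1 _; apply: (intg_bounded P (K := (2 * m) ^+ 2) mf) => z.
  by have /andP[h0 h1] := fb z; rewrite ger0_norm.
have icv := cond_expP C If1.
exists u', mu, th; split; split => //; first exact: ice_measurable icv.
by apply: ice_unique icv _; exact: ice_ae_eql ith.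
Qed.

End versions.

Section remainder.
Context d d' (Z : measurableType d) (X : measurableType d') (R : realType).
Variables (P : probability Z R) (C : {mfun Z >-> X}) (m : R).
Variables (u s t : Z -> R) (mu th D S T : X -> R).
Notation PX := (distribution P C).
Notation ice := (is_cond_exp P C).
Hypotheses (m0 : 0 <= m) (mfu : measurable_fun setT u) (um : forall z, `|u z| <= m).
Hypotheses (mmu : measurable_fun setT mu) (mum : forall x, `|mu x| <= m).
Hypotheses (mth : measurable_fun setT th) (thm : forall x, 0 <= th x <= (2 * m) ^+ 2).
Hypotheses (imu : ice u mu) (ith : ice (fun z => (u z - mu (C z)) ^+ 2) th).
Hypotheses (s2 : L2 P s) (t2 : L2 P t).
Hypothesis iD : ice (fun z => s z * ((u z - mu (C z)) ^+ 2 - th (C z)) +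
  2 * (t z * (u z - mu (C z)))) D.
Hypotheses (iS : ice (fun z => s z ^+ 2) S) (S0 : forall x, 0 <= S x).
Hypotheses (iT : ice (fun z => t z ^+ 2) T) (T0 : forall x, 0 <= T x).

Let M : R := 2 * m + 8.

Let iceZ (a : R) f g : intg P f -> ice f g -> ice (fun z => a * f z) (fun x => a * g x).
Proof.
move=> If i; have := ice_lin2 a 0 If If i i.
by congr ice; apply/funext => x; rewrite mul0r addr0.
Qed.

(** The function [q] is [A + B]. The two bounds are shaped for [uniformly_integrable_min]: the first
    makes [q] small in [L^1], and the second contains [q] only through its minimum with 1,
    multiplied by the fixed function [S + T]. *)
Lemma cond_var_remainder (P' : probability Z R) (v : Z -> R) (e : R) :
  P `<< P' -> P' `<< P -> measurable_fun setT v -> {ae P, forall z, `|v z| <= m} ->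
  exists q : X -> R, [/\ measurable_fun setT q, forall x, 0 <= q x,
   (\int[PX]_x (q x)%:E <= 2%:E * (qmd_remainder P P' s e +
      \int[P]_z ((v z - u z - e * t z) ^+ 2)%:E) +
      (2 * e ^+ 2)%:E * \int[P]_z (s z ^+ 2 + t z ^+ 2)%:E)%E &
   (\int[PX]_x ((cond_var P' C v x - th x - e * D x) ^+ 2)%:E <=
     (200 * M ^+ 10)%:E * (qmd_remainder P P' s e +
      \int[P]_z ((v z - u z - e * t z) ^+ 2)%:E +
      (e ^+ 2)%:E * \int[PX]_x ((S x + T x) * Num.min (q x) 1)%:E))%E].
Proof.
move=> PP' P'P mv vm.
have [|g [mg P'E gq]] := qmd_density e PP' P'P _ (s := s).
  exact: L2_measurable s2.
(* Versions are chosen under [P'], the law whose conditional variance is expanded; mutual absolute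
   continuity brings the exceptional sets back to [P]. *)
have vm' : {ae P', forall z, `|v z| <= m} by exact: ae_dominates vm.
have [v' [h [th' [[mv' v'm vv'] [mh hm ih _] [mth' th'm ith' mcv cvth]]]]] :=
  cond_var_version C m0 mv vm'.
have g2 : L2 P g.
  by apply/L2P; split => //; exact: intg_sqr_density P'E.
pose s' z := e * s z. pose t' z := e * t z.
have s'2 : L2 P s' by exact: L2Z.
have t'2 : L2 P t' by exact: L2Z.
pose r z := g z - (1 + 2^-1 * s' z).
have one2 : L2 P (fun=> 1 : R).
  by apply: (L2_bounded P (K := 1)) => // z; rewrite normr1.
have r2 : L2 P r by apply: L2B => //; apply: L2D => //; exact: L2Z.
pose k z := v' z - u z - t' z.
have v'2 : L2 P v' by exact: (L2_bounded P mv' v'm).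
have u2 : L2 P u by exact: (L2_bounded P mfu um).
have k2 : L2 P k by apply: L2B => //; exact: L2B.
have a2 : L2 P (fun z => g z - 1) by exact: L2B.
have d2 : L2 P (fun z => v' z - u z) by exact: L2B.
have ver f : L2 P f -> exists2 F : X -> R, ice (fun z => f z ^+ 2) F & forall x, 0 <= F x.
  move=> f2; have If := L2_sqr f2.
  by apply: ice_ge0_version => // [|z]; [exact: intg_measurable If|exact: sqr_ge0].
have [A iA A0] := ver _ a2. have [B iB B0] := ver _ d2.
have [Rr iR R0] := ver _ r2. have [K iK K0] := ver _ k2.
have [G0 iG _] := ver _ g2.
have mA := ice_measurable iA. have mB := ice_measurable iB.
have mR := ice_measurable iR. have mK := ice_measurable iK.
have mS := ice_measurable iS. have mT := ice_measurable iT.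
have mD := ice_measurable iD.
have M8 : 8 <= M by rewrite /M; have h0 := m0; lra.
have ubM (x y : R) : `|x| <= m -> `|y| <= m -> `|x - y| <= M.
  by move=> h1 h2; rewrite (le_trans (ler_normB _ _))// /M; have h0 := m0; lra.
have bM (x : R) : `|x| <= m -> `|x| <= M by move=> h1; rewrite /M; have h0 := m0; lra.
have thM2 (x : R) : 0 <= x <= (2 * m) ^+ 2 -> 0 <= x <= M ^+ 2.
  move=> /andP[-> h1]; rewrite (le_trans h1)// lerXn2r ?nnegrE/M//; have h0 := m0; lra.
have ih' : ice (fun z => g z ^+ 2 * v' z) (fun x => G0 x * h x).
  exact: (ice_bayes mg P'E mv' v'm hm ih iG).
have ith'' : ice (fun z => g z ^+ 2 * (v' z - h (C z)) ^+ 2) (fun x => G0 x * th' x).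
  apply: (ice_bayes mg P'E _ (K := M ^+ 2) _ _ ith' iG).
  - apply: measurable_funX; apply: measurable_funB => //; exact: measurable_compC.
  - by move=> z; rewrite ger0_norm ?sqr_ge0// ler_sqr_norm// ubM.
  - by move=> x; have /andP[h1 h2] := thM2 _ (th'm x); rewrite ger0_norm.
have IS2 := L2_sqr s2. have IT2 := L2_sqr t2.
have iS' : ice (fun z => s' z ^+ 2) (fun x => e ^+ 2 * S x).
  have := iceZ (e ^+ 2) IS2 iS; congr ice.
  by apply/funext => z; rewrite /s' exprMn.
have iT' : ice (fun z => t' z ^+ 2) (fun x => e ^+ 2 * T x).
  have := iceZ (e ^+ 2) IT2 iT; congr ice.
  by apply/funext => z; rewrite /t' exprMn.
have iD' : ice (fun z => s' z * ((u z - mu (C z)) ^+ 2 - th (C z)) +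
    2 * (t' z * (u z - mu (C z)))) (fun x => e * D x).
  have mf0 : measurable_fun setT (fun z => u z - mu (C z)).
    by apply: measurable_funB => //; exact: measurable_compC.
  have ID : intg P (fun z => s z * ((u z - mu (C z)) ^+ 2 - th (C z)) +
      2 * (t z * (u z - mu (C z)))).
    have Is : intg P s by exact: L2_intg.
    have It : intg P t by exact: L2_intg.
    apply: intgD; last apply: intgZ.
      under eq_fun do rewrite mulrC.
      apply: (@intg_bM _ _ _ _ (M ^+ 2 + M ^+ 2)) => //.
        by apply: measurable_funB; [exact: measurable_funX|exact: measurable_compC].
      move=> z; rewrite (le_trans (ler_normB _ _))// lerD//.
        by rewrite ger0_norm ?sqr_ge0// ler_sqr_norm// ubM.
      by have /andP[h1 h2] := thM2 _ (thm (C z)); rewrite ger0_norm.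
    under eq_fun do rewrite mulrC.
    by apply: (@intg_bM _ _ _ _ M) => // z; exact: ubM.
  have := iceZ e ID iD; congr ice.
  by apply/funext => z; rewrite /s' /t'; ring.
have gE z : g z = 1 + 2^-1 * s' z + r z by rewrite /r; ring.
have vE z : v' z = u z + t' z + k z by rewrite /k; ring.
have main := cond_var_expansion M8 g2 s'2 r2 t'2 k2 mfu mv' mmu mh mth gE vE
  (fun z => ubM _ _ (um z) (mum _)) (fun z => ubM _ _ (v'm z) (mum _))
  (fun z => ubM _ _ (v'm z) (um z)) (fun x => ubM _ _ (hm x) (mum x))
  (fun z => bM _ (um z)) (fun z => bM _ (v'm z)) (fun x => bM _ (mum x))
  (fun x => thM2 _ (thm x)) (fun x => thM2 _ (th'm x)) imu ith iD' iG ih' ith''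
  iA iB iR iK iS' iT'.
have PX' : PX `<< distribution P' C by exact: distribution_dominates.
have cvth' := ae_dominates PX' cvth.
have vv'P := ae_dominates PP' vv'.
have kE : (\int[P]_z ((v z - u z - e * t z) ^+ 2)%:E = \int[P]_z (k z ^+ 2)%:E)%E.
  apply: ae_eq_integral => //.
  - apply/measurable_EFinP; apply: measurable_funX; apply: measurable_funB.
      exact: measurable_funB.
    by apply: measurable_funM => //; exact: L2_measurable t2.
  - by apply/measurable_EFinP; apply: intg_measurable; exact: L2_sqr k2.
  - by apply: filterS vv'P => z /= -> _.
have rE : (\int[P]_z (r z ^+ 2)%:E <= qmd_remainder P P' s e)%E by exact: gq.
exists (fun x => A x + B x); split.
- exact: measurable_funD.
- by move=> x; rewrite addr_ge0.
- have ab2 z : (g z - 1) ^+ 2 + (v' z - u z) ^+ 2 <=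
      2 * (r z ^+ 2 + k z ^+ 2) + 2 * e ^+ 2 * (s z ^+ 2 + t z ^+ 2).
    have h1 : (g z - 1) ^+ 2 <= 2 * r z ^+ 2 + 2 * (e * s z) ^+ 2.
      rewrite gE /s'; have := sqr_ge0 (r z - 2^-1 * (e * s z)).
      by have := sqr_ge0 (e * s z); lra.
    have h2 : (v' z - u z) ^+ 2 <= 2 * k z ^+ 2 + 2 * (e * t z) ^+ 2.
      by rewrite vE /t'; have := sqr_ge0 (k z - e * t z); lra.
    by move: h1 h2; rewrite !exprMn; lra.
  have IAB := intgD (L2_sqr a2) (L2_sqr d2).
  have Irk := intgD (L2_sqr r2) (L2_sqr k2).
  have Ist := intgD IS2 IT2.
  have nn (f1 f2 : Z -> R) z : 0 <= f1 z ^+ 2 + f2 z ^+ 2.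
    by rewrite addr_ge0 ?sqr_ge0.
  have iAB : ice (fun z => (g z - 1) ^+ 2 + (v' z - u z) ^+ 2) (fun x => A x + B x).
    have := ice_lin2 1 1 (L2_sqr a2) (L2_sqr d2) iA iB; congr ice.
      by apply/funext => z; rewrite !mul1r.
    by apply/funext => z; rewrite !mul1r.
  rewrite (ice_total iAB).
  apply: (@le_trans _ _ (\int[P]_z (2 * (r z ^+ 2 + k z ^+ 2) +
      2 * e ^+ 2 * (s z ^+ 2 + t z ^+ 2))%:E)%E).
    apply: ge0_le_integral => //.
    - by move=> z _; rewrite lee_fin addr_ge0 ?sqr_ge0.
    - by apply/measurable_EFinP; exact: intg_measurable IAB.
    - apply/measurable_EFinP; apply: intg_measurable.
      exact: intgD (intgZ 2 Irk) (intgZ (2 * e ^+ 2) Ist).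
    - by move=> z _; rewrite lee_fin.
  have e20 : 0 <= 2 * e ^+ 2 by rewrite pmulr_rge0 ?sqr_ge0.
  rewrite (ge0_integral_lin P (intg_measurable Irk) (intg_measurable Ist)
    (nn _ _) (nn _ _) (ler0n _ 2) e20).
  rewrite leeD2r// lee_wpmul2l//.
  under eq_integral do rewrite EFinD.
  rewrite ge0_integralD//; last 4 first.
  - by move=> z _; rewrite lee_fin sqr_ge0.
  - by apply/measurable_EFinP; apply: intg_measurable; exact: L2_sqr r2.
  - by move=> z _; rewrite lee_fin sqr_ge0.
  - by apply/measurable_EFinP; apply: intg_measurable; exact: L2_sqr k2.
  by rewrite leeD// kE.
- have c0 : 0 <= 200 * M ^+ 10 by rewrite mulr_ge0// exprn_ge0// (le_trans _ M8).
  pose q x := Num.min (A x + B x) 1.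
  have q0 x : 0 <= q x by rewrite /q le_min ler01 addr_ge0.
  have mq : measurable_fun setT q.
    by apply: measurable_minr => //; exact: measurable_funD.
  have mST : measurable_fun setT (fun x => (S x + T x) * q x).
    by apply: measurable_funM => //; exact: measurable_funD.
  have ST0 x : 0 <= (S x + T x) * q x by rewrite mulr_ge0// addr_ge0.
  have mRK : measurable_fun setT (fun x => Rr x + K x) by exact: measurable_funD.
  have RK0 x : 0 <= Rr x + K x by rewrite addr_ge0.
  have nnW x : 0 <= 1 * (Rr x + K x) + e ^+ 2 * ((S x + T x) * q x).
    by rewrite mul1r; apply: addr_ge0 => //; apply: mulr_ge0 => //; exact: sqr_ge0.
  apply: (@le_trans _ _ (\int[PX]_x ((200 * M ^+ 10) *
      (1 * (Rr x + K x) + e ^+ 2 * ((S x + T x) * q x)))%:E)%E).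
    apply: ae_ge0_le_integral => //.
    - by move=> x _; rewrite lee_fin sqr_ge0.
    - apply/measurable_EFinP; apply: measurable_funX; apply: measurable_funB.
        exact: measurable_funB.
      exact: measurable_funM.
    - by move=> x _; rewrite lee_fin mulr_ge0// nnW.
    - apply/measurable_EFinP; apply: measurable_funM => //.
      by apply: measurable_funD; apply: measurable_funM.
    - apply: filterS (ae_and main cvth') => x [h1 h2] _; rewrite lee_fin h2.
      have -> : e ^+ 2 * ((S x + T x) * q x) =
          (e ^+ 2 * S x + e ^+ 2 * T x) * q x by ring.
      by rewrite mul1r.
  under eq_integral do rewrite EFinM.
  rewrite ge0_integralZl ?lee_fin//; last 2 first.
  - apply/measurable_EFinP.
    by apply: measurable_funD; apply: measurable_funM.
  - by move=> x _; rewrite lee_fin nnW.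
  rewrite lee_wpmul2l ?lee_fin//.
  rewrite ge0_integral_lin ?sqr_ge0// leeD2r// mul1e.
  under eq_integral do rewrite EFinD.
  rewrite ge0_integralD//; last 4 first.
  - by move=> x _; rewrite lee_fin.
  - exact/measurable_EFinP.
  - by move=> x _; rewrite lee_fin.
  - exact/measurable_EFinP.
  by rewrite (ice_total iR) (ice_total iK) leeD// kE.
Qed.


End remainder.

(** * Uniqueness of total derivatives *)

Section uniqueness.
Context d1 d2 d3 (Z : measurableType d1) (T : measurableType d2)
  (Y : measurableType d3) (R : realType).

Lemma linear_span_L2 d (V : measurableType d) (mu : {measure set V -> \bar R})
    (S : set (V -> R)) : S `<=` L2 mu -> linear_span S `<=` L2 mu.
Proof.
move=> SL f [n [c [g [Sg ->]]]]; elim: n c g Sg => [|n IHn] c g Sg.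
  by under eq_fun do rewrite big_ord0; exact: L2_0.
under eq_fun do rewrite big_ord_recr/=.
apply: L2D; last exact/L2Z/SL.
by apply: (IHn (fun i => c (widen_ord (leqnSn n) i))
  (fun i => g (widen_ord (leqnSn n) i))).
Qed.

Lemma L2closure_sub d (V : measurableType d) (mu : {measure set V -> \bar R})
    (S : set (V -> R)) : S `<=` L2 mu -> S `<=` L2closure mu S.
Proof.
move=> SL f Sf; split; first exact: SL.
move=> e e0; exists f => //; rewrite L2norm_lt//.
under eq_integral do rewrite /= subrr expr0n.
by rewrite integral0 lte_fin exprn_gt0.
Qed.

Lemma sub_linear_span d (V : measurableType d) (S : set (V -> R)) : S `<=` linear_span S.
Proof.
move=> f Sf; exists 1%N, (fun=> 1), (fun=> f); split => //.
by apply/funext => z; rewrite big_ord1 mul1r.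
Qed.

Lemma integral_sqr_eq0 d (V : measurableType d) (mu : {measure set V -> \bar R})
    (f : V -> R) : measurable_fun setT f ->
  (forall eps : R, 0 < eps -> (\int[mu]_x (f x ^+ 2)%:E <= eps%:E)%E) ->
  {ae mu, forall x, f x = 0}.
Proof.
move=> mf feps.
have m2 : measurable_fun setT (EFin \o (fun x => f x ^+ 2)).
  by apply/measurable_EFinP; exact: measurable_funX.
have : (\int[mu]_x `|(EFin \o (fun x => f x ^+ 2)%R) x| = 0)%E.
  apply/eqP; rewrite eq_le integral_ge0 ?andbT//.
  apply/lee_addgt0Pr => eps eps0; rewrite add0e.
  under eq_integral => x _ do rewrite /= ger0_norm ?sqr_ge0//.
  exact: feps.
move/(ae_eq_integral_abs _ measurableT m2); apply: filterS => x /(_ I) [].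
by move=> /eqP; rewrite sqrf_eq0 => /eqP.
Qed.

Lemma integral_sqrD_le d (V : measurableType d) (mu : {measure set V -> \bar R})
    (f g h : V -> R) : measurable_fun setT f -> measurable_fun setT g ->
  measurable_fun setT h -> {ae mu, forall x, h x = f x + g x} ->
  (\int[mu]_x (h x ^+ 2)%:E <=
    2%:E * \int[mu]_x (f x ^+ 2)%:E + 2%:E * \int[mu]_x (g x ^+ 2)%:E)%E.
Proof.
move=> mf mg mh hE; rewrite -ge0_integral_lin//; last 4 first.
- exact: measurable_funX.
- exact: measurable_funX.
- by move=> x; exact: sqr_ge0.
- by move=> x; exact: sqr_ge0.
apply: ae_ge0_le_integral => //.
- by move=> x _; rewrite lee_fin sqr_ge0.
- by apply/measurable_EFinP; exact: measurable_funX.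
- by move=> x _; rewrite lee_fin addr_ge0// mulr_ge0// sqr_ge0.
- apply/measurable_EFinP; apply: measurable_funD; apply: measurable_funM => //;
    exact: measurable_funX.
- apply: filterS hE => x -> _; rewrite lee_fin.
  by have := sqr_ge0 (f x - g x); lra.
Qed.

Variables (M : set (probability Z R)) (mu : {measure set T -> \bar R})
  (U : set (T -> R)) (nu : {measure set Y -> \bar R})
  (theta : probability Z R -> (T -> R) -> Y -> R)
  (P : probability Z R) (u : T -> R).
Hypotheses (MP : M P) (Uu : U u).

Lemma tangent_set_sub_space : model_tangent_set M P `<=` model_tangent_space M P.
Proof.
move=> s ts; apply: L2closure_sub; last exact: sub_linear_span.
by apply: linear_span_L2 => ? [].
Qed.

(** The constant path has score zero. With its analogue for [U] it makes [(s, 0)] and [(0, t)]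
    tangent directions, so that the two components can be treated separately. *)
Lemma model_tangent_set0 : model_tangent_set M P (fun=> 0).
Proof.
split; first exact: L2_0.
exists (fun=> P); split => //.
apply/littleo_at0_ge0P => [e|eps eps0].
  by apply: integral_ge0 => z _; rewrite lee_fin sqr_ge0.
near=> e; rewrite /qmd_remainder.
under eq_integral do rewrite subrr mulr0 mul0r subr0 expr0n /=.
by rewrite integral0 lee_fin mulr_ge0 ?sqr_ge0 ?ltW.
Unshelve. all: by end_near. Qed.

Lemma L2tangent_set0 : L2tangent_set mu U u (fun=> 0).
Proof.
split; first exact: L2_0.
exists (fun=> u); split => //.
apply/littleo_L2normP; apply/littleo_at0_ge0P => [e|eps eps0].
  by apply: integral_ge0 => z _; rewrite lee_fin sqr_ge0.
near=> e.
under eq_integral do rewrite subrr mulr0 subr0 expr0n /=.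
by rewrite integral0 lee_fin mulr_ge0 ?sqr_ge0 ?ltW.
Unshelve. all: by end_near. Qed.

Variables D1 D2 : (Z -> R) -> (T -> R) -> Y -> R.
Hypotheses (hD1 : is_total_derivative M mu U nu theta P u D1)
  (hD2 : is_total_derivative M mu U nu theta P u D2).

Let dotM := model_tangent_space M P.
Let dotU := L2tangent_space mu U u.
Let agree s t := {ae nu, forall y, D1 s t y = D2 s t y}.

Let tU_sub : L2tangent_set mu U u `<=` dotU.
Proof.
move=> s ts; apply: L2closure_sub; last exact: sub_linear_span.
by apply: linear_span_L2 => ? [].
Qed.
Let spanM_sub : linear_span (model_tangent_set M P) `<=` dotM.
Proof. by apply: L2closure_sub; apply: linear_span_L2 => ? []. Qed.
Let spanU_sub : linear_span (L2tangent_set mu U u) `<=` dotU.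
Proof. by apply: L2closure_sub; apply: linear_span_L2 => ? []. Qed.

(** Along one path both expansions hold, and the difference of their remainders is [e * (D1 - D2)];
    a single small [e] bounds [D1 - D2] by an arbitrary [eps]. *)
Let agree_tangent s t : model_tangent_set M P s -> L2tangent_set mu U u t ->
  agree s t.
Proof.
move=> ts tt; have [_ [Pe hPe]] := ts; have [_ [ue hue]] := tt.
have [th2 [L21 _ _] r1] := hD1; have [_ [L22 _ _] r2] := hD2.
have del1 : L2 nu (D1 s t) by apply: L21; [exact: tangent_set_sub_space|exact: tU_sub].
have del2 : L2 nu (D2 s t) by apply: L22; [exact: tangent_set_sub_space|exact: tU_sub].
have := r1 _ _ _ _ ts tt hPe hue; have := r2 _ _ _ _ ts tt hPe hue.
have nn (f : R -> Y -> R) e : (0 <= \int[nu]_x (f e x ^+ 2)%:E)%E.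
  by apply: integral_ge0 => z _; rewrite lee_fin sqr_ge0.
move=> /littleo_L2normP/littleo_at0_ge0P => /(_ (nn _)) o2.
move=> /littleo_L2normP/littleo_at0_ge0P => /(_ (nn _)) o1.
have m1 := L2_measurable del1; have m2 := L2_measurable del2.
suff : {ae nu, forall y, D1 s t y - D2 s t y = 0}.
  by apply: filterS => y /eqP; rewrite subr_eq0 => /eqP.
apply: integral_sqr_eq0; first exact: measurable_funB.
(* Squaring a sum of two terms costs a factor 2 on each, so two remainders of size [eps / 4] add up
   to [eps]. *)
move=> eps eps0; have e4 : 0 < eps / 4 by rewrite divr_gt0.
have [e [[[e0 e1] h1] h2]] : exists e : R, ((0 < e /\ e < 1) /\
   (\int[nu]_y ((theta (Pe e) (ue e) y - theta P u y - e * D1 s t y) ^+ 2)%:E <= (eps / 4 * e ^+ 2)%:E)%E) /\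
   (\int[nu]_y ((theta (Pe e) (ue e) y - theta P u y - e * D2 s t y) ^+ 2)%:E <= (eps / 4 * e ^+ 2)%:E)%E.
  apply: (@filter_ex _ (0:R)^'+).
  apply: filterI; last exact: o2.
  apply: filterI; last exact: o1.
  apply: filterI; first exact: nbhs_right_gt.
  exact: nbhs_right_lt.
have e01 : 0 <= e <= 1 by rewrite !ltW.
have mth : measurable_fun setT (fun y => theta (Pe e) (ue e) y - theta P u y).
  apply: measurable_funB; apply: (L2_measurable (mu := nu)); apply: th2 => //.
    by case: hPe => + _ _; exact.
  by case: hue => + _; exact.
have mr1 : measurable_fun setT (fun y => theta (Pe e) (ue e) y - theta P u y - e * D1 s t y).
  by apply: measurable_funB => //; exact: measurable_funM.
have mr2 : measurable_fun setT (fun y => theta (Pe e) (ue e) y - theta P u y - e * D2 s t y).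
  by apply: measurable_funB => //; exact: measurable_funM.
have mNr1 : measurable_fun setT (fun y => - (theta (Pe e) (ue e) y - theta P u y - e * D1 s t y)).
  exact: measurableT_comp.
have m12 : measurable_fun setT (fun y => e * (D1 s t y - D2 s t y)).
  by apply: measurable_funM => //; exact: measurable_funB.
have := integral_sqrD_le (mu := nu) mNr1 mr2 m12 _.
move=> /(_ ltac:(by apply: nearW => y; ring)).
under eq_integral do rewrite exprMn EFinM.
rewrite ge0_integralZl//; last 3 first.
- by apply/measurable_EFinP; apply: measurable_funX; exact: measurable_funB.
- by move=> y _; rewrite lee_fin sqr_ge0.
- by rewrite lee_fin sqr_ge0.
under [X in (_ <= 2%:E * X + _)%E -> _]eq_integral do rewrite sqrrN.
move=> h.
have e2 : 0 < e ^+ 2 by rewrite exprn_gt0.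
rewrite -(@lee_pmul2l _ (e ^+ 2)%:E)//; apply: (le_trans h).
apply: (@le_trans _ _ (2%:E * (eps / 4 * e ^+ 2)%:E + 2%:E * (eps / 4 * e ^+ 2)%:E)%E).
  by rewrite leeD// lee_wpmul2l.
by rewrite -!EFinM -EFinD lee_fin; lra.
Qed.

Let lin1 (D : (Z -> R) -> (T -> R) -> Y -> R) : continuous_linear M mu U nu P u D ->
  forall (a : R) s1 s2 t1 t2, dotM s1 -> dotM s2 -> dotU t1 -> dotU t2 ->
  {ae nu, forall y, D (fun z => a * s1 z + s2 z) (fun z => a * t1 z + t2 z) y =
    a * D s1 t1 y + D s2 t2 y}.
Proof.
move=> [_ l _] a s1 s2 t1 t2 h1 h2 h3 h4; have := l a s1 s2 t1 t2 h1 h2 h3 h4.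
by apply: filterS => y; apply.
Qed.

Let agree_lin (a : R) s1 s2 t1 t2 : dotM s1 -> dotM s2 -> dotU t1 -> dotU t2 ->
  agree s1 t1 -> agree s2 t2 ->
  agree (fun z => a * s1 z + s2 z) (fun z => a * t1 z + t2 z).
Proof.
move=> h1 h2 h3 h4 a1 a2; have [_ c1 _] := hD1; have [_ c2 _] := hD2.
have := ae_and (lin1 c1 a h1 h2 h3 h4) (ae_and (lin1 c2 a h1 h2 h3 h4) (ae_and a1 a2)).
by apply: filterS => y [-> [-> [-> ->]]].
Qed.

Let agree_spanM s : linear_span (model_tangent_set M P) s -> agree s (fun=> 0).
Proof.
move=> [n [c [g [tg ->]]]]; elim: n c g tg => [|n IHn] c g tg.
  have -> : (fun z => \sum_(i < 0) c i * g i z) = (fun=> 0).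
    by apply/funext => z; rewrite big_ord0.
  exact: agree_tangent model_tangent_set0 L2tangent_set0.
have -> : (fun z => \sum_(i < n.+1) c i * g i z) =
    (fun z => c ord0 * g ord0 z + \sum_(i < n) c (lift ord0 i) * g (lift ord0 i) z).
  by apply/funext => z; rewrite big_ord_recl.
(* Linearity is available only jointly in both components, so the zero direction has to be written
   in the form [a * t1 + t2] with the same coefficient. *)
have -> : (fun _ : T => 0 : R) = (fun z => c ord0 * (fun=> 0) z + (fun=> 0) z).
  by apply/funext => z; rewrite mulr0 addr0.
have U0 : dotU (fun=> 0) by apply: tU_sub; exact: L2tangent_set0.
apply: agree_lin => //.
- exact: tangent_set_sub_space.
- by apply: spanM_sub; exists n, (fun i => c (lift ord0 i)), (fun i => g (lift ord0 i)).
- by apply: agree_tangent => //; exact: L2tangent_set0.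
- exact: (IHn (fun i => c (lift ord0 i)) (fun i => g (lift ord0 i))).
Qed.

Let agree_spanU t : linear_span (L2tangent_set mu U u) t -> agree (fun=> 0) t.
Proof.
move=> [n [c [g [tg ->]]]]; elim: n c g tg => [|n IHn] c g tg.
  have -> : (fun z => \sum_(i < 0) c i * g i z) = (fun=> 0).
    by apply/funext => z; rewrite big_ord0.
  exact: agree_tangent model_tangent_set0 L2tangent_set0.
have -> : (fun z => \sum_(i < n.+1) c i * g i z) =
    (fun z => c ord0 * g ord0 z + \sum_(i < n) c (lift ord0 i) * g (lift ord0 i) z).
  by apply/funext => z; rewrite big_ord_recl.
have -> : (fun _ : Z => 0 : R) = (fun z => c ord0 * (fun=> 0) z + (fun=> 0) z).
  by apply/funext => z; rewrite mulr0 addr0.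
have M0 : dotM (fun=> 0) by apply: tangent_set_sub_space; exact: model_tangent_set0.
apply: agree_lin => //.
- exact: tU_sub.
- by apply: spanU_sub; exists n, (fun i => c (lift ord0 i)), (fun i => g (lift ord0 i)).
- by apply: agree_tangent => //; exact: model_tangent_set0.
- exact: (IHn (fun i => c (lift ord0 i)) (fun i => g (lift ord0 i))).
Qed.

Let agree_span s t : linear_span (model_tangent_set M P) s ->
  linear_span (L2tangent_set mu U u) t -> agree s t.
Proof.
move=> hs ht.
have -> : s = (fun z => 1 * s z + (fun=> 0) z).
  by apply/funext => z; rewrite mul1r addr0.
have -> : t = (fun z => 1 * (fun=> 0) z + t z).
  by apply/funext => z; rewrite mulr0 add0r.
apply: agree_lin.
- exact: spanM_sub.
- by apply: tangent_set_sub_space; exact: model_tangent_set0.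
- by apply: tU_sub; exact: L2tangent_set0.
- exact: spanU_sub.
- exact: agree_spanM.
- exact: agree_spanU.
Qed.

(** The continuity clause bounds the sum of the squared distances of the two components, hence half
    of [del ^+ 2] for each. *)
Let approx d (V : measurableType d) (la : {measure set V -> \bar R})
    (S : set (V -> R)) f (del : R) : 0 < del -> L2closure la S f ->
  exists2 g, S g & (L2norm la (g \- f)%R ^+ 2 < ((del ^+ 2) / 2)%:E)%E.
Proof.
move=> d0 [_ /(_ (del / 2))]; rewrite divr_gt0// => /(_ isT)[g Sg].
rewrite L2norm_lt ?divr_gt0// => h; exists g => //; rewrite L2norm_sqr.
under eq_integral do rewrite /= -sqrrN opprB.
apply: (lt_le_trans h); rewrite lee_fin; have := sqr_ge0 del; lra.
Qed.

(** The derivatives agree on the spans, and both are continuous. Approximating [(s, t)] by one pair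
    [(s', t')] from the spans writes the difference at [(s, t)] as a sum of two small increments. *)
Lemma total_derivative_unique s t : dotM s -> dotU t ->
  {ae nu, forall y, D1 s t y = D2 s t y}.
Proof.
move=> hs ht; have [_ [L21 _ k1] _] := hD1; have [_ [L22 _ k2] _] := hD2.
have m1 := L2_measurable (L21 _ _ hs ht). have m2 := L2_measurable (L22 _ _ hs ht).
suff : {ae nu, forall y, D1 s t y - D2 s t y = 0}.
  by apply: filterS => y /eqP; rewrite subr_eq0 => /eqP.
apply: integral_sqr_eq0; first exact: measurable_funB.
move=> eps eps0.
pose e := Num.sqrt (eps / 4).
have e0 : 0 < e by rewrite sqrtr_gt0 divr_gt0.
have ee : e ^+ 2 = eps / 4 by rewrite sqr_sqrtr// divr_ge0// ltW.
have [del1 del10 c1] := k1 s t hs ht e e0. have [del2 del20 c2] := k2 s t hs ht e e0.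
pose del := Num.min del1 del2.
have del0 : 0 < del by rewrite lt_min del10.
have [s' Ss' hs'] := approx del0 hs. have [t' St' ht'] := approx del0 ht.
have dM := spanM_sub Ss'. have dU := spanU_sub St'.
have sum : (L2norm P (s' \- s)%R ^+ 2 + L2norm mu (t' \- t)%R ^+ 2 < (del ^+ 2)%:E)%E.
  rewrite (_ : del ^+ 2 = (del ^+ 2) / 2 + (del ^+ 2) / 2); last by rewrite -splitr.
  by rewrite EFinD lteD.
have le2 x : 0 < x -> del <= x -> ((del ^+ 2)%:E <= (x ^+ 2)%:E)%E.
  by move=> x0 dx; rewrite lee_fin lerXn2r ?nnegrE// ltW.
have := c1 s' t' dM dU (lt_le_trans sum (le2 _ del10 _)).
rewrite {1}/del ge_min lexx => /(_ isT).
rewrite L2norm_lt// ee => h1.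
have := c2 s' t' dM dU (lt_le_trans sum (le2 _ del20 _)).
rewrite {1}/del ge_min lexx orbT => /(_ isT).
rewrite L2norm_lt// ee => h2.
have m1' := L2_measurable (L21 _ _ dM dU). have m2' := L2_measurable (L22 _ _ dM dU).
have a1 : measurable_fun setT (fun y => - (D1 s' t' y - D1 s t y)).
  by apply: measurableT_comp => //; exact: measurable_funB.
have a2 : measurable_fun setT (fun y => D2 s' t' y - D2 s t y) by exact: measurable_funB.
have a3 : measurable_fun setT (fun y => D1 s t y - D2 s t y) by exact: measurable_funB.
have h : {ae nu, forall y, D1 s t y - D2 s t y =
    - (D1 s' t' y - D1 s t y) + (D2 s' t' y - D2 s t y)}.
  by apply: filterS (agree_span Ss' St') => y ->; ring.
apply: (le_trans (integral_sqrD_le a1 a2 a3 h)).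
under eq_integral do rewrite sqrrN.
apply: (@le_trans _ _ (2%:E * (eps / 4)%:E + 2%:E * (eps / 4)%:E)%E).
  by rewrite leeD// lee_wpmul2l// ltW.
by rewrite -!EFinM -EFinD lee_fin; lra.
Qed.

End uniqueness.

(** * The tangent space of a ball *)

Section ball.
Context d (T : measurableType d) (R : realType) (Q : probability T R) (m : R).
Notation U := (Linfty_ball Q m).

Lemma Linfty_ballP (f : T -> R) :
  U f <-> measurable_fun setT f /\ {ae Q, forall z, `|f z| <= m}.
Proof.
have E : ('N[Q]_+oo[EFin \o f] <= m%:E)%E <-> {ae Q, forall z, `|f z| <= m}.
  rewrite unlock /= probability_setT lte01; split => [/ess_supP h|h].
    by apply: filterS h => x /=; rewrite lee_fin.
  by apply/ess_supP; apply: filterS h => x /=; rewrite lee_fin.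
by split=> -[mf /E].
Qed.

Lemma Linfty_ball_ge0 (f : T -> R) : U f -> 0 <= m.
Proof. by move=> [_ fm]; rewrite -lee_fin (le_trans _ fm)// Lnorm_ge0. Qed.

Lemma linear_spanB d' (V : measurableType d') (S : set (V -> R)) (f g : V -> R) :
  S f -> S g -> linear_span S (fun z => f z - g z).
Proof.
move=> Sf Sg; exists 2%N, (fun i => if i == ord0 then 1 else -1),
  (fun i => if i == ord0 then f else g); split.
  by move=> i; case: ifP.
by apply/funext => z; rewrite !big_ord_recl big_ord0 /= mul1r mulN1r addr0.
Qed.

Variable u : T -> R.
Hypothesis Uu : U u.

(** The straight path [u + e * h] stays in the ball: [h] is opposed in sign to [u], so the nearer
    bound is not crossed, and a step of size at most [m] cannot cross the other one. *)
Lemma inward_tangent (K : R) (h : T -> R) : 0 < m -> measurable_fun setT h ->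
  (forall z, `|h z| <= K) -> (forall z, 0 <= u z -> h z <= 0) ->
  (forall z, u z < 0 -> 0 <= h z) -> L2tangent_set Q U u h.
Proof.
move=> m0 mh hK hpos hneg; split; first exact: (L2_bounded Q mh hK).
have [mfu um] := (Linfty_ballP u).1 Uu.
(* A path must remain in the ball at all times in [[0, 1]], hence the fallback to [u]; near 0 the
   first branch applies because [m] is positive. *)
exists (fun e => if e * K <= m then (fun z => u z + e * h z) else u); split.
  move=> e /andP[e0 e1]; case: ifPn => [eK|//]; apply/Linfty_ballP; split.
    by apply: measurable_funD => //; exact: measurable_funM.
  apply: filterS um => z; rewrite !ler_norml => /andP[u1 u2].
  have /andP[h1 h2] : - m <= e * h z <= m.
    rewrite -ler_norml normrM ger0_norm// (le_trans _ eK)// ler_wpM2l//.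
  have [uz|uz] := lerP 0 (u z).
    by have := hpos _ uz => hz; apply/andP; split; nra.
  by have := hneg _ uz => hz; apply/andP; split; nra.
apply/littleo_L2normP/littleo_at0_ge0P => [e|eps eps0].
  by apply: integral_ge0 => z _; rewrite lee_fin sqr_ge0.
have K1 : 0 < `|K| + 1 by rewrite ltr_wpDl.
near=> e.
have e0 : 0 < e by near: e; exact: nbhs_right_gt.
have -> : e * K <= m.
  have em : e <= m / (`|K| + 1) by near: e; apply: nbhs_right_le; rewrite divr_gt0.
  rewrite ler_pdivlMr// in em; rewrite (le_trans _ em)// ler_pM2l//.
  by rewrite (le_trans (ler_norm _))// lerDl.
under eq_integral do rewrite (addrC (u _)) addrK subrr expr0n /=.
by rewrite integral0 lee_fin mulr_ge0 ?sqr_ge0 ?ltW.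
Unshelve. all: by end_near. Qed.

(** [f1] is the inward part of [f]. What is left of [f] points outward, so its opposite [f1 - f]
    points inward, and [f] is a difference of two tangent directions. *)
Lemma bounded_tangent_span (K : R) (f : T -> R) : 0 < m -> measurable_fun setT f ->
  (forall z, `|f z| <= K) -> linear_span (L2tangent_set Q U u) f.
Proof.
move=> m0 mf fK; have [mfu um] := (Linfty_ballP u).1 Uu.
pose f1 z := if 0 <= u z then Num.min (f z) 0 else Num.max (f z) 0.
have mf1 : measurable_fun setT f1.
  apply: measurable_fun_if => //.
  - by apply: measurable_fun_ler.
  - by apply: measurable_funTS; exact: measurable_minr.
  - by apply: measurable_funTS; exact: measurable_maxr.
have fK' z : - K <= f z <= K by rewrite -ler_norml.
have -> : f = (fun z => f1 z - (f1 z - f z)).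
  by apply/funext => z; rewrite opprB addrC subrK.
apply: linear_spanB; apply: (@inward_tangent K) => //.
- move=> z; rewrite ler_norml /f1; have /andP[h1 h2] := fK' z.
  by case: ifP => _; have [h|h] := lerP (f z) 0; apply/andP; split; lra.
- by move=> z uz; rewrite /f1 uz ge_min lexx orbT.
- by move=> z uz; rewrite /f1 (lt_geF uz) le_max lexx orbT.
- exact: measurable_funB.
- move=> z; rewrite ler_norml /f1; have /andP[h1 h2] := fK' z.
  by case: ifP => _; have [h|h] := lerP (f z) 0; apply/andP; split; lra.
- by move=> z uz; rewrite /f1 uz subr_le0 ge_min lexx.
- by move=> z uz; rewrite /f1 (lt_geF uz) subr_ge0 le_max lexx.
Qed.

Lemma ball_tangent_space (f : T -> R) : 0 < m -> L2 Q f -> L2tangent_space Q U u f.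
Proof.
move=> m0 f2; split => // e e0; have mf := L2_measurable f2.
have e2 : 0 < e ^+ 2 / 2 by rewrite divr_gt0// exprn_gt0.
have [n hn] := tail_integral (fun z => sqr_ge0 (f z)) (L2_sqr f2) e2.
pose A := [set z | n%:R < f z ^+ 2].
have mA : measurable A.
  rewrite [A](_ : _ = setT `&` (fun z => f z ^+ 2) @^-1` `]n%:R, +oo[%classic).
    by apply: measurable_funX.
  by rewrite setTI; apply/seteqP; split => x /=; rewrite in_itv /= andbT.
exists (fun z => (1 - \1_A z) * f z).
  (* Off [A] one has [f z ^+ 2 <= n], which implies [|f z| <= n + 1] without any square root. *)
  apply: (@bounded_tangent_span (n%:R + 1)) => //.
    by apply: measurable_funM => //; apply: measurable_funB.
  move=> z; rewrite indicE; case: (boolP (z \in A)) => /= [_|].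
    by rewrite subrr mul0r normr0 addr_ge0.
  rewrite notin_setE /A /= => /negP; rewrite -leNgt => h.
  rewrite subr0 mul1r ler_norml; have n0 : 0 <= n%:R :> R by [].
  by apply/andP; split; nra.
rewrite L2norm_lt//.
have E z : (f \- (fun z => (1 - \1_A z) * f z))%R z ^+ 2 = \1_A z * f z ^+ 2.
  by rewrite /= indicE; case: (_ \in _) => /=; ring.
under eq_integral do rewrite E.
by rewrite (le_lt_trans hn)// lte_fin ltr_pdivrMr// mulr_natr mulr2n ltrDl exprn_gt0.
Qed.

(** The empty linear combination already lies at distance zero, whatever the tangent directions are;
    this serves for a ball of radius 0. *)
Lemma tangent_space_ae0 (f : T -> R) : measurable_fun setT f ->
  {ae Q, forall z, f z = 0} -> L2tangent_space Q U u f.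
Proof.
move=> mf f0; split.
  by apply: (L2_ae_eq mf _ (L2_0 Q)); apply: filterS f0 => z ->.
move=> e e0; exists (fun=> 0).
  exists 0%N, (fun=> 0), (fun=> fun=> 0); split; first by case.
  by apply/funext => z; rewrite big_ord0.
rewrite L2norm_lt// (ae_eq_integral (cst 0%E))//.
- by rewrite integral0 lte_fin exprn_gt0.
- by apply/measurable_EFinP; apply: measurable_funX; exact: measurable_funB.
- by apply: filterS f0 => z /= -> _; rewrite subr0 expr0n.
Qed.

End ball.

(** * The derivative of the conditional variance *)

Lemma L2_law d d' (Z : measurableType d) (X : measurableType d') (R : realType)
    (P : probability Z R) (C : {mfun Z >-> X}) (w : X -> R) :
  L2 (distribution P C) w -> L2 P (fun z => w (C z)).
Proof.
move=> w2; have mw := L2_measurable w2; apply/L2P; split.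
  exact: measurable_compC.
apply: intg_ge0; first by apply: measurable_funX; exact: measurable_compC.
  by move=> z; exact: sqr_ge0.
rewrite -(ge0_integral_law P C (measurable_funX 2 mw) (fun x => sqr_ge0 (w x))).
exact: intg_lty (L2_sqr w2).
Qed.

Lemma L2_ae_le d (T : measurableType d) (R : realType)
    (mu : {measure set T -> \bar R}) (K : R) (f g : T -> R) :
  measurable_fun setT f -> L2 mu g ->
  {ae mu, forall x, `|f x| <= K * `|g x|} -> L2 mu f.
Proof.
move=> mf g2 fg; have mg := L2_measurable g2.
apply/L2P; split => //; apply: intg_ge0; first exact: measurable_funX.
  by move=> x; exact: sqr_ge0.
apply: (@le_lt_trans _ _ (\int[mu]_x (K ^+ 2 * g x ^+ 2)%:E)%E); last first.
  exact: intg_lty (intgZ _ (L2_sqr g2)).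
apply: ae_ge0_le_integral => //.
- by move=> x _; rewrite lee_fin sqr_ge0.
- by apply/measurable_EFinP; exact: measurable_funX.
- by move=> x _; rewrite lee_fin mulr_ge0// sqr_ge0.
- apply/measurable_EFinP; apply: measurable_funM => //; exact: measurable_funX.
- apply: filterS fg => x fx _; rewrite lee_fin -exprMn.
  have := ler_sqr_norm fx; rewrite !exprMn real_normK ?num_real//.
Qed.

Lemma Rintegral_density d (T : measurableType d) (R : realType)
    (nu mu : {finite_measure set T -> \bar R}) (f : T -> R) : nu `<< mu ->
  intg nu f -> \int[nu]_x f x = \int[mu]_x (f x * density nu mu x).
Proof.
move=> numu If; rewrite /Rintegral.
have := Radon_Nikodym_change_of_variables numu measurableT If.
rewrite -/(RNderiv nu mu) -(EFin_density numu) => <-.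
by congr fine; apply: eq_integral.
Qed.

Section variance_derivative.
Context (R : realType) (dZ dX : measure_display)
  (Z : measurableType dZ) (X : measurableType dX) (C : {mfun Z >-> X}).
Variables (P Q : probability Z R) (m : R) (u' : Z -> R) (mu th : X -> R).
Notation PX := (distribution P C).
Notation QX := (distribution Q C).
Notation ice := (is_cond_exp P C).
Hypotheses (PQ : P `<< Q) (QP : Q `<< P) (m0 : 0 <= m).
Variables (KX KZ : R).
Hypotheses (KX0 : 0 <= KX) (hKX : {ae PX, forall x, `|density QX PX x| <= KX}).
Hypotheses (KZ0 : 0 <= KZ) (hKZ : {ae Q, forall z, `|density P Q z| <= KZ}).
Hypotheses (mfu' : measurable_fun setT u') (u'm : forall z, `|u' z| <= m).
Hypotheses (mmu : measurable_fun setT mu) (mum : forall x, `|mu x| <= m).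
Hypotheses (mth : measurable_fun setT th) (thm : forall x, 0 <= th x <= (2 * m) ^+ 2).
Hypotheses (imu : ice u' mu) (ith : ice (fun z => (u' z - mu (C z)) ^+ 2) th).

Let f0 z := u' z - mu (C z).
Let phi z := f0 z ^+ 2 - th (C z).
Let Df (s t : Z -> R) z := s z * phi z + 2 * (t z * f0 z).

(** The variation of the conditional mean with [P] and [u] contributes no term: the mean minimises
    the conditional mean square, so its displacement matters only at second order. *)
Definition variance_derivative (s t : Z -> R) : X -> R := cond_exp P C (Df s t).

Notation D0 := variance_derivative.

Let mf0 : measurable_fun setT f0.
Proof. by apply: measurable_funB => //; exact: measurable_compC. Qed.
Let mphi : measurable_fun setT phi.
Proof.
by apply: measurable_funB; [exact: measurable_funX|exact: measurable_compC].
Qed.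
Let f0m z : `|f0 z| <= 2 * m.
Proof.
rewrite (le_trans (ler_normB _ _))//.
by have := u'm z; have := mum (C z); lra.
Qed.
Let phim z : `|phi z| <= (2 * m) ^+ 2.
Proof.
have /andP[h1 h2] := thm (C z); have := ler_sqr_norm (f0m z).
by have := sqr_ge0 (f0 z); rewrite ler_norml /phi; lra.
Qed.

Lemma QX_PX : QX `<< PX. Proof. exact: distribution_dominates. Qed.
Let hKX' : {ae PX, forall x, density QX PX x <= KX}.
Proof. by apply: filterS hKX => x; apply: le_trans; exact: ler_norm. Qed.
Let hKZ' : {ae Q, forall x, density P Q x <= KZ}.
Proof. by apply: filterS hKZ => x; apply: le_trans; exact: ler_norm. Qed.

Lemma L2_QP t : L2 Q t -> L2 P t.
Proof. exact: L2_bounded_density PQ hKZ' KZ0. Qed.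

Let Df2 s t : L2 P s -> L2 P t -> L2 P (Df s t).
Proof.
move=> s2 t2; apply: L2D; last apply: L2Z.
  by under eq_fun do rewrite mulrC; exact: L2_bM mphi phim s2.
by under eq_fun do rewrite mulrC; exact: L2_bM mf0 f0m t2.
Qed.

Lemma variance_derivativeP s t : L2 P s -> L2 P t -> ice (Df s t) (D0 s t).
Proof. by move=> s2 t2; apply: cond_expP; apply: L2_intg; exact: Df2. Qed.

Lemma variance_derivative_lin (a : R) s1 s2 t1 t2 : L2 P s1 -> L2 P s2 -> L2 P t1 -> L2 P t2 ->
  {ae PX, forall x, D0 (fun z => a * s1 z + s2 z) (fun z => a * t1 z + t2 z) x =
    a * D0 s1 t1 x + D0 s2 t2 x}.
Proof.
move=> h1 h2 h3 h4.
have i1 := variance_derivativeP h1 h3. have i2 := variance_derivativeP h2 h4.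
have I1 := L2_intg (Df2 h1 h3). have I2 := L2_intg (Df2 h2 h4).
have i3 := ice_lin a I1 I2 i1 i2.
have i4 := variance_derivativeP (L2D (L2Z a h1) h2) (L2D (L2Z a h3) h4).
apply: ice_unique i4 _; move: i3; congr ice; apply/funext => z.
by rewrite /Df; ring.
Qed.

(** A common bound for [2 * phi ^+ 2] and [8 * f0 ^+ 2], the coefficients of [s ^+ 2] and [t ^+ 2]
    in the estimate of [Df s t ^+ 2]. *)
Let c0 : R := 8 * (2 * m) ^+ 4 + 8 * (2 * m) ^+ 2.
Let c00 : 0 <= c0.
Proof. by rewrite /c0 (exprM _ 2 2) addr_ge0// mulr_ge0// sqr_ge0. Qed.

(** [KX] pays for passing from [QX] to [PX], [c0] for the boundedness of [phi] and [f0] after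
    Jensen's inequality, and [1 + KZ] for measuring [t] under [Q] instead of [P]. *)
Lemma variance_derivative_bound s t : L2 P s -> L2 Q t ->
  (\int[QX]_x (D0 s t x ^+ 2)%:E <= (KX * c0 * (1 + KZ))%:E *
    (\int[P]_z (s z ^+ 2)%:E + \int[Q]_z (t z ^+ 2)%:E))%E.
Proof.
move=> s2 t2; have t2P := L2_QP t2.
have iD := variance_derivativeP s2 t2P; have mD := ice_measurable iD.
have D2 := Df2 s2 t2P.
have mD2 : measurable_fun setT (fun x => D0 s t x ^+ 2) by exact: measurable_funX.
have nD x : 0 <= D0 s t x ^+ 2 by exact: sqr_ge0.
apply: (le_trans (ge0_le_integral_bounded_density QX_PX hKX' KX0 mD2 nD)).
have ms := L2_measurable s2; have mt := L2_measurable t2.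
have ms2 : measurable_fun setT (fun z => s z ^+ 2) by exact: measurable_funX.
have mt2 : measurable_fun setT (fun z => t z ^+ 2) by exact: measurable_funX.
have mDf : measurable_fun setT (fun z => Df s t z ^+ 2).
  by apply: measurable_funX; exact: L2_measurable D2.
have h1 : (\int[PX]_x (D0 s t x ^+ 2)%:E <= \int[P]_z (Df s t z ^+ 2)%:E)%E.
  have [J' iJ' J'0] := ice_ge0_version C (measurable_funX 2 (L2_measurable D2))
    (L2_sqr D2) (fun z => sqr_ge0 (Df s t z)).
  rewrite -(ice_total iJ'); apply: ae_ge0_le_integral => //.
  - by move=> x _; rewrite lee_fin.
  - exact/measurable_EFinP.
  - by move=> x _; rewrite lee_fin.
  - by apply/measurable_EFinP; exact: ice_measurable iJ'.
  - by apply: filterS (ice_jensen D2 iD iJ') => x ? _; rewrite lee_fin.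
have h2 : (\int[P]_z (Df s t z ^+ 2)%:E <=
    c0%:E * \int[P]_z (s z ^+ 2)%:E + c0%:E * \int[P]_z (t z ^+ 2)%:E)%E.
  rewrite -ge0_integral_lin//; [|by move=> z; exact: sqr_ge0|by move=> z; exact: sqr_ge0].
  apply: ge0_le_integral => //.
  - by move=> z _; rewrite lee_fin sqr_ge0.
  - exact/measurable_EFinP.
  - apply/measurable_EFinP; apply: measurable_funD; exact: measurable_funM.
  - move=> z _; rewrite lee_fin.
    have p2 : phi z ^+ 2 <= (2 * m) ^+ 4 by rewrite (exprM _ 2 2) ler_sqr_norm.
    have f2 : f0 z ^+ 2 <= (2 * m) ^+ 2 by rewrite ler_sqr_norm.
    have e : Df s t z ^+ 2 <= 2 * (s z ^+ 2 * phi z ^+ 2) + 8 * (t z ^+ 2 * f0 z ^+ 2).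
      by rewrite /Df; have := sqr_ge0 (s z * phi z - 2 * (t z * f0 z)); lra.
    have e1 : s z ^+ 2 * phi z ^+ 2 <= s z ^+ 2 * (2 * m) ^+ 4 by rewrite ler_wpM2l ?sqr_ge0.
    have e2 : t z ^+ 2 * f0 z ^+ 2 <= t z ^+ 2 * (2 * m) ^+ 2 by rewrite ler_wpM2l ?sqr_ge0.
    have e3 : 0 <= s z ^+ 2 * (2 * m) ^+ 2 by rewrite mulr_ge0 ?sqr_ge0.
    have e4 : 0 <= s z ^+ 2 * (2 * m) ^+ 4 by rewrite (exprM _ 2 2) mulr_ge0 ?sqr_ge0.
    have e5 : 0 <= t z ^+ 2 * (2 * m) ^+ 4 by rewrite (exprM _ 2 2) mulr_ge0 ?sqr_ge0.
    rewrite /c0 (le_trans e)//.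
    move: (s z ^+ 2) (t z ^+ 2) (phi z ^+ 2) (f0 z ^+ 2) ((2 * m) ^+ 4) ((2 * m) ^+ 2) e1 e2 e3 e4 e5.
    by move=> a b c f g h *; lra.
have h3 := ge0_le_integral_bounded_density PQ hKZ' KZ0 mt2 (fun z => sqr_ge0 (t z)).
set Is := (\int[P]_z (s z ^+ 2)%:E)%E in h2 *.
set It := (\int[P]_z (t z ^+ 2)%:E)%E in h2 h3 *.
set Jt := (\int[Q]_z (t z ^+ 2)%:E)%E in h3 *.
have Is0 : (0 <= Is)%E by apply: integral_ge0 => z _; rewrite lee_fin sqr_ge0.
have Jt0 : (0 <= Jt)%E by apply: integral_ge0 => z _; rewrite lee_fin sqr_ge0.
rewrite 2!EFinM -2!muleA lee_wpmul2l ?lee_fin// (le_trans h1)// (le_trans h2)//.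
rewrite -ge0_muleDr//; last first.
  by apply: integral_ge0 => z _; rewrite lee_fin sqr_ge0.
rewrite lee_wpmul2l ?lee_fin// ge0_muleDr// leeD//.
  by rewrite -[leLHS]mul1e lee_wpmul2r// lee_fin lerDl.
by rewrite (le_trans h3)// lee_wpmul2r// lee_fin lerDr.
Qed.

Section differentiability.
Variables (u : Z -> R) (s t : Z -> R) (Pe : R -> probability Z R) (ue : R -> Z -> R).
Hypotheses (uu' : {ae P, forall z, u z = u' z}) (mfu : measurable_fun setT u).
Hypotheses (mcv : measurable_fun setT (cond_var P C u))
  (cvth : {ae PX, forall x, cond_var P C u x = th x}).
Hypotheses (s2 : L2 P s) (t2 : L2 Q t).
Hypothesis Pe_equiv : forall e, 0 <= e <= 1 -> P `<< Pe e /\ Pe e `<< P.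
Hypothesis ue_ball : forall e, 0 <= e <= 1 ->
  measurable_fun setT (ue e) /\ {ae P, forall z, `|ue e z| <= m}.
Hypothesis Pe_qmd : littleo_at0 (fun e => qmd_remainder P (Pe e) s e) 2.
Hypothesis ue_path :
  littleo_at0 (fun e => L2norm Q (fun z => ue e z - u z - e * t z)) 1.

Lemma cond_var_differentiable : littleo_at0 (fun e => L2norm QX
  (fun x => cond_var (Pe e) C (ue e) x - cond_var P C u x - e * D0 s t x)) 1.
Proof.
have t2P := L2_QP t2; have iD := variance_derivativeP s2 t2P.
have mD := ice_measurable iD.
have nni dd (V : measurableType dd) (la : {measure set V -> \bar R}) (f : V -> R) :
    (0 <= \int[la]_x (f x ^+ 2)%:E)%E.
  by apply: integral_ge0 => x _; rewrite lee_fin sqr_ge0.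
apply/littleo_L2normP/littleo_at0_ge0P => // eps eps0.
move/littleo_L2normP: ue_path => /littleo_at0_ge0P => /(_ (fun e => nni _ _ _ _)) hu.
move/littleo_at0_ge0P: Pe_qmd => /(_ (fun e => nni _ _ _ _)) hP.
have [S iS S0] := ice_ge0_version C (measurable_funX 2 (L2_measurable s2))
  (L2_sqr s2) (fun z => sqr_ge0 (s z)).
have [T iT T0] := ice_ge0_version C (measurable_funX 2 (L2_measurable t2P))
  (L2_sqr t2P) (fun z => sqr_ge0 (t z)).
pose M : R := 2 * m + 8.
pose c := 200 * M ^+ 10.
have M0 : 0 <= M by rewrite /M; have := m0; lra.
have c_0 : 0 <= c by rewrite /c mulr_ge0// exprn_ge0.
(* Three contributions of size [r * e ^+ 2] will be added: the score remainder, the remainder of the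
   path in the ball, and the uniformly integrable term. The 1 keeps the divisor positive when
   [KX * c] vanishes. *)
pose r := eps / (3 * (KX * c + 1)).
have Kc1 : 0 < KX * c + 1 by rewrite ltr_wpDl// mulr_ge0.
have r0 : 0 < r by rewrite divr_gt0// mulr_gt0.
have rE : KX * c * (3 * r) <= eps.
  have -> : eps = (KX * c + 1) * (3 * r) by rewrite /r; field; lra.
  by rewrite ler_wpM2r ?lerDl// mulr_ge0// ltW.
have F0 x : 0 <= S x + T x by rewrite addr_ge0.
have [del del0 hdel] := uniformly_integrable_min F0
  (intgD (ice_intg iS) (ice_intg iT)) r0.
pose I := fine (\int[P]_z (s z ^+ 2 + t z ^+ 2)%:E)%E.
have Ist := intgD (L2_sqr s2) (L2_sqr t2P).
have IE : (\int[P]_z (s z ^+ 2 + t z ^+ 2)%:E = I%:E)%E.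
  by rewrite fineK//; exact: (integrable_fin_num measurableT Ist).
have I0 : 0 <= I.
  by rewrite -lee_fin -IE integral_ge0// => z _; rewrite lee_fin addr_ge0 ?sqr_ge0.
have KZ1 : 0 < KZ + 1 by rewrite ltr_wpDl.
have rK : 0 < r / (KZ + 1) by rewrite divr_gt0.
have b0 : 0 < 4 * r + 2 * I + 1 by lra.
near=> e.
have e0 : 0 < e by near: e; exact: nbhs_right_gt.
have e1 : e < 1 by near: e; exact: nbhs_right_lt.
(* The integral of [q] will be at most [e ^+ 2 * (4 * r + 2 * I)]; since [e ^+ 2 <= e], this choice
   brings it below [del]. *)
have eb : e <= del / (4 * r + 2 * I + 1).
  by near: e; apply: nbhs_right_le; rewrite divr_gt0.
have hPe : (qmd_remainder P (Pe e) s e <= (r * e ^+ 2)%:E)%E by near: e; exact: hP.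
have hue : (\int[Q]_z ((ue e z - u z - e * t z) ^+ 2)%:E <=
    (r / (KZ + 1) * e ^+ 2)%:E)%E by near: e; exact: hu.
have e01 : 0 <= e <= 1 by rewrite !ltW.
have [PPe PeP] := Pe_equiv e01. have [mue uem] := ue_ball e01.
have ee0 : 0 <= e ^+ 2 by exact: sqr_ge0.
have mk (w : Z -> R) : measurable_fun setT w ->
    measurable_fun setT (fun z => (ue e z - w z - e * t z) ^+ 2).
  move=> mw; apply: measurable_funX; apply: measurable_funB; first exact: measurable_funB.
  by apply: measurable_funM => //; exact: L2_measurable t2.
have hk : (\int[P]_z ((ue e z - u' z - e * t z) ^+ 2)%:E <= (r * e ^+ 2)%:E)%E.
  have -> : (\int[P]_z ((ue e z - u' z - e * t z) ^+ 2)%:E =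
      \int[P]_z ((ue e z - u z - e * t z) ^+ 2)%:E)%E.
    apply: ae_eq_integral => //.
    - by apply/measurable_EFinP; exact: mk.
    - by apply/measurable_EFinP; exact: mk.
    - by apply: filterS uu' => z /= -> _.
  apply: (le_trans (ge0_le_integral_bounded_density PQ hKZ' KZ0 (mk _ mfu)
    (fun z => sqr_ge0 _))).
  apply: (@le_trans _ _ (KZ%:E * (r / (KZ + 1) * e ^+ 2)%:E)%E).
    by rewrite lee_wpmul2l.
  rewrite -EFinM lee_fin mulrA ler_wpM2r// mulrCA ler_piMr ?ltW//.
  by rewrite ltr_pdivrMr// mul1r ltrDl.
have [q [mq q0 hq1 hq2]] := cond_var_remainder m0 mfu' u'm mmu mum mth thm imu ith
  s2 t2P iD iS S0 iT T0 e PPe PeP mue uem.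
have hq3 : (\int[PX]_x ((S x + T x) * Num.min (q x) 1)%:E <= r%:E)%E.
  apply: hdel => //; apply: (le_trans hq1); rewrite IE.
  apply: (@le_trans _ _ (2%:E * ((r * e ^+ 2)%:E + (r * e ^+ 2)%:E) + (2 * e ^+ 2)%:E * I%:E)%E).
    by rewrite leeD2r// lee_wpmul2l// leeD.
  change ((2 * (r * e ^+ 2 + r * e ^+ 2) + 2 * e ^+ 2 * I)%:E <= del%:E)%E.
  rewrite lee_fin.
  have -> : 2 * (r * e ^+ 2 + r * e ^+ 2) + 2 * e ^+ 2 * I = e ^+ 2 * (4 * r + 2 * I) by ring.
  have h1 : e ^+ 2 <= e by rewrite expr2 ler_piMr// ltW.
  rewrite (@le_trans _ _ (e * (4 * r + 2 * I + 1)))//; last by rewrite -ler_pdivlMr.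
  by rewrite ler_pM// ?lerDl//; have := ltW r0; lra.
have [_ [_ [_ [_ _ [_ _ _ mcve _]]]]] :=
  cond_var_version C m0 mue (ae_dominates PeP uem).
have mrem (w : X -> R) : measurable_fun setT w ->
  measurable_fun setT (fun x => (cond_var (Pe e) C (ue e) x - w x - e * D0 s t x) ^+ 2).
  move=> mw; apply: measurable_funX; apply: measurable_funB; first exact: measurable_funB.
  exact: measurable_funM.
apply: (le_trans (ge0_le_integral_bounded_density QX_PX hKX' KX0 (mrem _ mcv)
  (fun x => sqr_ge0 _))).
have -> : (\int[PX]_x ((cond_var (Pe e) C (ue e) x - cond_var P C u x - e * D0 s t x) ^+ 2)%:E =
    \int[PX]_x ((cond_var (Pe e) C (ue e) x - th x - e * D0 s t x) ^+ 2)%:E)%E.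
  apply: ae_eq_integral => //.
  - by apply/measurable_EFinP; exact: mrem.
  - by apply/measurable_EFinP; exact: mrem.
  - by apply: filterS cvth => x /= -> _.
apply: (@le_trans _ _ (KX%:E * (c%:E * ((r * e ^+ 2)%:E + (r * e ^+ 2)%:E +
    (e ^+ 2)%:E * r%:E)))%E).
  rewrite lee_wpmul2l ?lee_fin// (le_trans hq2)// lee_wpmul2l ?lee_fin//.
  by rewrite leeD// ?leeD// lee_wpmul2l.
change ((KX * (c * (r * e ^+ 2 + r * e ^+ 2 + e ^+ 2 * r)))%:E <= (eps * e ^+ 2)%:E)%E.
rewrite lee_fin.
have -> : KX * (c * (r * e ^+ 2 + r * e ^+ 2 + e ^+ 2 * r)) = KX * c * (3 * r) * e ^+ 2 by ring.
by rewrite ler_wpM2r.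
Unshelve. all: by end_near. Qed.

End differentiability.

Lemma variance_derivative_L2 s t : L2 P s -> L2 Q t -> L2 QX (D0 s t).
Proof.
move=> s2 t2; have iD := variance_derivativeP s2 (L2_QP t2).
apply/L2P; split; first exact: ice_measurable iD.
apply: intg_ge0; first by apply: measurable_funX; exact: ice_measurable iD.
  by move=> x; exact: sqr_ge0.
apply: (le_lt_trans (variance_derivative_bound s2 t2)); apply: lte_mul_pinfty => //.
  by rewrite lee_fin !mulr_ge0// addr_ge0.
by apply: lte_add_pinfty; exact: intg_lty (L2_sqr _).
Qed.

(** Writing [W] for the density of [QX] times [w], the inner product becomes the [P]-integral of
    [W (C z) * Df s t z], whose two summands are the two pairings. *)
Lemma variance_derivative_adjoint s t w : L2 P s -> L2 Q t -> L2 QX w ->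
  let ns z := density QX PX (C z) * w (C z) * (f0 z ^+ 2 - th (C z)) in
  let nt z := 2 * density P Q z * density QX PX (C z) * w (C z) * f0 z in
  [/\ L2 P ns, \int[P]_z ns z = 0, L2 Q nt &
    L2dot QX (D0 s t) w = L2dot P s ns + L2dot Q t nt].
Proof.
move=> s2 t2 w2 ns nt.
have mw := L2_measurable w2.
have mp := measurable_density QX_PX.
have mpZ := measurable_density PQ.
pose W x := density QX PX x * w x.
have mW : measurable_fun setT W by exact: measurable_funM.
(* Of the two density factors in [W ^+ 2], one is bounded by [KX] and the other converts [PX] into
   [QX], where [w] is square-integrable. *)
have W2 : L2 PX W.
  apply/L2P; split => //; apply: intg_ge0.
  - exact: measurable_funX.
  - by move=> x; exact: sqr_ge0.
  have mw2 : measurable_fun setT (fun x => w x ^+ 2) by exact: measurable_funX.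
  have mpd := measurable_pdensity QX_PX.
  apply: (@le_lt_trans _ _ (KX%:E * \int[QX]_x (w x ^+ 2)%:E)%E); last first.
    by apply: lte_mul_pinfty; [rewrite lee_fin| |exact: intg_lty (L2_sqr w2)].
  rewrite (ge0_integral_pdensity QX_PX mw2 (fun x => sqr_ge0 (w x))).
  have mwp : measurable_fun setT (fun x => w x ^+ 2 * pdensity QX PX x).
    exact: measurable_funM.
  have wp0 x : 0 <= w x ^+ 2 * pdensity QX PX x.
    by rewrite mulr_ge0 ?sqr_ge0// pdensity_ge0.
  rewrite -ge0_integralZl ?lee_fin//; [|exact/measurable_EFinP|by move=> x _; rewrite lee_fin].
  apply: ae_ge0_le_integral => //.
  - by move=> x _; rewrite lee_fin sqr_ge0.
  - by apply/measurable_EFinP; exact: measurable_funX.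
  - by move=> x _; rewrite lee_fin mulr_ge0.
  - by apply/measurable_EFinP; exact: measurable_funM.
  apply: filterS (ae_and hKX' (pdensityE QX_PX)) => x [pK pE] _.
  rewrite lee_fin /W exprMn -pE [leRHS]mulrCA [leLHS]mulrC ler_wpM2l ?sqr_ge0//.
  by rewrite expr2 ler_wpM2r// pE pdensity_ge0.
have WC2 : L2 P (fun z => W (C z)) by exact: L2_law.
have phi2 : L2 P phi by exact: (L2_bounded P mphi phim).
have ns2 : L2 P ns.
  have -> : ns = (fun z => phi z * W (C z)).
    by apply/funext => z; rewrite /ns /W mulrC.
  exact: (L2_bM mphi phim WC2).
have I1 : intg P (fun=> 1 : R) by apply: (@intg_bounded _ _ _ _ `|1|).
have Ith : intg P (fun z => th (C z) * 1).
  apply: (@intg_bounded _ _ _ _ ((2 * m) ^+ 2)).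
    by apply: measurable_funM => //; exact: measurable_compC.
  by move=> z; rewrite mulr1; have /andP[h1 h2] := thm (C z); rewrite ger0_norm.
have If02 : intg P (fun z => f0 z ^+ 2).
  apply: (@intg_bounded _ _ _ _ ((2 * m) ^+ 2)); first exact: measurable_funX.
  by move=> z; rewrite ger0_norm ?sqr_ge0// ler_sqr_norm.
have iphi : ice phi (fun=> 0).
  have := ice_lin2 1 (-1) If02 Ith ith (ice_pullout mth I1 Ith (ice_cst P C 1)).
  by congr ice; apply/funext => z; rewrite /phi; ring.
have Iphi := L2_intg phi2.
(* [phi] has conditional mean zero, so any function of [C z] times it integrates to zero; this is
   the membership condition for the tangent space of a locally nonparametric model. *)
have ns0 : \int[P]_z ns z = 0.
  have [_ E] := ice_integral mW Iphi (L2_mul WC2 phi2) iphi.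
  rewrite /Rintegral E; under eq_integral do rewrite mulr0.
  by rewrite integral0.
have nt2 : L2 Q nt.
  have wC2 : L2 Q (fun z => w (C z)) by exact: L2_law.
  have mnt : measurable_fun setT nt.
    apply: measurable_funM => //; apply: measurable_funM; last exact: measurable_compC.
    apply: measurable_funM; last exact: measurable_compC.
    exact: measurable_funM.
  apply: (@L2_ae_le _ _ _ _ (2 * KZ * KX * (2 * m)) _ _ mnt wC2).
  have hC : {ae Q, forall z, `|density QX PX (C z)| <= KX}.
    by apply: (ae_comp (p := fun x => `|density QX PX x| <= KX)); exact: ae_dominates QX_PX hKX.
  apply: filterS (ae_and hKZ hC) => z [h1 h2].
  rewrite /nt !normrM (ger0_norm (ler0n _ 2)).
  have -> : 2 * `|density P Q z| * `|density QX PX (C z)| * `|w (C z)| * `|f0 z| =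
    2 * `|density P Q z| * `|density QX PX (C z)| * `|f0 z| * `|w (C z)| by ring.
  rewrite ler_wpM2r// ler_pM ?mulr_ge0// ler_pM ?mulr_ge0// ler_pM2l//.
split => //.
have t2P := L2_QP t2; have D2 := Df2 s2 t2P.
have iD := variance_derivativeP s2 t2P.
have D0L2 := variance_derivative_L2 s2 t2.
rewrite /L2dot (Rintegral_density QX_PX (L2_mul D0L2 w2)).
have IWD := L2_mul WC2 D2.
have [_ E] := ice_integral mW (L2_intg D2) IWD iD.
transitivity (\int[P]_z (W (C z) * Df s t z)).
  rewrite /Rintegral E; congr fine; apply: eq_integral => x _.
  by rewrite /W; congr EFin; ring.
(* [nt] is [b] times the density of [P] with respect to [Q], so pairing [t] with [nt] under [Q] is
   pairing it with [b] under [P]. *)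
pose b z := 2 * (W (C z) * f0 z).
have b2 : L2 P b.
  by apply: L2Z; under eq_fun do rewrite mulrC; exact: (L2_bM mf0 f0m WC2).
have -> : \int[Q]_z (t z * nt z) = \int[P]_z (t z * b z).
  rewrite (Rintegral_density PQ (L2_mul t2P b2)); apply: eq_Rintegral => z _.
  by rewrite /nt /b /W; ring.
rewrite -RintegralD//; [|exact: L2_mul|exact: L2_mul].
by apply: eq_Rintegral => z _; rewrite /ns /b /Df /W /phi; ring.
Qed.

End variance_derivative.

(** * Continuity from a norm bound, and the conclusion *)

Lemma Rintegral_ae_eq d (T : measurableType d) (R : realType)
    (mu : {measure set T -> \bar R}) (f g : T -> R) :
  measurable_fun setT f -> measurable_fun setT g ->
  {ae mu, forall x, f x = g x} -> \int[mu]_x f x = \int[mu]_x g x.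
Proof.
move=> mf mg fg; rewrite /Rintegral; congr fine; apply: ae_eq_integral => //.
- exact/measurable_EFinP.
- exact/measurable_EFinP.
- exact: ae_EFin.
Qed.

(** Linearity with coefficient -1 identifies, up to a null set, the increment of [D] with its value
    at the increment of the arguments, to which the bound applies. *)
Lemma continuous_linear_of_bound d1 d2 d3 (Z : measurableType d1)
    (T : measurableType d2) (Y : measurableType d3) (R : realType)
    (M : set (probability Z R)) (mu : {measure set T -> \bar R}) (U : set (T -> R))
    (nu : {measure set Y -> \bar R}) (P : probability Z R) (u : T -> R)
    (D : (Z -> R) -> (T -> R) -> Y -> R) (c : R) : 0 <= c ->
  (forall s t, L2 P s -> L2 mu t -> L2 nu (D s t)) ->
  (forall a s1 s2 t1 t2, L2 P s1 -> L2 P s2 -> L2 mu t1 -> L2 mu t2 ->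
    {ae nu, forall y, D (fun z => a * s1 z + s2 z) (fun z => a * t1 z + t2 z) y =
      a * D s1 t1 y + D s2 t2 y}) ->
  (forall s t, L2 P s -> L2 mu t -> (\int[nu]_y (D s t y ^+ 2)%:E <=
    c%:E * (\int[P]_z (s z ^+ 2)%:E + \int[mu]_z (t z ^+ 2)%:E))%E) ->
  continuous_linear M mu U nu P u D.
Proof.
move=> c0 D2 Dlin Dc; split.
- by move=> s t [s2 _] [t2 _]; exact: D2.
- move=> a s1 s2 t1 t2 [h1 _] [h2 _] [h3 _] [h4 _].
  by apply: filterS (Dlin a _ _ _ _ h1 h2 h3 h4) => y Dy _.
move=> s t [s2 _] [t2 _] e e0; have c1 : 0 < c + 1 by rewrite ltr_wpDl.
(* [c] times the square of this radius is below [e ^+ 2], also when [c] is 0. *)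
exists (e / (c + 1)); first by rewrite divr_gt0.
move=> s' t' [s'2 _] [t'2 _]; rewrite !L2norm_sqr => h.
have ds : L2 P (fun z => -1 * s z + s' z) by apply: L2D => //; exact: L2Z.
have dt : L2 mu (fun z => -1 * t z + t' z) by apply: L2D => //; exact: L2Z.
rewrite L2norm_lt//.
have mD := L2_measurable (D2 _ _ ds dt).
have mDs := L2_measurable (D2 _ _ s2 t2). have mDs' := L2_measurable (D2 _ _ s'2 t'2).
have -> : (\int[nu]_y ((D s' t' \- D s t)%R y ^+ 2)%:E =
    \int[nu]_y (D (fun z => -1 * s z + s' z)%R (fun z => -1 * t z + t' z)%R y ^+ 2)%:E)%E.
  apply: ae_eq_integral => //.
  - by apply/measurable_EFinP; apply: measurable_funX; exact: measurable_funB.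
  - by apply/measurable_EFinP; exact: measurable_funX.
  - by apply: filterS (Dlin (-1) _ _ _ _ s2 s'2 t2 t'2) => y /= -> _; rewrite mulN1r addrC.
apply: (le_lt_trans (Dc _ _ ds dt)).
apply: (@le_lt_trans _ _ (c%:E * ((e / (c + 1)) ^+ 2)%:E)%E).
  rewrite lee_wpmul2l// (le_trans _ (ltW h))// leeD//;
    rewrite le_eqVlt; apply/orP; left; apply/eqP; apply: eq_integral => z _;
    by rewrite /= mulN1r addrC.
rewrite -EFinM lte_fin expr_div_n mulrA ltr_pdivrMr ?exprn_gt0// mulrC.
by rewrite ltr_pM2l ?exprn_gt0//; nra.
Qed.

Theorem lemmaS10 (R : realType) (dZ dX : measure_display)
    (Z : measurableType dZ) (X : measurableType dX) (C : {mfun Z >-> X})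
    (M : set (probability Z R)) (Q : probability Z R) (m : R)
    (P : probability Z R) (u : Z -> R)
    (QX := distribution Q C) (PX := distribution P C)
    (U := Linfty_ball Q m)
    (theta := fun (P' : probability Z R) (u' : Z -> R) => cond_var P' C u')
    (M_equiv : forall P1 P2, M P1 -> M P2 -> P1 `<< P2)
    (MQ : M Q) (MP : M P) (Uu : U u)
    (M_np : locally_nonparametric M P)
    (QX_PX_bounded : ('N[PX]_+oo[RNderiv QX PX] < +oo)%E)
    (P_Q_bounded : ('N[Q]_+oo[RNderiv P Q] < +oo)%E) :
  totally_pathwise_differentiable M Q U QX theta P u /\
  forall D, is_total_derivative M Q U QX theta P u D ->
    is_adjoint M Q U QX P u D (fun w =>
      (fun z => density QX PX (C z) * w (C z) *
         ((u z - cond_exp P C u (C z)) ^+ 2 - theta P u (C z)),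
       fun z => 2 * density P Q z * density QX PX (C z) * w (C z) *
         (u z - cond_exp P C u (C z)))).
Proof.
have PQ : P `<< Q by exact: M_equiv.
have QP : Q `<< P by exact: M_equiv.
have dQX : QX `<< PX by exact: distribution_dominates.
have [KX KX0 hKX] := bounded_densityP dQX QX_PX_bounded.
have [KZ KZ0 hKZ] := bounded_densityP PQ P_Q_bounded.
have m0 := Linfty_ball_ge0 Uu.
have [mfu umQ] := (Linfty_ballP Q m u).1 Uu.
have um := ae_dominates PQ umQ.
have [u' [mu [th [[mfu' u'm uu'] [mmu mum imu cumu] [mth thm ith mcv cvth]]]]] :=
  cond_var_version C m0 mfu um.
pose D0 := variance_derivative C P u' mu th.
have L2P_D0 s t (s2 : L2 P s) (t2 : L2 Q t) : L2 QX (D0 s t).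
  exact: (variance_derivative_L2 PQ QP KX0 hKX KZ0 hKZ mfu' u'm mmu mum mth thm s2 t2).
have hD0 : is_total_derivative M Q U QX theta P u D0.
  split.
  (* The values of [theta] are square-integrable because each agrees almost everywhere with a
     bounded version; null sets of the law of [C] under [P'] are null for [QX]. *)
  - move=> P' v MP' Uv; have [mv vmQ] := (Linfty_ballP Q m v).1 Uv.
    have QP' : Q `<< P' by exact: M_equiv.
    have P'Q : P' `<< Q by exact: M_equiv.
    have [_ [_ [th' [_ _ [mth' th'm _ mcv' cvth']]]]] :=
      cond_var_version C m0 mv (ae_dominates P'Q vmQ).
    have QX' : QX `<< distribution P' C by exact: distribution_dominates.
    have e : {ae QX, forall x, th' x = cond_var P' C v x}.
      by apply: filterS (ae_dominates QX' cvth') => x ->.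
    apply: (L2_ae_eq mcv' e); apply: (L2_bounded _ (K := (2 * m) ^+ 2) mth') => x.
    by have /andP[h1 h2] := th'm x; rewrite ger0_norm.
  - apply: (continuous_linear_of_bound _ _ _ _ L2P_D0 _
      (variance_derivative_bound PQ QP KX0 hKX KZ0 hKZ mfu' u'm mmu mum mth thm)).
      apply: mulr_ge0; last exact: addr_ge0.
      by rewrite mulr_ge0// (exprM _ 2 2) addr_ge0// mulr_ge0// sqr_ge0.
    move=> a s1 s2 t1 t2 h1 h2 h3 h4; apply: (ae_dominates dQX).
    apply: (variance_derivative_lin C mfu' u'm mmu mum mth thm a h1 h2).
      exact: (L2_QP PQ KZ0 hKZ h3).
    exact: (L2_QP PQ KZ0 hKZ h4).
  - move=> s t Pe ue [s2 _] [t2 _] [MPe Pe0 Pes] [Uue uet].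
    apply: (cond_var_differentiable PQ QP m0 KX0 hKX KZ0 hKZ mfu' u'm mmu mum mth
      thm imu ith uu' mfu mcv cvth s2 t2) => //.
      by move=> e e01; split; apply: M_equiv => //; exact: MPe.
    move=> e e01; have [mue uem] := (Linfty_ballP Q m (ue e)).1 (Uue e e01).
    by split => //; exact: ae_dominates PQ uem.
split; first by exists D0.
move=> D hD w w2.
have Iu : intg P u.
  apply: (intg_ae_eq mfu _ (intg_bounded P mfu' u'm)).
  by apply: filterS uu' => z ->.
have mcu : measurable_fun setT (cond_exp P C u) by exact: ice_measurable (cond_expP C Iu).
have mw := L2_measurable w2.
have mp := measurable_density dQX. have mpZ := measurable_density PQ.
have mWC : measurable_fun setT (fun z => density QX PX (C z) * w (C z)).
  by apply: measurable_funM; exact: measurable_compC.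
have f0E : {ae P, forall z, u z - cond_exp P C u (C z) = u' z - mu (C z)}.
  by apply: filterS (ae_and uu' (ae_comp cumu)) => z [-> ->].
have cvE : {ae P, forall z, cond_var P C u (C z) = th (C z)} by exact: (ae_comp cvth).
have mf0 : measurable_fun setT (fun z => u z - cond_exp P C u (C z)).
  by apply: measurable_funB => //; exact: measurable_compC.
have adj s t (s2 : L2 P s) (t2 : L2 Q t) :=
  variance_derivative_adjoint PQ QP KX0 hKX KZ0 hKZ mfu' u'm mmu mum mth thm
    ith s2 t2 w2.
have [ns2 ns0 nt2 _] := adj _ _ (L2_0 P) (L2_0 Q).
(* [ns] and [nt] are built from the bounded versions, [ns'] and [nt'] are the expressions of the
   statement; every claim is proved for the former and carried over along almost everywhere
   equality. *)
set ns := fun z : Z => density QX PX (C z) * w (C z) * ((u' z - mu (C z)) ^+ 2 - th (C z)) in ns2 ns0.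
set nt := fun z : Z => 2 * density P Q z * density QX PX (C z) * w (C z) * (u' z - mu (C z)) in nt2.
set ns' := (X in (X, _)). set nt' := (X in (_, X)).
have nsE : {ae P, forall z, ns z = ns' z}.
  by apply: filterS (ae_and f0E cvE) => z [h1 h2]; rewrite /ns /ns' /theta h1 h2.
have ntE : {ae Q, forall z, nt z = nt' z}.
  by apply: filterS (ae_dominates QP f0E) => z h1; rewrite /nt /nt' h1.
have mns' : measurable_fun setT ns'.
  apply: measurable_funM => //; apply: measurable_funB; first exact: measurable_funX.
  exact: measurable_compC.
have mnt' : measurable_fun setT nt'.
  apply: measurable_funM => //; apply: measurable_funM; last exact: measurable_compC.
  apply: measurable_funM; last exact: measurable_compC.
  exact: measurable_funM.
have mns := L2_measurable ns2. have mnt := L2_measurable nt2.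
split => /=.
- rewrite [model_tangent_space _ _]M_np; split; first exact: L2_ae_eq mns' nsE ns2.
  by rewrite -(Rintegral_ae_eq mns mns' nsE).
- move: m0; rewrite le_eqVlt => /predU1P[m0|m0].
    apply: tangent_space_ae0 => //; apply: filterS ntE => z <-.
    have z0 (x : R) : `|x| <= m -> x = 0 by rewrite -m0 normr_le0 => /eqP.
    by rewrite /nt (z0 _ (u'm z)) (z0 _ (mum (C z))) subrr mulr0.
  by apply: ball_tangent_space => //; exact: L2_ae_eq mnt' ntE nt2.
- move=> s t hs ht; have [s2 _] := hs. have [t2 _] := ht.
  have [_ _ _ E] := adj _ _ s2 t2.
  have DD0 := total_derivative_unique MP Uu hD hD0 hs ht.
  have [_ [DL2 _ _] _] := hD.
  have mD := L2_measurable (DL2 _ _ hs ht). have mD0 := L2_measurable (L2P_D0 _ _ s2 t2).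
  have ms := L2_measurable s2. have mt := L2_measurable t2.
  transitivity (L2dot QX (D0 s t) w).
    apply: Rintegral_ae_eq; [exact: measurable_funM|exact: measurable_funM|].
    by apply: filterS DD0 => x ->.
  rewrite [LHS]E; congr (_ + _); apply: Rintegral_ae_eq; try exact: measurable_funM.
    by apply: filterS nsE => z <-.
  by apply: filterS ntE => z <-.
Qed.
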